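(* Let $1<p<\infty$, $1<q<\infty$, let $a$ and $b$ be normal form parameters, and let $C>0$. (i) If, for all $t>0$, $$\int_0^tx^{p'-1}a(x)\,dx\le C\int_0^tx^{p'-1}b(x)\,dx,$$ then $N_{p,q}(a)\le C^{1/p'}N_{p,q}(b)$. (ii) If $1<p\le q<\infty$, then $$\max\big((q')^{1/p'}A_2,\;K_{p,q}A_2^{(0)},\;K_{p,q}A_2^{(\infty)}\big)\le N_{p,q}(b)\le K_{p,q}A_2.$$ (iii) If $1<p\le q<\infty$ and $A_2^{(0)}=A_2$ or $A_2^{(\infty)}=A_2$, then $N_{p,q}(b)=K_{p,q}A_2$. Here, for $1<p\le q<\infty$, $$c_2(t)=t^{-1/q'}\bigg(\frac{p'}{q'}\int_0^tx^{p'-1}b(x)\,dx\bigg)^{1/p'}$$ and $$A_2=\sup_{t>0}c_2(t),\quad A_2^{(0)}=\liminf_{t\to0^+}c_2(t),\quad A_2^{(\infty)}=\liminf_{t\to\infty}c_2(t).$$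
   Context: $L^+$ is the set of Lebesgue measurable functions $(0,\infty)\to[0,\infty]$ and $\|\cdot\|_p$ is the usual $L^p$ norm for Lebesgue measure on $(0,\infty)$; $p',q'$ denote conjugate exponents, $\frac1p+\frac1{p'}=1$. A normal form parameter is a non-increasing function $b:(0,\infty)\to[0,\infty]$. Put $H_bf(x)=\int_0^{b(x)}f(t)\,dt$ for $f\in L^+$, and let $N_{p,q}(b)\in[0,\infty]$ be the smallest $C$ such that $\|H_bf\|_q\le C\|f\|_p$ for all $f\in L^+$ with $\|f\|_p<\infty$. For $1<p\le q<\infty$ the constant $K_{p,q}$ is $$K_{p,q}=p^{1/p}(p')^{1/p'}\ \text{ if }p=q,\qquad K_{p,q}=\Big(\frac{\Gamma(s)}{\Gamma(s/p)\Gamma(s/q')}\Big)^{1/s}\ \text{ if }p<q,\ \text{ where }\tfrac1s=\tfrac1p-\tfrac1q.$$ (By classical results of Hardy ($p=q$) and Bliss ($p<q$), $N_{p,q}(x^{-p'/q})=K_{p,q}$.) *)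

(* Defs.v *)
From HB Require Import structures.
From mathcomp Require Import all_boot all_order all_algebra.
From mathcomp Require Import all_classical all_reals all_analysis measurable_realfun.
Import Order.TTheory GRing.Theory Num.Theory.
Import numFieldNormedType.Exports.

Set Implicit Arguments.
Unset Strict Implicit.
Unset Printing Implicit Defensive.

Local Open Scope classical_set_scope.
Local Open Scope ring_scope.

(** [R] with the sigma-algebra of all Lebesgue measurable sets (in the sense of
    Caratheodory), instead of the Borel sets used by [lebesgue_measure]. *)
Definition lebesgueR (R : realType) : measurableType _ :=
  caratheodory_type ((wlength (@idfun R))^*)%mu.

Definition leb {R : realType} : {measure set (lebesgueR R) -> \bar R} :=
  @completed_lebesgue_measure R.

(** Functions on (0,+oo) are represented by functions on [R]; their values
    outside (0,+oo) never matter. *)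
Definition posR {R : realType} : set R := `]0, +oo[.

Definition Lplus (R : realType) (f : R -> \bar R) : Prop :=
  measurable_fun (posR : set (lebesgueR R)) (f : lebesgueR R -> \bar R) /\
  (forall x, 0 < x -> (0 <= f x)%E).

Definition Lpnorm (R : realType) (p : R) (f : R -> \bar R) : \bar R :=
  'N[@leb R]_(p%:E)[f \_ posR].

Definition normal_form (R : realType) (b : R -> \bar R) : Prop :=
  (forall x, 0 < x -> (0 <= b x)%E) /\
  (forall x y, 0 < x -> x <= y -> (b y <= b x)%E).

Definition Hop (R : realType) (b f : R -> \bar R) (x : R) : \bar R :=
  (\int[@leb R]_(t in [set t : R | (0 < t%:E < b x)%E]) f t)%E.

(** The set over which the infimum is taken always contains [+oo] (a null [f]
    has a null image, and [+oo * 0 = 0] in [\bar R]) and contains its infimum. *)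
Definition Nconst (R : realType) (p q : R) (b : R -> \bar R) : \bar R :=
  ereal_inf [set C : \bar R | (0 <= C)%E /\
    forall f : R -> \bar R, Lplus f -> (Lpnorm p f < +oo)%E ->
      (Lpnorm q (Hop b f) <= C * Lpnorm p f)%E].

(** 1/p + 1/(conjexp p) = 1 *)
Definition conjexp (R : realType) (p : R) : R := (1 - p^-1)^-1.

(** The Borel [lebesgue_measure] suffices here, the integrand being continuous. *)
Definition Gamma (R : realType) (s : R) : R :=
  \int[@lebesgue_measure R]_(x in `]0, +oo[) (x `^ (s - 1) * expR (- x)).

Definition Kconst (R : realType) (p q : R) : R :=
  if p == q then p `^ p^-1 * conjexp p `^ (conjexp p)^-1
  else let s := (p^-1 - q^-1)^-1 in
    (Gamma s / (Gamma (s / p) * Gamma (s / conjexp q))) `^ s^-1.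

Definition weighted_int (R : realType) (p : R) (b : R -> \bar R) (t : R) : \bar R :=
  (\int[@leb R]_(x in `]0%R, t[) ((x `^ (conjexp p - 1))%:E * b x))%E.

Definition c2 (R : realType) (p q : R) (b : R -> \bar R) (t : R) : \bar R :=
  ((t `^ (- (conjexp q)^-1))%:E *
   ((conjexp p / conjexp q)%:E * weighted_int p b t) `^ (conjexp p)^-1)%E.

Definition A2 (R : realType) (p q : R) (b : R -> \bar R) : \bar R :=
  ereal_sup [set c2 p q b t | t in posR].

Definition A2_0 (R : realType) (p q : R) (b : R -> \bar R) : \bar R :=
  limf_einf (c2 p q b) 0^'+.

Definition A2_oo (R : realType) (p q : R) (b : R -> \bar R) : \bar R :=
  limf_einf (c2 p q b) (pinfty_nbhs R).

(* Main.v *)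
(** For nonincreasing g, integrating the p'-th power of the adjoint
    t |-> \int_{b > t} g gives p' \int G^(p'-1) g b with G the primitive of g
    (Tonelli and a layer-cake formula).  Since G(x)/x and g are nonincreasing,
    Hardy's lemma bounds this by C times the same quantity for another weight
    when the integrals of x^(p'-1) against the weights compare on every ]0, t[.
    Testing with g a power of a truncation of H_a f turns this into (i).

    With b0(x) = x^(-p'/q), c_2(t)^p' is the ratio of the weighted integrals of
    b and b0 on ]0, t[, so the upper bound in (ii) is (i) against b0, and the
    lower bounds are (i) with b0 cut off near 0, resp. flattened on ]0, T[: such
    weights retain the constant K_{p,q} because the extremal functions for b0 can
    be rescaled towards the end that is kept.  The first lower bound is duality
    tested on g = 1_]0, t[.

    N(b0) <= K_{p,q} is Hardy's inequality for p = q.  For p < q it is proved by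
    mass transport: with F the primitive of f, w(x) = F(b0(x)) and
    s = 1/(1/p - 1/q), let Z transport w^q dx (normalised) onto
    (1 + z^(p'/s))^(-s) dz and put Y = Z^(1/s) x^(1 - 1/s).  Weighted AM-GM
    gives \int w^q <= c \int w^(q/p' + 1) Y', and integrating by parts followed
    by Hoelder's inequality bounds the right-hand side by the norms of f and w. *)

Require Import Defs.
From HB Require Import structures.
From mathcomp Require Import all_boot all_order all_algebra.
From mathcomp Require Import all_classical all_reals all_analysis measurable_realfun.
From mathcomp Require Import ring lra.
Import Order.TTheory GRing.Theory Num.Theory.
Import numFieldNormedType.Exports.
Set Implicit Arguments.
Unset Strict Implicit.
Unset Printing Implicit Defensive.
Local Open Scope classical_set_scope.
Local Open Scope ring_scope.

(** The density [phi(z) = (1 + z^th)^(-s)] is dictated by the extremal functions: for these, the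
    q-th power of the image is a multiple of a dilate of [phi], so [Z] is linear and the AM-GM step
    is an equality. The exponent [-s] makes [(Z')^(1/s)] equal to [(l w^q)^(1/s) (1 + Z^th)].
    Multiplying by [(l w^q)^(1 - 1/s)] gives [l w^q (1 + Z^th)], whose integral depends on [phi]
    alone, while the factor that multiplies [Y'] becomes [w^(q/p' + 1)], a power that integrates by
    parts.

    The p-th power of an extremal function is the same kind of density with [th = q/s]. By the Beta
    integral both densities have the same mass [m], a quotient of Gamma values, and [K = m^(-1/s)].

    Duality bounds an integral by a power of itself and then divides, so the integral must be known
    to be finite. This forces bounded functions with bounded support almost everywhere; monotone
    convergence removes the restriction at the end.

    For [p = q] the lower bound is approached by powers whose exponent is perturbed by [e], with [e]
    tending to 0. *)

Section lebesgueR.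
Context {R : realType}.
Local Notation L := (lebesgueR R).
Local Notation mu := (@lebesgue_measure R).

Lemma measurable_lebesgueR (A : set R) :
  measurable A -> measurable (A : set L).
Proof. exact: sub_caratheodory. Qed.

Lemma measurable_id_lebesgueR : measurable_fun [set: L] (idfun : L -> R).
Proof. by move=> _ A mA; rewrite setTI; exact: measurable_lebesgueR. Qed.

Lemma measurable_fun_lebesgueR d (T : measurableType d) (A : set R) (f : R -> T) :
  measurable A -> measurable_fun A f -> measurable_fun (A : set L) (f : L -> T).
Proof.
move=> mA mf _ B mB; apply: measurable_lebesgueR; exact: mf.
Qed.

Lemma lebE (A : set R) : measurable A -> leb A = mu A.
Proof. by []. Qed.

(** The identity is measurable from the Lebesgue to the Borel sigma-algebra and pushes [leb] forward
    to [lebesgue_measure], so this is the change of variables formula for a pushforward. *)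
Lemma ge0_integral_leb (A : set R) (f : R -> \bar R) :
  measurable A -> measurable_fun A f -> (forall x, A x -> (0 <= f x)%E) ->
  (\int[@leb R]_(x in A) f x = \int[mu]_(x in A) f x)%E.
Proof.
move=> mA mf f0.
rewrite -[LHS](@ge0_integral_pushforward _ _ L (measurableTypeR R) R (idfun : L -> R)
  measurable_id_lebesgueR (@leb R) A f)//.
by move=> x; rewrite inE; exact: f0.
Qed.

End lebesgueR.

(** * Integration on the half-line *)

Section Lplus_theory.
Context {R : realType}.
Local Notation L := (lebesgueR R).
Local Open Scope ereal_scope.

Lemma measurable_posR : measurable (posR : set L).
Proof. by apply: measurable_lebesgueR; exact: measurable_itv. Qed.

Lemma posRE (x : R) : posR x = (0 < x)%R.
Proof. by rewrite /posR /= in_itv/= andbT. Qed.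

Lemma measurable_EFin_lebesgueR (A : set L) :
  measurable_fun A ((fun t : R => t%:E) : L -> \bar R).
Proof.
apply: measurable_funTS.
apply: (measurable_fun_lebesgueR measurableT); exact: (@EFin_measurable R setT).
Qed.

Lemma Lplus_borel (f : R -> \bar R) : measurable_fun (posR : set R) f ->
  (forall x, (0 < x)%R -> 0 <= f x) -> Lplus f.
Proof.
move=> mf f0; split=> //; apply: measurable_fun_lebesgueR => //.
exact: measurable_itv.
Qed.

Lemma LplusM (f g : R -> \bar R) : Lplus f -> Lplus g -> Lplus (fun x => f x * g x).
Proof.
move=> [mf f0] [mg g0]; split; first exact: emeasurable_funM.
by move=> x x0; rewrite mule_ge0 ?f0 ?g0.
Qed.

Lemma Lplus_poweR (f : R -> \bar R) (r : R) : Lplus f -> Lplus (fun x => f x `^ r).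
Proof.
move=> [mf f0]; split; last by move=> x _; exact: poweR_ge0.
exact: (measurableT_comp (measurable_poweR r)).
Qed.

Lemma Lplus_cst (c : \bar R) : 0 <= c -> Lplus (cst c).
Proof. by move=> c0; split. Qed.

Lemma measurable_kernel (b : R -> \bar R) : Lplus b ->
  measurable_fun (posR `*` posR : set (L * L)%type)
    (fun z : L * L => (z.2 : R)%:E < b z.1).
Proof.
move=> [mb b0]; apply: measurable_fun_lte.
- apply: (@measurable_comp _ _ _ _ _ _ (posR : set L)) => //.
  + exact: measurable_posR.
  + by move=> _ [z [_ ?] <-].
  + exact: measurable_EFin_lebesgueR.
  + exact: measurable_funTS measurable_snd.
- apply: (@measurable_comp _ _ _ _ _ _ (posR : set L)) => //.
  + exact: measurable_posR.
  + by move=> _ [z [? _] <-].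
  + exact: measurable_funTS measurable_fst.
Qed.

Lemma Lplus_if (c : R -> bool) (f : R -> \bar R) :
  measurable_fun (posR : set L) (c : L -> bool) -> Lplus f ->
  Lplus (fun x => if c x then f x else 0).
Proof.
move=> mc [mf f0]; split; last by move=> x x0; case: ifPn => // _; exact: f0.
apply: measurable_fun_if => //; first exact: measurable_posR.
by apply: measurable_funS mf => //; exact: measurable_posR.
Qed.

Lemma integral_posR_ge0 (f : R -> \bar R) : Lplus f -> 0 <= \int[@leb R]_(x in posR) f x.
Proof. by move=> [_ f0]; apply: integral_ge0 => x; rewrite posRE; exact: f0. Qed.

Lemma integralZl_posR (c : \bar R) (f : R -> \bar R) : Lplus f -> 0 <= c ->
  \int[@leb R]_(x in posR) (c * f x) = c * \int[@leb R]_(x in posR) f x.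
Proof.
move=> [mf f0] c0; apply: (ge0_integralZl (@leb R) measurable_posR mf _ c0) => x.
by rewrite posRE; exact: f0.
Qed.

Lemma integralD_posR (f g : R -> \bar R) : Lplus f -> Lplus g ->
  \int[@leb R]_(x in posR) (f x + g x) =
  \int[@leb R]_(x in posR) f x + \int[@leb R]_(x in posR) g x.
Proof.
move=> [mf f0] [mg g0]; apply: (ge0_integralD (@leb R) measurable_posR) => //.
- by move=> x; rewrite posRE; exact: f0.
- by move=> x; rewrite posRE; exact: g0.
Qed.

Lemma LplusD (f g : R -> \bar R) : Lplus f -> Lplus g -> Lplus (fun x => f x + g x).
Proof.
move=> [mf f0] [mg g0]; split; first exact: emeasurable_funD.
by move=> x x0; rewrite adde_ge0 ?f0 ?g0.
Qed.

Lemma eq_integral_posR (f g : R -> \bar R) : (forall x, (0 < x)%R -> f x = g x) ->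
  \int[@leb R]_(x in posR) f x = \int[@leb R]_(x in posR) g x.
Proof. by move=> fg; apply: eq_integral => x /set_mem; rewrite posRE; exact: fg. Qed.

Lemma le_integral_posR (f g : R -> \bar R) : Lplus f -> Lplus g ->
  (forall x, (0 < x)%R -> f x <= g x) ->
  \int[@leb R]_(x in posR) f x <= \int[@leb R]_(x in posR) g x.
Proof.
move=> [mf f0] [mg g0] fg; apply: (ge0_le_integral (@leb R) measurable_posR _ mf mg) => x.
  by rewrite posRE; exact: f0.
by rewrite posRE; exact: fg.
Qed.

Lemma eq_Lplus (f g : R -> \bar R) : (forall x, (0 < x)%R -> f x = g x) ->
  Lplus f -> Lplus g.
Proof.
move=> fg [mf f0]; split; last by move=> x x0; rewrite -fg//; exact: f0.
by apply: (eq_measurable_fun _ _ mf) => x /set_mem; rewrite posRE => x0; rewrite fg.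
Qed.

Lemma measurable_lt_Lplus (b : R -> \bar R) (t : \bar R) : Lplus b ->
  measurable_fun (posR : set L) (fun x : L => t < b x).
Proof.
by move=> b0; apply: measurable_fun_lte; [exact: measurable_cst|exact: b0.1].
Qed.

Lemma measurable_EFin_lt (y : \bar R) :
  measurable_fun (posR : set L) (fun t : L => (t : R)%:E < y).
Proof.
by apply: measurable_fun_lte; [exact: measurable_EFin_lebesgueR|exact: measurable_cst].
Qed.

Lemma integral_posR_if (c : R -> bool) (A : set R) (f : R -> \bar R) :
  (forall x, A x <-> (0 < x)%R /\ c x) ->
  \int[@leb R]_(x in A) f x = \int[@leb R]_(x in posR) (if c x then f x else 0).
Proof.
move=> Ac; rewrite (_ : A = (posR : set L) `&` [set x : R | c x]); last first.
  by apply/seteqP; split=> x /=; rewrite posRE; move/Ac.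
rewrite integral_mkcondr; apply: eq_integral => x _.
by rewrite patchE mem_setE.
Qed.

End Lplus_theory.

(** * The adjoint operator *)

Section tonelli.
Context {R : realType}.
Local Notation L := (lebesgueR R).
Local Open Scope ereal_scope.

Definition adj (b g : R -> \bar R) (t : R) : \bar R :=
  \int[@leb R]_(x in [set x : R | (0 < x)%R /\ t%:E < b x]) g x.

Lemma tonelli_posR (k : R -> R -> \bar R) :
  measurable_fun (posR `*` posR : set (L * L)%type) (fun z : L * L => k z.1 z.2) ->
  (forall x t, (0 < x)%R -> (0 < t)%R -> 0 <= k x t) ->
  \int[@leb R]_(x in posR) \int[@leb R]_(t in posR) k x t =
  \int[@leb R]_(t in posR) \int[@leb R]_(x in posR) k x t.
Proof.
move=> mk k0.
(* Extension by zero turns the iterated integrals over the quadrant into iterated integrals over the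
   plane, where Tonelli applies. *)
pose h : (L * L)%type -> \bar R := (fun z : L * L => k z.1 z.2) \_ (posR `*` posR).
have mh : measurable_fun setT h.
  have mDD : measurable (posR `*` posR : set (L * L)%type).
    by apply: measurableX; exact: measurable_posR.
  have := (measurable_restrict (fun z : L * L => k z.1 z.2) mDD (@measurableT _ _)).1.
  by rewrite setTI; exact.
have h0 z : 0 <= h z.
  rewrite /h patchE; case: ifPn => // /set_mem [/=].
  by rewrite !posRE => ? ?; exact: k0.
have := fubini_tonelli (m1 := @leb R) (m2 := @leb R) h mh h0.
have E1 x : \int[@leb R]_t h (x, t) =
    ((fun x => \int[@leb R]_(t in posR) k x t) \_ posR) x.
  rewrite patchE; case: ifPn => [/set_mem x0|x0].
    rewrite [in RHS]integral_mkcond; apply: eq_integral => t _.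
    rewrite /h !patchE; congr (if _ then _ else _).
    by apply/idP/idP => [/set_mem[]|/set_mem ?] /=; rewrite ?inE//; split.
  apply: integral0_eq => t _; rewrite /h patchE; case: ifPn => // /set_mem[/= ? _].
  by case/negP: x0; rewrite inE.
have E2 t : \int[@leb R]_x h (x, t) =
    ((fun t => \int[@leb R]_(x in posR) k x t) \_ posR) t.
  rewrite patchE; case: ifPn => [/set_mem x0|x0].
    rewrite [in RHS]integral_mkcond; apply: eq_integral => x _.
    rewrite /h !patchE; congr (if _ then _ else _).
    by apply/idP/idP => [/set_mem[]|/set_mem ?] /=; rewrite ?inE//; split.
  apply: integral0_eq => x _; rewrite /h patchE; case: ifPn => // /set_mem[/= _ ?].
  by case/negP: x0; rewrite inE.
move=> F; rewrite [LHS]integral_mkcond [RHS]integral_mkcond.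
transitivity (\int[@leb R]_x \int[@leb R]_y h (x, y)).
  by apply: eq_integral => x _; exact/esym/E1.
by rewrite F; apply: eq_integral => x _; exact/E2.
Qed.

Lemma Lplus_integral (k : R -> R -> \bar R) :
  measurable_fun (posR `*` posR : set (L * L)%type) (fun z : L * L => k z.1 z.2) ->
  (forall x t, (0 < x)%R -> (0 < t)%R -> 0 <= k x t) ->
  Lplus (fun x => \int[@leb R]_(t in posR) k x t).
Proof.
move=> mk k0; split; last first.
  by move=> x x0; apply: integral_ge0 => t; rewrite posRE => t0; exact: k0.
pose h : (L * L)%type -> \bar R := (fun z : L * L => k z.1 z.2) \_ (posR `*` posR).
have mh : measurable_fun setT h.
  have mDD : measurable (posR `*` posR : set (L * L)%type).
    by apply: measurableX; exact: measurable_posR.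
  have := (measurable_restrict (fun z : L * L => k z.1 z.2) mDD (@measurableT _ _)).1.
  by rewrite setTI; exact.
have h0 z : 0 <= h z.
  rewrite /h patchE; case: ifPn => // /set_mem [/=].
  by rewrite !posRE => ? ?; exact: k0.
have := measurable_fun_fubini_tonelli_F (m2 := @leb R) h mh h0.
move=> mF; apply: (@eq_measurable_fun _ _ _ _ _ (fubini_F (@leb R) h)); last exact: measurable_funTS mF.
move=> x /set_mem x0.
rewrite [RHS]integral_mkcond; apply: eq_integral => t _.
rewrite /h !patchE; congr (if _ then _ else _).
by apply/idP/idP => [/set_mem[]|/set_mem ?] /=; rewrite ?inE//; split.
Qed.

Lemma Hop_if (b f : R -> \bar R) x :
  Hop b f x = \int[@leb R]_(t in posR) (if t%:E < b x then f t else 0).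
Proof.
by apply: integral_posR_if => t /=; rewrite lte_fin; split=> [/andP|[-> ->]].
Qed.

Lemma adj_if (b g : R -> \bar R) t :
  adj b g t = \int[@leb R]_(x in posR) (if t%:E < b x then g x else 0).
Proof. by apply: integral_posR_if => x. Qed.

Lemma measurable_kernel_fun (b : R -> \bar R) (k : L * L -> \bar R) : Lplus b ->
  measurable_fun (posR `*` posR : set (L * L)%type) k ->
  measurable_fun (posR `*` posR : set (L * L)%type)
    (fun z : L * L => if (z.2 : R)%:E < b z.1 then k z else 0).
Proof.
move=> b0 mk; have mDD : measurable (posR `*` posR : set (L * L)%type).
  by apply: measurableX; exact: measurable_posR.
apply: measurable_fun_if => //; first exact: measurable_kernel.
by apply: measurable_funS mk => // z [].
Qed.

Lemma measurable_fst_posR (f : R -> \bar R) : Lplus f ->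
  measurable_fun (posR `*` posR : set (L * L)%type) (fun z : L * L => f z.1).
Proof.
move=> [mf _]; apply: (@measurable_comp _ _ _ _ _ _ (posR : set L)) => //.
- exact: measurable_posR.
- by move=> _ [z [? _] <-].
- exact: measurable_funTS measurable_fst.
Qed.

Lemma measurable_snd_posR (f : R -> \bar R) : Lplus f ->
  measurable_fun (posR `*` posR : set (L * L)%type) (fun z : L * L => f z.2).
Proof.
move=> [mf _]; apply: (@measurable_comp _ _ _ _ _ _ (posR : set L)) => //.
- exact: measurable_posR.
- by move=> _ [z [_ ?] <-].
- exact: measurable_funTS measurable_snd.
Qed.

Lemma Lplus_Hop (b f : R -> \bar R) : Lplus b -> Lplus f -> Lplus (Hop b f).
Proof.
move=> b0 f0; rewrite (funext (Hop_if b f)).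
apply: Lplus_integral.
  by apply: measurable_kernel_fun => //; exact: measurable_snd_posR.
by move=> x t x0 t0; case: ifPn => // _; exact: f0.2.
Qed.

Lemma measurable_swap_posR (k : L * L -> \bar R) :
  measurable_fun (posR `*` posR : set (L * L)%type) k ->
  measurable_fun (posR `*` posR : set (L * L)%type) (fun z : L * L => k (z.2, z.1)).
Proof.
move=> mk; apply: (@measurable_comp _ _ _ _ _ _ (posR `*` posR : set (L * L)%type) k _
  (fun z : L * L => (z.2, z.1))) => //.
- by apply: measurableX; exact: measurable_posR.
- by move=> _ [z [? ?] <-]; split.
- apply: measurable_funTS; apply: (measurable_fun_pair (f := @snd L L) (g := @fst L L)).
    exact: measurable_snd.
  exact: measurable_fst.
Qed.

Lemma Lplus_adj (b g : R -> \bar R) : Lplus b -> Lplus g -> Lplus (adj b g).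
Proof.
move=> b0 g0; rewrite (funext (adj_if b g)).
apply: Lplus_integral.
  apply: (measurable_swap_posR (k := fun z => if (z.2:R)%:E < b z.1 then g z.1 else 0)).
  by apply: measurable_kernel_fun => //; exact: measurable_fst_posR.
by move=> x t x0 t0; case: ifPn => // _; exact: g0.2.
Qed.

(** Both sides are the double integral of [f t * g x] over the region [t < b x]. Later proofs use
    this identity also as their layer-cake formula and as integration by parts. *)
Lemma Hop_adj (b f g : R -> \bar R) : Lplus b -> Lplus f -> Lplus g ->
  \int[@leb R]_(x in posR) (g x * Hop b f x) =
  \int[@leb R]_(t in posR) (f t * adj b g t).
Proof.
move=> b0 f0 g0.
transitivity (\int[@leb R]_(x in posR) \int[@leb R]_(t in posR)
    (if t%:E < b x then f t * g x else 0)).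
  apply: eq_integral_posR => x x0; rewrite Hop_if -integralZl_posR.
  - by apply: eq_integral_posR => t _; case: ifPn => _; rewrite ?mule0// muleC.
  - by apply: Lplus_if f0; exact: measurable_EFin_lt.
  - exact: g0.2.
rewrite tonelli_posR; last 2 first.
  - apply: (measurable_kernel_fun (k := fun z => f z.2 * g z.1)) => //.
    by apply: emeasurable_funM; [exact: measurable_snd_posR|exact: measurable_fst_posR].
  - move=> x t x0 t0; case: ifPn => // _.
    by rewrite mule_ge0// ?f0.2 ?g0.2.
apply: eq_integral_posR => t t0; rewrite adj_if -integralZl_posR.
- by apply: eq_integral_posR => x _; case: ifPn => _; rewrite ?mule0.
- by apply: Lplus_if g0; exact: measurable_lt_Lplus.
- exact: f0.2.
Qed.

End tonelli.

(** * Hoelder's inequality for functions with values in [[0, +oo]] *)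

Section hoelder_posR.
Context {R : realType}.
Local Notation L := (lebesgueR R).
Local Open Scope ereal_scope.

Lemma powR_inv (x r : R) : (0 < x)%R -> ((x^-1) `^ r = (x `^ r)^-1)%R.
Proof. by move=> x0; rewrite -powR_inv1 ?ltW// -powRrM mulN1r powRN. Qed.

Lemma LpnormE (p : R) (f : R -> \bar R) : p != 0%R -> Lplus f ->
  Lpnorm p f = (\int[@leb R]_(x in posR) (f x `^ p)) `^ p^-1.
Proof.
move=> p0 [_ f0]; rewrite /Lpnorm unlock; congr (_ `^ _).
rewrite [RHS]integral_mkcond; apply: eq_integral => x _; rewrite !patchE.
case: ifPn => [/set_mem|_]; first by rewrite posRE => /f0 fx; rewrite gee0_abs.
by rewrite abse0 poweR0r.
Qed.

(** Young's inequality for [x / c] and [y / d], multiplied by [c * d]. With [c] and [d] the two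
    norms, the normalisation in Hoelder's inequality sits in real coefficients and no extended real
    is divided. *)
Lemma young_ereal (x y : \bar R) (p q c d : R) : (0 < p)%R -> (0 < q)%R ->
  (p^-1 + q^-1 = 1)%R -> (0 < c)%R -> (0 < d)%R -> 0 <= x -> 0 <= y ->
  x * y <= (c * d / (p * c `^ p))%:E * x `^ p + (c * d / (q * d `^ q))%:E * y `^ q.
Proof.
move=> p0 q0 pq c0 d0.
have cp : (0 < c `^ p)%R by rewrite powR_gt0.
have dq : (0 < d `^ q)%R by rewrite powR_gt0.
have k1 : (0 < c * d / (p * c `^ p))%R by rewrite divr_gt0 ?mulr_gt0.
have k2 : (0 < c * d / (q * d `^ q))%R by rewrite divr_gt0 ?mulr_gt0.
case: x => [x| |] // x0; case: y => [y| |] // y0.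
- rewrite !poweR_EFin -!EFinM -EFinD lee_fin.
  rewrite !lee_fin in x0 y0.
  have := @conjugate_powR _ (x / c)%R (y / d)%R p q.
  rewrite !divr_ge0// ?(ltW c0)// ?(ltW d0)// => /(_ isT isT p0 q0 pq).
  rewrite !powRM ?invr_ge0 ?(ltW c0) ?(ltW d0)//.
  rewrite !powR_inv// => H.
  have := ler_wpM2l (ltW (mulr_gt0 c0 d0)) H.
  set X := (x `^ p)%R; set Y := (y `^ q)%R.
  rewrite (_ : c * d * (x / c * (y / d)) = x * y)%R; last first.
    by field; rewrite !gt_eqF.
  move=> /le_trans; apply; rewrite le_eqVlt; apply/orP; left; apply/eqP.
  by field; rewrite !gt_eqF.
- by rewrite poweRyr ?gt_eqF// [X in _ <= _ + X]gt0_muley ?lte_fin// addey ?leey// poweR_EFin -EFinM.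
- by rewrite poweRyr ?gt_eqF// [X in _ <= X + _]gt0_muley ?lte_fin// addye ?leey// poweR_EFin -EFinM.
- by rewrite !poweRyr ?gt_eqF// !gt0_muley ?lte_fin.
Qed.

(** A null p-norm makes [f] vanish almost everywhere, and [0 * +oo = 0] covers the points where [g]
    is infinite. This is the degenerate case of Hoelder's inequality. *)
Lemma integral_posR_eq0 (f g : R -> \bar R) (p : R) : (0 < p)%R -> Lplus f -> Lplus g ->
  \int[@leb R]_(x in posR) (f x `^ p) = 0 ->
  \int[@leb R]_(x in posR) (f x * g x) = 0.
Proof.
move=> p0 f0 g0 f_eq0.
have fp := Lplus_poweR p f0.
have : \int[@leb R]_(x in posR) `|f x `^ p| = 0.
  rewrite -f_eq0; apply: eq_integral_posR => x x0; rewrite gee0_abs//; exact: fp.2.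
move/(ae_eq_integral_abs (@leb R) measurable_posR fp.1) => H.
rewrite -(integral0 (@leb R) (posR : set L)).
apply: ae_eq_integral; [exact: measurable_posR|exact: (LplusM f0 g0).1|exact: measurable_cst|].
apply: filterS H => x /= /[swap] Dx /(_ Dx).
move=> /poweR_eq0_eq0 ->; rewrite ?mul0e//.
by rewrite posRE in Dx; exact: f0.2.
Qed.

Lemma hoelder_posR (p q : R) (f g : R -> \bar R) : (0 < p)%R -> (0 < q)%R ->
  (p^-1 + q^-1 = 1)%R -> Lplus f -> Lplus g ->
  \int[@leb R]_(x in posR) (f x * g x) <=
  (\int[@leb R]_(x in posR) (f x `^ p)) `^ p^-1 *
  (\int[@leb R]_(x in posR) (g x `^ q)) `^ q^-1.
Proof.
move=> p0 q0 pq f0 g0.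
have fp := Lplus_poweR p f0; have gq := Lplus_poweR q g0.
have [A0|A0] := eqVneq (\int[@leb R]_(x in posR) (f x `^ p)) 0.
  by rewrite (integral_posR_eq0 p0)// mule_ge0// poweR_ge0.
have [B0|B0] := eqVneq (\int[@leb R]_(x in posR) (g x `^ q)) 0.
  under eq_integral do rewrite muleC.
  by rewrite (integral_posR_eq0 q0)// mule_ge0// poweR_ge0.
move: A0 B0 (integral_posR_ge0 fp) (integral_posR_ge0 gq).
case EA : (integral _ _ _) => [A| |] //; last first.
  move=> _ B0 _ B0'; rewrite poweRyr ?invr_neq0 ?gt_eqF// gt0_mulye ?leey//.
  by rewrite poweR_gt0// lt0e B0.
case EB : (integral _ _ _) => [B| |] //; last first.
  move=> A0 _ A0' _; rewrite (poweRyr (r := q^-1)) ?invr_neq0 ?gt_eqF// gt0_muley ?leey//.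
  by rewrite poweR_gt0// lt0e A0.
move=> A0 B0 A1 B1.
have {A0 A1}A0 : (0 < A)%R by rewrite -lte_fin lt0e A0.
have {B0 B1}B0 : (0 < B)%R by rewrite -lte_fin lt0e B0.
(* Both norms are now positive reals [c] and [d]; for these the two Young terms integrate to
   [c * d / p] and [c * d / q]. *)
rewrite !poweR_EFin -EFinM.
set c := (A `^ p^-1)%R; set d := (B `^ q^-1)%R.
have c0 : (0 < c)%R by rewrite powR_gt0.
have d0 : (0 < d)%R by rewrite powR_gt0.
have cp : (c `^ p = A)%R by rewrite -powRrM mulVf ?powRr1 ?gt_eqF// ltW.
have dq : (d `^ q = B)%R by rewrite -powRrM mulVf ?powRr1 ?gt_eqF// ltW.
clearbody c d.
have k1 : (0 < c * d / (p * c `^ p))%R by rewrite divr_gt0 ?mulr_gt0 ?powR_gt0.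
have k2 : (0 < c * d / (q * d `^ q))%R by rewrite divr_gt0 ?mulr_gt0 ?powR_gt0.
have k1e : 0 <= (c * d / (p * c `^ p))%:E by rewrite lee_fin (ltW k1).
have k2e : 0 <= (c * d / (q * d `^ q))%:E by rewrite lee_fin (ltW k2).
have h1 := LplusM (Lplus_cst k1e) fp.
have h2 := LplusM (Lplus_cst k2e) gq.
apply: (@le_trans _ _ (\int[@leb R]_(x in posR)
  ((c * d / (p * c `^ p))%:E * f x `^ p + (c * d / (q * d `^ q))%:E * g x `^ q))).
  apply: le_integral_posR; [exact: LplusM|exact: LplusD|].
  by move=> x x0; apply: young_ereal => //; [exact: f0.2|exact: g0.2].
rewrite (integralD_posR h1 h2) (integralZl_posR fp k1e) (integralZl_posR gq k2e) EA EB.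
rewrite -!EFinM -EFinD lee_fin cp dq.
rewrite (_ : (_ + _)%R = (c * d * (p^-1 + q^-1))%R); first by rewrite pq mulr1.
field.
by rewrite !gt_eqF.
Qed.

End hoelder_posR.

(** * Primitives *)

Section ftc.
Context {R : realType}.
Local Notation mu := (@lebesgue_measure R).
Implicit Types (g G : R -> R) (a b la lb : R).

(** The set is exhausted by compact intervals: monotone convergence gives the limit of the
    integrals, and the ordinary fundamental theorem identifies them as differences of [G]. Only
    limits of [G] at the ends are needed, so improper integrals are included. *)
Lemma ge0_FTC_bigcup g G (u v : nat -> R) (A : set R) la lb :
  A = \bigcup_n `[u n, v n]%classic -> (forall n, u n < v n) ->
  {homo u : m n / (m <= n)%N >-> n <= m} -> {homo v : m n / (m <= n)%N >-> m <= n} ->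
  (forall x, A x -> is_derive x 1 G (g x)) ->
  (forall x, A x -> {for x, continuous g}) ->
  (forall x, A x -> 0 <= g x) ->
  G (u n) @[n --> \oo] --> la -> G (v n) @[n --> \oo] --> lb ->
  (\int[@leb R]_(x in A) (g x)%:E = (lb - la)%:E)%E.
Proof.
move=> AE uv nu nv dG cg g0 Gu Gv.
have sub n : `[u n, v n]%classic `<=` A by rewrite AE => x ?; exists n.
have cgn n : {within `[u n, v n], continuous g}.
  by apply: continuous_in_subspaceT => x /set_mem /sub; exact: cg.
have mgn n : measurable_fun (`[u n, v n]%classic : set R) (EFin \o g).
  by apply/measurable_EFinP; apply: subspace_continuous_measurable_fun.
have mA : measurable (A : set R) by rewrite AE; exact: bigcup_measurable.
have mg : measurable_fun (A : set R) (EFin \o g).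
  by rewrite AE; apply/measurable_fun_bigcup.
rewrite ge0_integral_leb//.
have cvI : (\int[mu]_(x in `[u n, v n]) (g x)%:E @[n --> \oo] -->
    \int[mu]_(x in A) (g x)%:E)%E.
  have := @ge0_nondecreasing_set_cvg_integral _ (measurableTypeR R) R
    (fun n => `[u n, v n]%classic) (EFin \o g) mu.
  rewrite AE; apply => //.
    move=> m n mn; apply/subsetPset => x /=; rewrite !in_itv/= => /andP[ux xv].
    by rewrite (le_trans (nu _ _ mn))// (le_trans xv)// nv.
  by move=> n x /sub /g0; rewrite lee_fin.
have cvJ : (\int[mu]_(x in `[u n, v n]) (g x)%:E @[n --> \oo] --> (lb - la)%:E)%E.
  rewrite (_ : (fun n => _) = EFin \o (fun n => G (v n) - G (u n))); last first.
    apply/funext => n /=; rewrite (@continuous_FTC2 _ g G) ?EFinB//.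
    - have dn x : x \in `[u n, v n] -> derivable G x 1.
        by move=> xuv; have := dG x (sub n x xuv); case.
      have cn x : x \in `[u n, v n] -> {for x, continuous G}.
        by move=> /dn /derivable1_diffP /differentiable_continuous.
      split.
      + by move=> x xuv; apply: dn; exact: subset_itv_oo_cc.
      + by apply: cvg_at_right_filter; apply: cn; rewrite in_itv/= lexx ltW.
      + by apply: cvg_at_left_filter; apply: cn; rewrite in_itv/= lexx ltW.
    - move=> x xuv; rewrite derive1E; apply: derive_val.
      by apply: dG; apply: (sub n); exact: subset_itv_oo_cc.
  by apply: cvg_EFin; [exact: nearW|exact: cvgB].
exact: (cvg_unique _ cvI cvJ).
Qed.

Lemma ge0_FTC_oo g G a b la lb : a < b ->
  (forall x, a < x < b -> is_derive x 1 G (g x)) ->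
  (forall x, a < x < b -> {for x, continuous g}) ->
  (forall x, a < x < b -> 0 <= g x) ->
  G x @[x --> a^'+] --> la -> G x @[x --> b^'-] --> lb ->
  (\int[@leb R]_(x in `]a, b[) (g x)%:E = (lb - la)%:E)%E.
Proof.
move=> ab dG cg g0 Ga Gb.
have d0 : 0 < (b - a) / 3 by rewrite divr_gt0 ?subr_gt0.
(* As [harmonic n <= 1], the factor 1/3 keeps [a + d n < b - d n] from [n = 0] on. *)
pose d n : R := (b - a) / 3 * harmonic n.
have dn0 n : 0 < d n by rewrite mulr_gt0// harmonic_gt0.
have dn1 n : d n <= (b - a) / 3.
  by rewrite ger_pMr// invf_le1 ?ltr0n// ler1n.
have cd : d n @[n --> \oo] --> 0.
  by rewrite -(mulr0 ((b - a) / 3)); apply: cvgMr; exact: cvg_harmonic.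
have nd m n : (m <= n)%N -> d n <= d m.
  by move=> mn; rewrite ler_pM2l// lef_pV2 ?posrE ?ltr0n// ler_nat.
apply: (@ge0_FTC_bigcup g G (fun n => a + d n) (fun n => b - d n)).
- apply/seteqP; split=> x /=.
    rewrite in_itv/= => /andP[ax xb].
    have e0 : 0 < Num.min (x - a) (b - x) by rewrite lt_min !subr_gt0 ax xb.
    have [n _ /(_ n (leqnn n)) /=] := (cvgrPdist_lt _ _).1 cd _ e0.
    rewrite sub0r normrN gtr0_norm// lt_min => /andP[h1 h2]; exists n => //=.
    by rewrite in_itv/=; apply/andP; split; lra.
  move=> [n _] /=; rewrite !in_itv/= => /andP[h1 h2]; have := dn0 n.
  by move=> ?; apply/andP; split; lra.
- by move=> n; have := dn1 n; lra.
- by move=> m n /nd; rewrite lerD2l.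
- by move=> m n /nd; rewrite lerD2l lerN2.
- by move=> x /=; rewrite in_itv; exact: cg.
- by move=> x /=; rewrite in_itv; exact: g0.
- apply: ((cvg_at_rightP G a la).1 Ga); split; first by move=> n; rewrite ltrDl.
  by rewrite -[X in _ --> X]addr0; apply: cvgD cd; exact: cvg_cst.
- apply: ((cvg_at_leftP G b lb).1 Gb); split; first by move=> n; rewrite ltrBlDr ltrDl.
  by rewrite -[X in _ --> X]subr0; apply: cvgB cd; exact: cvg_cst.
Qed.

Lemma ge0_FTC_oy g G a la lb :
  (forall x, a < x -> is_derive x 1 G (g x)) ->
  (forall x, a < x -> {for x, continuous g}) ->
  (forall x, a < x -> 0 <= g x) ->
  G x @[x --> a^'+] --> la -> G x @[x --> +oo] --> lb ->
  (\int[@leb R]_(x in `]a, +oo[) (g x)%:E = (lb - la)%:E)%E.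
Proof.
move=> dG cg g0 Ga Gb.
have nd m n : (m <= n)%N -> @harmonic R n <= harmonic m.
  by move=> mn; rewrite lef_pV2 ?posrE ?ltr0n// ler_nat.
(* [harmonic 0 = 1], so the right end starts at [a + 2] to stay strictly above the left one. *)
apply: (@ge0_FTC_bigcup g G (fun n => a + harmonic n) (fun n => a + n.+2%:R)).
- apply/seteqP; split=> x /=.
    rewrite in_itv/= andbT => ax.
    have e0 : 0 < x - a by rewrite subr_gt0.
    have [n _ /(_ _ (leq_addr (Num.truncn (x - a)) n)) /=] := (cvgrPdist_lt _ _).1 (@cvg_harmonic R) _ e0.
    rewrite sub0r normrN gtr0_norm ?harmonic_gt0// => h1.
    exists (n + Num.truncn (x - a))%N => //=.
    rewrite in_itv/=; apply/andP; split; first by rewrite -lerBrDl (ltW h1).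
    have : x - a < (Num.truncn (x - a)).+1%:R by exact: truncnS_gt.
    have : (Num.truncn (x - a)).+1%:R <= (n + Num.truncn (x - a)).+2%:R :> R.
      by rewrite ler_nat ltnS (leq_trans (leq_addl n _)).
    lra.
  move=> [n _] /=; rewrite !in_itv/= => /andP[h1 h2]; have := harmonic_gt0 n (R := R).
  by rewrite andbT => h0; rewrite (lt_le_trans _ h1)// ltrDl.
- move=> n; rewrite ltrD2l (@le_lt_trans _ _ 1)//; last by rewrite ltr1n.
  by rewrite invf_le1 ?ltr0n// ler1n.
- by move=> m n /nd; rewrite lerD2l.
- by move=> m n mn; rewrite lerD2l ler_nat !ltnS.
- by move=> x /=; rewrite in_itv/= andbT; exact: dG.
- by move=> x /=; rewrite in_itv/= andbT; exact: cg.
- by move=> x /=; rewrite in_itv/= andbT; exact: g0.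
- apply: ((cvg_at_rightP G a la).1 Ga); split; first by move=> n; rewrite ltrDl harmonic_gt0.
  by rewrite -[X in _ --> X]addr0; apply: cvgD; [exact: cvg_cst|exact: cvg_harmonic].
- apply: ((cvg_pinftyP G lb).1 Gb); apply/cvgryPge => M.
  near=> n; have : M - a <= n.+2%:R.
    rewrite (le_trans (y := n%:R))//; last by rewrite ler_nat -addn2 leq_addr.
    by near: n; exact: nbhs_infty_ger.
  lra.
Unshelve. all: by end_near.
Qed.

End ftc.

Section primitive.
Context {R : realType}.
Local Notation L := (lebesgueR R).
Local Open Scope ereal_scope.

Lemma Lplus_sub (A : set R) (f : R -> \bar R) : A `<=` posR -> Lplus f ->
  measurable_fun (A : set L) f.
Proof. by move=> Asub [mf _]; apply: measurable_funS mf => //; exact: measurable_posR. Qed.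

Lemma integral_oc (f : R -> \bar R) (c : R) : (0 < c)%R -> Lplus f ->
  \int[@leb R]_(x in `]0%R, c]) f x = \int[@leb R]_(x in `]0%R, c[) f x.
Proof.
move=> c0 f0; rewrite (@ge0_negligible_integral _ L R (@leb R) (`]0%R, c]%classic : set L) [set c] f).
- congr (integral _ _ _); apply/seteqP; split=> x /=; rewrite !in_itv/=.
    by move=> [/andP[-> xc] /eqP xnc]; rewrite lt_neqAle xnc.
  by move=> /andP[-> xc]; split; [exact: ltW|apply/eqP; rewrite lt_eqF].
- by apply: measurable_lebesgueR; exact: measurable_set1.
- by apply: measurable_lebesgueR; exact: measurable_itv.
- by apply: Lplus_sub f0 => x /=; rewrite posRE in_itv/= => /andP[].
- by move=> x /=; rewrite in_itv/= => /andP[? _]; exact: f0.2.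
- by rewrite lebE; [exact: lebesgue_measure_set1|exact: measurable_set1].
Qed.

Lemma le_integral_subset (A B : set R) (f : R -> \bar R) : measurable A -> measurable B ->
  A `<=` B -> B `<=` posR -> Lplus f ->
  \int[@leb R]_(x in A) f x <= \int[@leb R]_(x in B) f x.
Proof.
move=> mA mB AB Bp f0; apply: ge0_subset_integral => //.
- exact: measurable_lebesgueR.
- exact: measurable_lebesgueR.
- exact: Lplus_sub f0.
- by move=> x /Bp; rewrite posRE; exact: f0.2.
Qed.

(** A bounded down-closed set is the interval up to its supremum, with or without that endpoint,
    which is null. The endpoint [c] does not depend on [h], so several integrands over [A] can be
    compared on one interval. *)
Lemma integral_lower_set (A : set R) (u : R) :
  (exists x, A x) -> (forall x, A x -> (0 < x <= u)%R) ->
  (forall x y, (0 < x)%R -> (x <= y)%R -> A y -> A x) ->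
  exists2 c, (0 < c <= u)%R & forall h : R -> \bar R, Lplus h ->
    \int[@leb R]_(x in A) h x = \int[@leb R]_(x in `]0%R, c[) h x.
Proof.
move=> [a Aa] Au Adown.
have supA : has_sup A by split; [exists a|exists u => x /Au /andP[]].
have c0 : (0 < sup A)%R.
  by have /andP[a0 _] := Au _ Aa; exact: lt_le_trans a0 (ub_le_sup supA.2 Aa).
have cu : (sup A <= u)%R by apply: ge_sup supA.1 _ => x /Au /andP[].
exists (sup A); first by rewrite c0.
move=> h h0.
have sub1 : `]0%R, sup A[ `<=` A.
  move=> x; rewrite /= in_itv/= => /andP[x0 /(sup_gt supA.1)[y Ay xy]].
  by apply: Adown Ay => //; exact: ltW.
have sub2 : A `<=` `]0%R, sup A].
  move=> x Ax; rewrite /= in_itv/= (ub_le_sup supA.2 Ax) andbT.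
  by have /andP[] := Au _ Ax.
have [Ac|Ac] := pselect (A (sup A)).
  rewrite -integral_oc//; congr (integral _ _ _); apply/seteqP; split=> // x.
  by rewrite /= in_itv/= => /andP[x0 xA]; exact: Adown Ac.
congr (integral _ _ _); apply/seteqP; split=> // x Ax.
have := sub2 _ Ax; rewrite /= !in_itv/= => /andP[-> xA]/=.
by rewrite lt_neqAle xA andbT; apply/eqP => xE; apply: Ac; rewrite -xE.
Qed.

End primitive.

Section bounded_primitive.
Context {R : realType}.
Local Notation L := (lebesgueR R).
Local Open Scope ereal_scope.

(** Real-valued so that ordinary calculus applies; [fine] would send an infinite integral to 0, but
    below the integrand is always bounded and [primE] recovers the integral. *)
Definition prim (f : R -> \bar R) (y : R) : R :=
  fine (\int[@leb R]_(t in `]0%R, y[) f t).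

Lemma itv_posR (a b : R) : (0 <= a)%R -> `]a, b[%classic `<=` (posR : set R).
Proof.
by move=> a0 x /=; rewrite posRE in_itv/= => /andP[ax _]; exact: le_lt_trans ax.
Qed.

Lemma leb_itv_oo (a b : R) : (a <= b)%R -> leb `]a, b[%classic = (b - a)%:E.
Proof.
move=> ab; rewrite lebE; last exact: measurable_itv.
rewrite lebesgue_measure_itv/= lte_fin; case: ltP => // ba.
by rewrite (le_anti (_ : a <= b <= a)%R) ?subrr// ab.
Qed.

Lemma measurable_itv_leb (i : interval R) : measurable ([set` i] : set L).
Proof. by apply: measurable_lebesgueR; exact: measurable_itv. Qed.

Variables (f : R -> \bar R) (B : R).
Hypothesis f0 : Lplus f.
Hypothesis fB : forall x, (0 < x)%R -> f x <= B%:E.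

Lemma integral_oo_bound (a b : R) : (0 <= a)%R -> (a <= b)%R ->
  \int[@leb R]_(t in `]a, b[) f t <= (B * (b - a))%:E.
Proof.
move=> a0 ab; rewrite EFinM -leb_itv_oo// -integral_cst; last exact: measurable_itv_leb.
apply: ge0_le_integral => //.
- exact: measurable_itv_leb.
- by move=> x /(itv_posR a0); rewrite posRE; exact: f0.2.
- by apply: Lplus_sub f0; exact: itv_posR.
- by move=> x /(itv_posR a0); rewrite posRE; exact: fB.
Qed.

Lemma integral_oo_ge0 (a b : R) : (0 <= a)%R -> 0 <= \int[@leb R]_(t in `]a, b[) f t.
Proof.
by move=> a0; apply: integral_ge0 => x /(itv_posR a0); rewrite posRE; exact: f0.2.
Qed.

Lemma primE (y : R) : (0 <= y)%R ->
  \int[@leb R]_(t in `]0%R, y[) f t = (prim f y)%:E.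
Proof.
move=> y0; rewrite /prim fineK// ge0_fin_numE ?integral_oo_ge0//.
by apply: le_lt_trans (integral_oo_bound (lexx 0%R) y0) _; rewrite ltry.
Qed.

Lemma prim_ge0 y : (0 <= prim f y)%R.
Proof. by rewrite fine_ge0// integral_oo_ge0. Qed.

Lemma prim0 : prim f 0 = 0%R.
Proof. by rewrite /prim set_itvoo0 integral_set0. Qed.

Lemma prim_split (x y : R) : (0 <= x)%R -> (x < y)%R ->
  \int[@leb R]_(t in `]x, y[) f t = (prim f y - prim f x)%:E.
Proof.
move=> x0 xy; have y0 := le_trans x0 (ltW xy).
move: x0; rewrite le_eqVlt => /predU1P[x0|x0].
  by rewrite -x0 prim0 subr0 primE.
have : \int[@leb R]_(t in `]0%R, y[) f t =
   \int[@leb R]_(t in `]0%R, x[) f t + \int[@leb R]_(t in `]x, y[) f t.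
  rewrite -(integral_oc x0 f0) -ge0_integral_setU.
  - congr (integral _ _ _); apply/seteqP; split=> t /=; rewrite !in_itv/=.
      by move=> /andP[-> ->]; rewrite andbT /=; case: (leP t x); [left|right].
    by move=> [/andP[-> tx]|/andP[xt ->]]; rewrite ?andbT/= ?(le_lt_trans tx)// (lt_trans x0).
  - exact: measurable_itv_leb.
  - exact: measurable_itv_leb.
  - by apply: Lplus_sub f0 => t [|] /=; rewrite posRE in_itv/= => /andP[]// /(lt_trans x0).
  - by move=> t [|] /=; rewrite in_itv/= => /andP[t0 _]; apply: f0.2 => //; exact: lt_trans t0.
  - rewrite disj_set2E; apply/eqP/seteqP; split=> // t [] /=; rewrite !in_itv/=.
    by move=> /andP[_ tx] /andP[xt _]; move: (le_lt_trans tx xt); rewrite ltxx.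
rewrite !primE//; last exact: ltW.
have: \int[@leb R]_(t in `]x, y[) f t \is a fin_num.
  rewrite ge0_fin_numE ?integral_oo_ge0 ?(ltW x0)//.
  by apply: le_lt_trans (integral_oo_bound (ltW x0) (ltW xy)) _; rewrite ltry.
by move=> /fineK <- /eqP; rewrite -EFinD eqe => /eqP ->; rewrite addrAC subrr add0r.
Qed.

Lemma prim_le (x y : R) : (0 <= x)%R -> (x <= y)%R -> (prim f x <= prim f y)%R.
Proof.
move=> x0; rewrite le_eqVlt => /predU1P[->//|xy].
by rewrite -subr_ge0 -lee_fin -prim_split// integral_oo_ge0.
Qed.

Lemma prim_lip (x y : R) : (0 <= x)%R -> (x <= y)%R ->
  (prim f y <= prim f x + B * (y - x))%R.
Proof.
move=> x0; rewrite le_eqVlt => /predU1P[->//|xy].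
  by rewrite subrr mulr0 addr0.
by rewrite -lerBlDl -lee_fin -prim_split// integral_oo_bound// ltW.
Qed.

Lemma prim_bound_ge0 : (0 <= B)%R.
Proof. by rewrite -lee_fin; apply: le_trans (fB ltr01); apply: f0.2. Qed.

Lemma prim_continuous (x : R) : (0 < x)%R -> {for x, continuous (prim f)}.
Proof.
move=> x0; apply/cvgrPdist_le => e e0.
have B0 := prim_bound_ge0.
near=> t.
have t0 : (0 < t)%R by near: t; exact: lt_nbhsr.
have : (`|x - t| <= e / (B + 1))%R.
  near: t; apply: (cvgrPdist_le _ _).1; first exact: cvg_id.
  by rewrite divr_gt0// ltr_wpDl.
rewrite ler_pdivlMr ?ltr_wpDl// => H.
have [tx|xt] := leP t x.
  have := prim_lip (ltW t0) tx; have := prim_le (ltW t0) tx.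
  move: H; rewrite ger0_norm ?subr_ge0// => H H1 H2.
  rewrite ger0_norm ?subr_ge0//; nra.
have := prim_lip (ltW x0) (ltW xt); have := prim_le (ltW x0) (ltW xt).
move: H; rewrite ltr0_norm ?subr_lt0// => H H1 H2.
rewrite ler0_norm ?subr_le0//; nra.
Unshelve. all: by end_near.
Qed.

Lemma Lplus_prim : Lplus (fun t => (prim f t)%:E).
Proof.
apply: Lplus_borel; last by move=> x _; rewrite lee_fin prim_ge0.
apply/measurable_EFinP; apply: open_continuous_measurable_fun.
  exact: interval_open.
by move=> x /set_mem; rewrite posRE; exact: prim_continuous.
Qed.

(* The superlevel sets of the primitive are intervals starting at a point where
   it takes the given value. *)
Lemma integral_prim_gt (y l : R) : (0 < y)%R -> (0 < l)%R ->
  \int[@leb R]_(t in [set t | (0 < t < y)%R /\ (l < prim f t)%R]) f t =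
  (if (l < prim f y)%R then prim f y - l else 0)%:E.
Proof.
move=> y0 l0; case: ifPn => [ly|]; last first.
  rewrite -leNgt => yl; rewrite [X in integral _ X _](_ : _ = set0) ?integral_set0//.
  apply/seteqP; split=> // t [/andP[t0 ty]] lt.
  by have := le_lt_trans (prim_le (ltW t0) (ltW ty)) (le_lt_trans yl lt); rewrite ltxx.
have B0 := prim_bound_ge0.
pose S := [set t | (0 <= t <= y)%R /\ (prim f t <= l)%R].
have S0 : S 0%R by split; rewrite ?lexx ?(ltW y0)// prim0 ltW.
have supS : has_sup S by split; [exists 0%R|exists y => t [/andP[]]].
(* [c] is the last point where the primitive is at most [l]. The Lipschitz bound on either side of
   [c] gives [prim f c = l]; the denominators [B + 1] cover [B = 0]. *)
pose c := sup S.
have c0 : (0 <= c)%R by exact: (ub_le_sup supS.2 S0).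
have cy : (c <= y)%R by apply: ge_sup supS.1 _ => t [/andP[]].
have cl : (prim f c <= l)%R.
  apply/ler_addgt0Pr => e e0.
  have [t [/andP[t0 ty] tl] ct] : exists2 t, S t & (c - e / (B + 1) < t)%R.
    by apply: sup_gt supS.1 _; rewrite ltrBlDr ltrDl divr_gt0// ltr_wpDl.
  have tc : (t <= c)%R by apply: (ub_le_sup supS.2); split => //; rewrite t0.
  have := prim_lip t0 tc.
  move: ct; rewrite ltrBlDr -ltrBlDl ltr_pdivlMr ?ltr_wpDl// => ct H.
  nra.
have {}cy : (c < y)%R by rewrite lt_neqAle cy andbT; apply: contraTneq cl => ->; rewrite -ltNge.
have gtc t : (c < t)%R -> (t <= y)%R -> (l < prim f t)%R.
  move=> ct ty; rewrite ltNge; apply/negP => tl.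
  have : (t <= c)%R by apply: (ub_le_sup supS.2); split => //; rewrite ty (le_trans c0 (ltW ct)).
  by rewrite leNgt ct.
have cE : prim f c = l.
  apply/eqP; rewrite eq_le cl/=; apply/ler_addgt0Pr => e e0.
  pose t := Num.min y (c + e / (B + 1))%R.
  have ct : (c < t)%R by rewrite lt_min cy/= ltrDl divr_gt0// ltr_wpDl.
  have ty : (t <= y)%R by rewrite ge_min lexx.
  have tc : (t <= c + e / (B + 1))%R by rewrite ge_min lexx orbT.
  have := gtc t ct ty; have := prim_lip c0 (ltW ct).
  move: tc; rewrite -lerBlDl ler_pdivlMr ?ltr_wpDl// => tc H1 H2.
  nra.
rewrite -cE -prim_split//; congr (integral _ _ _).
apply/seteqP; split=> t /=; rewrite in_itv/=.
  move=> [/andP[t0 ->] tl]; rewrite andbT ltNge; apply/negP => tc.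
  by have := lt_le_trans tl (prim_le (ltW t0) tc); rewrite cE ltxx.
move=> /andP[ct ty]; rewrite ty andbT (le_lt_trans c0 ct) cE; split => //.
exact: gtc (ltW ty).
Qed.

End bounded_primitive.

(** * Power integrals and the power rule for primitives *)

Section power_integrals.
Context {R : realType}.
Local Notation L := (lebesgueR R).

Lemma is_derive_continuous (f : R -> R) (x d : R) :
  is_derive x 1 f d -> {for x, continuous f}.
Proof.
by move=> [df _]; apply: differentiable_continuous; exact/derivable1_diffP.
Qed.

Lemma is_derive_mul (f g : R -> R) (x df dg : R) :
  is_derive x 1 f df -> is_derive x 1 g dg ->
  is_derive x 1 (fun z => f z * g z) (df * g x + f x * dg).
Proof.
move=> hf hg; apply: is_derive_eq (is_deriveM hf hg) _.
by rewrite /GRing.scale/= addrC mulrC.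
Qed.

Lemma is_derive_mulc (f : R -> R) (x df k : R) :
  is_derive x 1 f df -> is_derive x 1 (fun z => k * f z) (k * df).
Proof. by move=> hf; exact: is_deriveZ. Qed.

Lemma is_derive_powR_comp (g : R -> R) (x d r : R) : 0 < g x -> is_derive x 1 g d ->
  is_derive x 1 (fun z => g z `^ r) (r * g x `^ (r - 1) * d).
Proof.
move=> gx dg.
exact: (@is_derive1_comp _ (fun z => z `^ r) g x _ _ (is_derive1_powR r gx) dg).
Qed.

Lemma continuous_powR (r x : R) : 0 < x -> {for x, continuous (fun z : R => z `^ r)}.
Proof. by move=> x0; exact: is_derive_continuous (is_derive1_powR r x0). Qed.

Lemma cvg_powRy (r : R) : 0 < r -> x `^ r @[x --> +oo] --> +oo.
Proof.
move=> r0; apply/cvgryPge => M; near=> x.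
have M0 : 0 <= Num.max M 0 by rewrite le_max lexx orbT.
have : (Num.max M 0) `^ r^-1 <= x by near: x; exact: nbhs_pinfty_ge.
move=> H; have x0 := le_trans (powR_ge0 _ _) H.
rewrite (le_trans (y := Num.max M 0)) ?le_max ?lexx//.
have := ge0_ler_powR (ltW r0) _ _ H; rewrite !nnegrE powR_ge0 => /(_ isT x0).
by rewrite -powRrM mulVf ?gt_eqF// powRr1.
Unshelve. all: by end_near.
Qed.

Lemma cvg_powRN (r : R) : r < 0 -> x `^ r @[x --> +oo] --> 0.
Proof.
move=> r0; have := @cvg_powRy (- r); rewrite oppr_gt0 => /(_ r0) H.
rewrite (_ : (fun x => x `^ r) = (fun x => (x `^ (- r))^-1)); last first.
  by apply/funext => x; rewrite powRN invrK.
apply/gtr0_cvgV0; last exact: H.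
by near=> x; rewrite powR_gt0.
Unshelve. all: by end_near.
Qed.

Lemma integral_powR_o (r c : R) : -1 < r -> 0 < c ->
  (\int[@leb R]_(x in `]0%R, c[) (x `^ r)%:E = (c `^ (r + 1) / (r + 1))%:E)%E.
Proof.
move=> r1 c0; have r0 : 0 < r + 1 by rewrite -ltrBlDr sub0r.
have dG x : 0 < x < c ->
    is_derive x 1 (fun x => (r + 1)^-1 * x `^ (r + 1)) (x `^ r).
  move=> /andP[x0 _].
  apply: is_derive_eq (is_derive_mulc _ (is_derive1_powR (r + 1) x0)) _.
  by rewrite addrK mulrA mulVf ?mul1r// gt_eqF.
rewrite (ge0_FTC_oo (la := 0) (lb := c `^ (r + 1) / (r + 1)) c0 dG) ?subr0//.
- by move=> x /andP[x0 _]; exact: continuous_powR.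
- by move=> x _; exact: powR_ge0.
- rewrite -[X in _ --> X](mulr0 (r + 1)^-1); apply: cvgMr.
  exact: powR_cvg0.
- rewrite mulrC; apply: cvg_at_left_filter; apply: cvgMr.
  exact: continuous_powR.
Qed.

Lemma integral_powR_y (r c : R) : r < -1 -> 0 < c ->
  (\int[@leb R]_(x in `]c, +oo[) (x `^ r)%:E = (c `^ (r + 1) / - (r + 1))%:E)%E.
Proof.
move=> r1 c0; have r0 : r + 1 < 0 by rewrite -ltrBrDr sub0r.
have dG x : c < x -> is_derive x 1 (fun x => (r + 1)^-1 * x `^ (r + 1)) (x `^ r).
  move=> cx; have x0 := lt_trans c0 cx.
  apply: is_derive_eq (is_derive_mulc _ (is_derive1_powR (r + 1) x0)) _.
  by rewrite addrK mulrA mulVf ?mul1r// lt_eqF.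
rewrite (ge0_FTC_oy (la := (r + 1)^-1 * c `^ (r + 1)) (lb := 0) dG).
- by rewrite invrN mulrN mulrC sub0r.
- by move=> x cx; apply: continuous_powR; exact: lt_trans cx.
- by move=> x _; exact: powR_ge0.
- apply: cvg_at_right_filter; apply: cvgMr.
  exact: continuous_powR.
- rewrite -[X in _ --> X](mulr0 (r + 1)^-1); apply: cvgMr.
  exact: cvg_powRN.
Qed.

Lemma Lplus_EFin (f : R -> R) : (forall x, 0 < x -> {for x, continuous f}) ->
  (forall x, 0 < x -> 0 <= f x) -> Lplus (fun x => (f x)%:E).
Proof.
move=> cf f0; apply: Lplus_borel; last by move=> x /f0; rewrite lee_fin.
apply/measurable_EFinP; apply: open_continuous_measurable_fun; first exact: interval_open.
by move=> x /set_mem; rewrite posRE; exact: cf.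
Qed.

Lemma Lplus_powR (r : R) : Lplus (fun x => (x `^ r)%:E).
Proof. by apply: Lplus_EFin => x x0; [exact: continuous_powR|exact: powR_ge0]. Qed.

Lemma measurable_ltr_posR (y : R) :
  measurable_fun (posR : set L) (fun t : L => (t : R) < y).
Proof.
rewrite (_ : (fun t => _) = (fun t : L => ((t : R)%:E < y%:E)%E)).
  exact: measurable_EFin_lt.
by apply/funext => t; rewrite lte_fin.
Qed.

(** Writing [y^r] as the integral of [r l^(r-1)] over [0 < l < y] presents a power of [h] as an
    image under [Hop h], ready for [Hop_adj]. *)
Lemma Hop_powR (h : R -> \bar R) (r x : R) (y : R) : 0 < r -> 0 <= y -> h x = y%:E ->
  Hop h (fun l => (r * l `^ (r - 1))%:E) x = (y `^ r)%:E.
Proof.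
move=> r0 y0 hx; rewrite /Hop hx.
rewrite (_ : [set t | _] = `]0%R, y[%classic); last first.
  by apply/seteqP; split => t /=; rewrite in_itv/= !lte_fin.
move: y0; rewrite le_eqVlt => /predU1P[<-|y0].
  by rewrite set_itvoo0 integral_set0 powR0// gt_eqF.
under eq_integral do rewrite EFinM.
rewrite ge0_integralZl; last by rewrite lee_fin ltW.
- rewrite integral_powR_o ?subrK//; last by rewrite -ltrBlDr opprK addrC subrr.
  by rewrite -EFinM mulrCA divff ?mulr1// gt_eqF.
- exact: measurable_itv_leb.
- by apply: Lplus_sub (Lplus_powR _); exact: itv_posR.
- by move=> t _; rewrite lee_fin powR_ge0.
Qed.

(** As [f] is merely measurable, its primitive cannot be differentiated at each point. Instead the
    power is expanded over levels [l], the order of integration is exchanged, and the integral of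
    [f] over each superlevel set is [prim f y - l]. An explicit integral in [l] remains. *)
Lemma integral_prim_powR (f : R -> \bar R) (B r y : R) : Lplus f ->
  (forall x, 0 < x -> (f x <= B%:E)%E) -> 0 < r -> 0 < y ->
  (\int[@leb R]_(t in `]0%R, y[) (f t * (prim f t `^ r)%:E) =
   (prim f y `^ (r + 1) / (r + 1))%:E)%E.
Proof.
move=> f0 fB r0 y0.
pose g t : \bar R := if t < y then f t else 0%E.
pose F t : \bar R := (prim f t)%:E.
pose k (l : R) : \bar R := (r * l `^ (r - 1))%:E.
have LF : Lplus F by exact: Lplus_prim fB.
have Lg : Lplus g.
  by apply: Lplus_if f0; exact: measurable_ltr_posR.
have Lk : Lplus k.
  apply: Lplus_EFin => x x0; last by rewrite mulr_ge0 ?powR_ge0// ltW.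
  by apply: cvgMr; exact: continuous_powR.
transitivity (\int[@leb R]_(t in posR) (g t * Hop F k t))%E.
  rewrite (@integral_posR_if _ (fun t => t < y)); last first.
    by move=> x; rewrite /= in_itv/=; split=> [/andP[]|[-> ->]].
  apply: eq_integral_posR => t t0; rewrite /g; case: ifPn => _; last by rewrite mul0e.
  by rewrite (@Hop_powR F r t (prim f t) r0)//; exact: prim_ge0.
rewrite Hop_adj//.
transitivity (\int[@leb R]_(l in posR) (if (l < prim f y)%R then
   (r * l `^ (r - 1) * (prim f y - l))%:E else 0%E))%E.
  apply: eq_integral_posR => l l0.
  have -> : adj F g l = (\int[@leb R]_(t in [set t | (0 < t < y)%R /\ (l < prim f t)%R]) f t)%E.
    rewrite /adj (@integral_posR_if _ (fun t => l < prim f t)); last first.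
      by move=> x /=; rewrite lte_fin.
    rewrite [RHS](@integral_posR_if _ (fun t => (t < y) && (l < prim f t))); last first.
      by move=> x /=; split=> [[/andP[-> ->]]|[-> /andP[]]].
    apply: eq_integral_posR => t t0; rewrite /g.
    by rewrite andbC; case: (l < prim f t); case: (t < y).
  rewrite (integral_prim_gt f0 fB)//; case: ifPn => _; last by rewrite mule0.
  by rewrite -EFinM.
rewrite -(@integral_posR_if _ (fun l => l < prim f y) `]0%R, prim f y[); last first.
  by move=> x; rewrite /= in_itv/=; split=> [/andP[]|[-> ->]].
set M := prim f y.
have : 0 <= M by exact: (prim_ge0 f0).
rewrite le_eqVlt => /predU1P[<-|M0].
  by rewrite set_itvoo0 integral_set0 powR0 ?mul0r// gt_eqF// addr_gt0.
clearbody M.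
have r1 : 0 < r + 1 by rewrite addr_gt0.
(* The antiderivative comes from integrating [r M l^(r-1) - r l^r] term by term. *)
have dG l : 0 < l < M -> is_derive l 1 (fun l => l `^ r * (M - r / (r + 1) * l))
    (r * l `^ (r - 1) * (M - l)).
  move=> /andP[l0 _].
  have d1 := is_derive1_powR r l0.
  have d2 : is_derive l 1 (fun l : R => M - r / (r + 1) * l) (- (r / (r + 1))).
    apply: is_derive_eq (is_deriveB (is_derive_cst M l 1)
      (is_derive_mulc (r / (r + 1)) (is_derive_id l 1))) _.
    by rewrite sub0r mulr1.
  apply: is_derive_eq (is_derive_mul d1 d2) _.
  rewrite -(mulr_powRB1 (ltW l0) r0); field; exact: lt0r_neq0.
rewrite (ge0_FTC_oo (la := 0) (lb := M `^ (r + 1) / (r + 1)) M0 dG) ?subr0//.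
- move=> l /andP[l0 _]; apply: cvgM.
    by apply: cvgMr; exact: continuous_powR.
  by apply: cvgB; [exact: cvg_cst|exact: cvg_id].
- move=> l /andP[l0 lM]; rewrite mulr_ge0// ?subr_ge0 ?(ltW lM)//.
  by rewrite mulr_ge0 ?powR_ge0// ltW.
- rewrite -[X in _ --> X](mul0r (M - r / (r + 1) * 0)); apply: cvgM.
    exact: powR_cvg0.
  apply: cvg_at_right_filter; apply: cvgB; [exact: cvg_cst|].
  by apply: cvgMr; exact: cvg_id.
- rewrite [X in _ --> X](_ : _ = M `^ r * (M - r / (r + 1) * M)); last first.
    rewrite powRD; last by rewrite gt_eqF.
    by rewrite powRr1 ?ltW//; field; exact: lt0r_neq0.
  apply: cvg_at_left_filter; apply: cvgM; first exact: continuous_powR.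
  by apply: cvgB; [exact: cvg_cst|apply: cvgMr; exact: cvg_id].
Qed.

End power_integrals.

(** * Nonincreasing weights and Hardy's lemma *)

Section monotone_weights.
Context {R : realType}.
Local Notation L := (lebesgueR R).
Local Open Scope ereal_scope.
Implicit Types (a b f g h k : R -> \bar R).

(** The superlevel sets of a nonincreasing function on the half-line are intervals, hence Borel. *)
Lemma Lplus_normal_form b : normal_form b -> Lplus b.
Proof.
move=> [b0 bni]; apply: Lplus_borel => //.
move=> mD; apply: (measurability _ (ErealGenOInfty.measurableE R)) => // _ [_ [y ->] <-].
apply: is_interval_measurable => x z /= [x0 xb] [z0 zb] t /andP[xt tz].
rewrite !posRE !in_itv/= !andbT in x0 xb zb *.
have t0 : (0 < t)%R by exact: lt_le_trans xt.
by split=> //; apply: lt_le_trans zb _; exact: bni.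
Qed.

Lemma Hop_cst1 b x : 0 <= b x -> Hop b (cst 1) x = b x.
Proof.
rewrite /Hop integral_cst; last first.
  rewrite (_ : [set t | _] = [set` `]0%R, +oo[] `&` [set t : R | t%:E < b x]).
    apply: measurable_lebesgueR.
    apply: measurable_lte => //; exact: measurable_itv.
  by apply/seteqP; split => t /=; rewrite in_itv/= andbT lte_fin => /andP.
rewrite mul1e; case: (b x) => [y|_|] //.
  rewrite lee_fin => y0; rewrite (_ : [set t | _] = `]0%R, y[%classic).
    by rewrite leb_itv_oo// subr0.
  by apply/seteqP; split=> t; rewrite /= in_itv/= !lte_fin.
rewrite (_ : [set t | _] = `]0%R, +oo[%classic).
  by rewrite (lebE (measurable_itv `]0%R, +oo[)) lebesgue_measure_itv/= ltry.
by apply/seteqP; split=> t; rewrite /= in_itv/= !andbT ?ltry ?andbT lte_fin.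
Qed.

Lemma integral_posR_le (h : R -> \bar R) (M : \bar R) : Lplus h ->
  (forall u : R, (0 < u)%R -> \int[@leb R]_(x in `]0%R, u[) h x <= M) ->
  \int[@leb R]_(x in posR) h x <= M.
Proof.
move=> h0 hM.
have posU : (posR : set L) = \bigcup_n `]0%R, n.+1%:R[%classic.
  apply/seteqP; split=> x /=; rewrite posRE.
    move=> x0; exists (Num.truncn x) => //=.
    by rewrite in_itv/= x0 truncnS_gt.
  by move=> [n _] /=; rewrite in_itv/= => /andP[].
have := @ge0_nondecreasing_set_cvg_integral _ L R (fun n => `]0%R, n.+1%:R[%classic) h (@leb R).
rewrite -posU => H.
have cv : (\int[@leb R]_(x in `]0%R, n.+1%:R[) h x)%E @[n --> \oo] -->
   \int[@leb R]_(x in posR) h x.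
  apply: H.
  - move=> m n mn; apply/subsetPset => x /=; rewrite !in_itv/= => /andP[-> /lt_le_trans]/=.
    by apply; rewrite ler_nat.
  - by move=> n; exact: measurable_itv_leb.
  - by move=> n; apply: Lplus_sub h0; exact: itv_posR.
  - by move=> n x /=; rewrite in_itv/= => /andP[x0 _]; exact: h0.2.
have <- := cvg_lim (@ereal_hausdorff R) cv.
apply: lime_le; first by apply/cvg_ex; exists (\int[@leb R]_(x in posR) h x).
by apply: nearW => n; exact: hM.
Qed.

(* Layer cake: a nonincreasing weight is a superposition of indicators of
   initial intervals. *)
Lemma hardy_weight (k u v : R -> \bar R) (C : R) : (0 <= C)%R -> normal_form k ->
  Lplus u -> Lplus v ->
  (forall t, (0 < t)%R -> \int[@leb R]_(x in `]0%R, t[) u x <=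
     C%:E * \int[@leb R]_(x in `]0%R, t[) v x) ->
  \int[@leb R]_(x in posR) (u x * k x) <= C%:E * \int[@leb R]_(x in posR) (v x * k x).
Proof.
move=> C0 knf u0 v0 uv; have k0 := Lplus_normal_form knf.
have one : Lplus (cst 1 : R -> \bar R) by exact: Lplus_cst.
(* Since [k x] is the length of []0, k x[], that is [Hop k 1 x], duality turns the integral of [w k]
   into the integral over levels [t] of the integral of [w] over [k > t]. *)
have E w : Lplus w -> \int[@leb R]_(x in posR) (w x * k x) =
    \int[@leb R]_(t in posR) (adj k w t).
  move=> w0; transitivity (\int[@leb R]_(x in posR) (w x * Hop k (cst 1) x)).
    by apply: eq_integral_posR => x x0; rewrite Hop_cst1//; exact: k0.2.
  by rewrite Hop_adj//; apply: eq_integral_posR => x x0; rewrite mul1e.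
have Au := Lplus_adj k0 u0; have Av := Lplus_adj k0 v0.
rewrite (E _ u0) (E _ v0) -(integralZl_posR Av); last by rewrite lee_fin.
apply: (le_integral_posR Au (LplusM (Lplus_cst (_ : 0 <= C%:E)) Av)).
  by rewrite lee_fin.
move=> l l0; rewrite /adj; set A := [set x | _].
have Adown x y : (0 < x)%R -> (x <= y)%R -> A y -> A x.
  move=> x0 xy [y0 ly]; split=> //; apply: lt_le_trans ly _; exact: knf.2.
have [A0|] := pselect (A = set0); first by rewrite A0 !integral_set0 mule0.
move=> /eqP/set0P nA.
have [[M AM]|] := pselect (exists M, forall x, A x -> (0 < x <= M)%R).
  have [c /andP[c0 _] H] := integral_lower_set nA AM Adown.
  by rewrite !H//; exact: uv.
(* An unbounded down-closed level set is the whole half-line; the hypothesis is then used on every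
   []0, t[] and passed to the limit. *)
move=> nAM; have AE : A = (posR : set L).
  apply/seteqP; split=> x; rewrite posRE; first by case.
  move=> x0; have [y Ay xy] : exists2 y, A y & (x < y)%R.
    apply/not_exists2P => nA'; apply: nAM; exists x => y Ay.
    have [y0 _] := Ay; rewrite y0/=.
    by have [//|] := nA' y; move/negP; rewrite -leNgt.
  exact: Adown (ltW xy) Ay.
rewrite AE; apply: (integral_posR_le u0) => t t0; apply: le_trans (uv _ t0) _.
apply: lee_wpmul2l; first by rewrite lee_fin.
by apply: (le_integral_subset _ _ _ _ v0);
  [exact: measurable_itv|exact: measurable_itv|exact: itv_posR|].
Qed.

End monotone_weights.

(** * Duality and transfer between weights *)

Section adjoint.
Context {R : realType}.
Local Notation L := (lebesgueR R).
Local Open Scope ereal_scope.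
Implicit Types (a b f g h k : R -> \bar R).

(** The closing step of each duality argument: divide by [I^(1/p)]. The division is legitimate
    because [I] is finite; [I = 0] is separate. *)
Lemma root_of_self_bound (I N : \bar R) (p q : R) : (0 < p)%R -> (0 < q)%R ->
  (p^-1 + q^-1 = 1)%R -> 0 <= I -> I < +oo -> 0 <= N ->
  I <= N * I `^ p^-1 -> I `^ q^-1 <= N.
Proof.
move=> p0 q0 pq; case: I => [I| |]// I0 _ N0.
move: N0; case: N => [N| |]// N0; last by rewrite leey.
rewrite !lee_fin in I0 N0 *.
move: I0; rewrite le_eqVlt => /predU1P[<- _|I0].
  by rewrite powR0// invr_neq0// gt_eqF.
rewrite -ler_pdivrMr ?powR_gt0//; apply: le_trans.
rewrite -[X in (_ <= X / _)%R](powRr1 (ltW I0)) -pq powRD ?pq ?oner_eq0//.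
by rewrite mulrAC divff ?mul1r// gt_eqF// powR_gt0.
Qed.

Lemma poweR_rootK (x : \bar R) (r : R) : 0 <= x -> r != 0%R -> (x `^ r) `^ r^-1 = x.
Proof. by move=> x0 r0; rewrite -poweRrM divff// poweRe1. Qed.

Lemma poweR_Kroot (x : \bar R) (r : R) : 0 <= x -> r != 0%R -> (x `^ r^-1) `^ r = x.
Proof. by move=> x0 r0; rewrite -poweRrM mulVf// poweRe1. Qed.

Lemma le_poweR (x y : \bar R) (r : R) : (0 <= r)%R -> 0 <= x -> x <= y -> x `^ r <= y `^ r.
Proof.
move=> r0 x0 xy; apply: gt0_ler_poweR => //; rewrite in_itv/= ?x0 ?leey//.
by rewrite (le_trans x0 xy).
Qed.

Section bounded_support.
Variables (b g : R -> \bar R) (B u : R).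
Hypothesis b0 : normal_form b.
Hypothesis g0 : Lplus g.
Hypothesis gB : forall x, (0 < x)%R -> g x <= B%:E.
Hypothesis gu : forall x, (u <= x)%R -> g x = 0.
Hypothesis u0 : (0 < u)%R.

Let Lb := Lplus_normal_form b0.

(** Monotonicity of [b] makes the domain of the adjoint an initial interval, and vanishing beyond
    [u] bounds it. The endpoint depends on [b], [t] and [u] but not on [h], so adjoints of different
    functions at the same [t] are integrals over the same interval. *)
Lemma adj_lower_set (t : R) :
  (forall h, (forall x, (u <= x)%R -> h x = 0) -> Lplus h -> adj b h t = 0) \/
  exists2 c, (0 < c <= u)%R & forall h, (forall x, (u <= x)%R -> h x = 0) -> Lplus h ->
    adj b h t = \int[@leb R]_(x in `]0%R, c[) h x.
Proof.
pose A := [set x : R | (0 < x <= u)%R /\ t%:E < b x].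
have AE h : (forall x, (u <= x)%R -> h x = 0) -> Lplus h ->
    adj b h t = \int[@leb R]_(x in A) h x.
  move=> hu h0; rewrite adj_if.
  rewrite [RHS](@integral_posR_if _ (fun x => (x <= u)%R && (t%:E < b x))); last first.
    by move=> x; rewrite /A/=; split=> [[/andP[x0 ->] ->]|[x0 /andP[-> ->]]]; rewrite x0.
  apply: eq_integral_posR => x x0; have [xu|ux] := leP x u; first by [].
  by rewrite hu ?(ltW ux)//; case: ifP.
have [A0|/eqP/set0P nA] := pselect (A = set0).
  by left=> h hu h0; rewrite AE// A0 integral_set0.
right; have [| |c cu cE] := @integral_lower_set R A u nA.
- by move=> x [].
- move=> x y x0 xy [/andP[y0 yu] ty]; split; first by rewrite x0 (le_trans xy).
  by apply: lt_le_trans ty _; exact: b0.2.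
by exists c => // h hu h0; rewrite AE// cE.
Qed.

Lemma adj_bound (t : R) : adj b g t <= (B * u)%:E.
Proof.
have B0 := prim_bound_ge0 g0 gB.
have [->//|[c /andP[c0 cu] ->//]] := adj_lower_set t.
  by rewrite lee_fin mulr_ge0// ltW.
apply: le_trans (integral_oo_bound g0 gB (lexx 0%R) (ltW c0)) _.
by rewrite subr0 lee_fin ler_wpM2l.
Qed.

Lemma Lplus_powR_prim (r : R) : Lplus (fun x => (prim g x `^ r)%:E).
Proof.
exact (Lplus_poweR r (Lplus_prim g0 gB)).
Qed.

(** On an initial interval the adjoint is a value of the primitive of [g], so the power rule
    applies. *)
Lemma adj_poweR (r t : R) : (0 < r)%R ->
  adj b g t `^ (r + 1) = (r + 1)%:E * adj b (fun x => g x * (prim g x `^ r)%:E) t.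
Proof.
move=> r0; have r1 : (0 < r + 1)%R by rewrite addr_gt0.
have Lk : Lplus (fun x => g x * (prim g x `^ r)%:E).
  exact: LplusM g0 (Lplus_powR_prim r).
have ku x : (u <= x)%R -> g x * (prim g x `^ r)%:E = 0 by move=> /gu ->; rewrite mul0e.
have [H|[c /andP[c0 cu] H]] := adj_lower_set t.
  by rewrite !H// mule0 poweR0r// gt_eqF.
rewrite !H// (integral_prim_powR g0 gB r0 c0) (primE g0 gB (ltW c0)).
by rewrite poweR_EFin -EFinM mulrCA divff ?mulr1// gt_eqF.
Qed.

(** The right-hand side is linear in [b], which is what makes two weights comparable. It arises by
    pairing [adj_poweR] with the constant 1 and using [Hop b 1 = b]. *)
Lemma integral_adj_poweR (r : R) : (0 < r)%R ->
  \int[@leb R]_(t in posR) (adj b g t `^ (r + 1)) =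
  (r + 1)%:E * \int[@leb R]_(x in posR) (g x * (prim g x `^ r)%:E * b x).
Proof.
move=> r0; have r1 : (0 < r + 1)%R by rewrite addr_gt0.
have Lk : Lplus (fun x => g x * (prim g x `^ r)%:E).
  exact: LplusM g0 (Lplus_powR_prim r).
under eq_integral do rewrite adj_poweR//.
rewrite (integralZl_posR (Lplus_adj Lb Lk)); last by rewrite lee_fin ltW.
congr (_ * _); transitivity (\int[@leb R]_(t in posR) (cst 1 t *
    adj b (fun x => g x * (prim g x `^ r)%:E) t)).
  by apply: eq_integral_posR => t _; rewrite mul1e.
rewrite -(Hop_adj Lb (Lplus_cst lee01) Lk).
by apply: eq_integral_posR => x x0; rewrite Hop_cst1//; exact: Lb.2.
Qed.

End bounded_support.

(** The constant is a real number and the norms are written as integrals, so the arguments below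
    stay among finite constants; [Nconst_le] and [Nconst_ge] translate to the infimum. *)
Definition admissible (p q : R) b (D : R) : Prop :=
  forall f, Lplus f -> \int[@leb R]_(x in posR) (f x `^ p) < +oo ->
    (\int[@leb R]_(x in posR) (Hop b f x `^ q)) `^ q^-1 <=
    D%:E * (\int[@leb R]_(x in posR) (f x `^ p)) `^ p^-1.

(** The norm of the adjoint is at most that of the operator. The function that is extremal in
    Hoelder's inequality against [adj b g] serves as test function; boundedness and bounded support
    of [g] keep the adjoint bounded. *)
Lemma admissible_adj (p q p' q' : R) b g (D B u : R) :
  (0 < p)%R -> (0 < q)%R -> (0 < p')%R -> (0 < q')%R ->
  (p^-1 + p'^-1 = 1)%R -> (q^-1 + q'^-1 = 1)%R -> (0 <= D)%R ->
  normal_form b -> admissible p q b D ->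
  Lplus g -> (forall x, (0 < x)%R -> g x <= B%:E) ->
  (forall x, (u <= x)%R -> g x = 0) -> (0 < u)%R ->
  (\int[@leb R]_(t in posR) (adj b g t `^ p')) `^ p'^-1 <=
  D%:E * (\int[@leb R]_(x in posR) (g x `^ q')) `^ q'^-1.
Proof.
move=> p0 q0 p'0 q'0 pp' qq' D0 bnf adm g0 gB gu u0.
have Lb := Lplus_normal_form bnf.
have B0 := prim_bound_ge0 g0 gB.
have Lphi := Lplus_adj Lb g0.
have Lphip := Lplus_poweR p' Lphi.
set N := D%:E * _.
have N0 : 0 <= N by rewrite mule_ge0 ?lee_fin// poweR_ge0.
have p'1 : (p' != 0)%R by rewrite gt_eqF.
(* Restriction to []0, v[] makes the integral finite, the adjoint being bounded; [v] is
   arbitrary. *)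
suff H (v : R) : (0 < v)%R -> \int[@leb R]_(t in `]0%R, v[) (adj b g t `^ p') <= N `^ p'.
  rewrite -[leRHS](poweR_rootK N0 p'1); apply: le_poweR; first by rewrite invr_ge0 ltW.
    exact: integral_posR_ge0.
  exact: integral_posR_le.
move=> v0.
have IE : \int[@leb R]_(t in `]0%R, v[) (adj b g t `^ p') =
    \int[@leb R]_(t in posR) (if (t < v)%R then adj b g t `^ p' else 0).
  by apply: integral_posR_if => t /=; rewrite in_itv/=; split=> [/andP[]|[-> ->]].
set I := \int[@leb R]_(t in `]0%R, v[) _ in IE *.
have I0 : 0 <= I by apply: integral_ge0 => t _; exact: poweR_ge0.
have Ioo : I < +oo.
  apply: (@le_lt_trans _ _ ((B * u) `^ p' * (v - 0))%:E); last by rewrite ltry.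
  apply: (integral_oo_bound (f := fun t => adj b g t `^ p') Lphip _ (lexx 0%R) (ltW v0)).
  move=> t t0; rewrite -poweR_EFin; apply: le_poweR; [exact: ltW|exact: Lphi.2|].
  exact: adj_bound.
(* With the exponent [p' - 1], both [f^p] and [f * adj b g] equal [(adj b g)^p'] on []0, v[]. *)
pose f t := if (t < v)%R then adj b g t `^ (p' - 1) else 0.
have Lf : Lplus f.
  by apply: Lplus_if; [exact: measurable_ltr_posR|exact: Lplus_poweR].
have p'E : (p' - 1 != 0)%R.
  apply/eqP => /eqP; rewrite subr_eq0 => /eqP p'E; move: pp'; rewrite p'E invr1.
  by move/eqP; rewrite -subr_eq0 addrK invr_eq0 gt_eqF.
have ppE : ((p' - 1) * p = p')%R.
  have : (p * p' * (p^-1 + p'^-1) = p * p')%R by rewrite pp' mulr1.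
  rewrite mulrDr mulrAC divff ?gt_eqF// mul1r mulfK ?gt_eqF// => /eqP.
  by rewrite eq_sym => /eqP H; rewrite mulrBl mul1r mulrC H addrK.
have fp : \int[@leb R]_(t in posR) (f t `^ p) = I.
  rewrite IE; apply: eq_integral_posR => t t0; rewrite /f; case: ifPn => _.
    by rewrite -poweRrM ppE.
  by rewrite poweR0r// gt_eqF.
have fphi : \int[@leb R]_(t in posR) (f t * adj b g t) = I.
  rewrite IE; apply: eq_integral_posR => t t0; rewrite /f; case: ifPn => _; last by rewrite mul0e.
  have : adj b g t \is a fin_num.
    rewrite ge0_fin_numE; last exact: Lphi.2.
    by apply: le_lt_trans (adj_bound bnf g0 gB gu u0 t) _; rewrite ltry.
  have := Lphi.2 t t0; case: (adj b g t) => // y; rewrite lee_fin => y0 _.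
  by rewrite !poweR_EFin -EFinM mulrC mulr_powRB1.
have := adm f Lf; rewrite fp => /(_ Ioo) admf.
have key : I <= N * I `^ p^-1.
  rewrite -[X in X <= _]fphi -(Hop_adj Lb Lf g0).
  apply: le_trans (hoelder_posR q'0 q0 _ g0 (Lplus_Hop Lb Lf)) _; first by rewrite addrC.
  rewrite /N -muleA muleCA; apply: lee_wpmul2l; first exact: poweR_ge0.
  exact: admf.
have := root_of_self_bound p0 p'0 pp' I0 Ioo N0 key.
move/(le_poweR (ltW p'0) (poweR_ge0 _ _)).
by rewrite poweR_Kroot.
Qed.

End adjoint.

(** * Comparison of two weights *)

Section transfer.
Context {R : realType}.
Local Notation L := (lebesgueR R).
Local Open Scope ereal_scope.
Implicit Types (a b f g h k : R -> \bar R).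

Lemma conj_mul1 (p p' : R) : (0 < p)%R -> (0 < p')%R -> (p^-1 + p'^-1 = 1)%R ->
  ((p' - 1) * p = p')%R.
Proof.
move=> p0 p'0 pp'; have : (p * p' * (p^-1 + p'^-1) = p * p')%R by rewrite pp' mulr1.
rewrite mulrDr mulrAC divff ?gt_eqF// mul1r mulfK ?gt_eqF// => H.
by rewrite mulrBl mul1r mulrC -H addrK.
Qed.

Lemma integral_oo_le g (u v c : R) : (0 <= u)%R -> (u <= v)%R -> Lplus g ->
  (forall x, (u < x < v)%R -> g x <= c%:E) ->
  \int[@leb R]_(t in `]u, v[) g t <= (c * (v - u))%:E.
Proof.
move=> u0 uv g0 gc; rewrite EFinM -leb_itv_oo// -integral_cst; last exact: measurable_itv_leb.
apply: ge0_le_integral => //.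
- exact: measurable_itv_leb.
- by move=> x /(itv_posR u0); rewrite posRE; exact: g0.2.
- by apply: Lplus_sub g0; exact: itv_posR.
Qed.

Lemma integral_oo_ge g (u v c : R) : (0 <= u)%R -> (u <= v)%R -> (0 <= c)%R -> Lplus g ->
  (forall x, (u < x < v)%R -> c%:E <= g x) ->
  (c * (v - u))%:E <= \int[@leb R]_(t in `]u, v[) g t.
Proof.
move=> u0 uv c0 g0 gc; rewrite EFinM -leb_itv_oo// -integral_cst; last exact: measurable_itv_leb.
apply: ge0_le_integral => //.
- exact: measurable_itv_leb.
- by apply: Lplus_sub g0; exact: itv_posR.
Qed.

(** With [c = g x], the primitive is at least [c x] at [x] and grows by at most [c (y - x)]
    afterwards, so its average does not increase. *)
Lemma prim_concave g (B x y : R) : normal_form g ->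
  (forall x, (0 < x)%R -> g x <= B%:E) -> (0 < x)%R -> (x <= y)%R ->
  (prim g y * x <= prim g x * y)%R.
Proof.
move=> gnf gB x0 xy; have g0 := Lplus_normal_form gnf.
have [c c0 gx] : exists2 c : R, (0 <= c)%R & g x = c%:E.
  have := gB x x0; have := g0.2 x x0; case: (g x) => [c| |]//.
  by rewrite lee_fin => c0 _; exists c.
have low : (c * x <= prim g x)%R.
  rewrite -lee_fin -(primE g0 gB (ltW x0)) -[X in (c * X)%R]subr0.
  apply: integral_oo_ge => //; first exact: ltW.
  by move=> t /andP[t0 tx]; rewrite -gx; apply: gnf.2 => //; exact: ltW.
have upp : (prim g y - prim g x <= c * (y - x))%R.
  move: xy; rewrite le_eqVlt => /predU1P[->|xy]; first by rewrite !subrr mulr0.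
  rewrite -lee_fin -(prim_split g0 gB (ltW x0) xy); apply: integral_oo_le => //; try exact: ltW.
  by move=> t /andP[xt ty]; rewrite -gx; apply: gnf.2 => //; exact: ltW.
nra.
Qed.

Lemma normal_form_average g (B r : R) : normal_form g ->
  (forall x, (0 < x)%R -> g x <= B%:E) -> (0 < r)%R ->
  normal_form (fun x => g x * ((prim g x / x) `^ r)%:E).
Proof.
move=> gnf gB r0; split.
  by move=> x x0; rewrite mule_ge0 ?gnf.1// lee_fin powR_ge0.
move=> x y x0 xy; have y0 := lt_le_trans x0 xy.
apply: lee_pmul; [exact: gnf.1|by rewrite lee_fin powR_ge0|exact: gnf.2|].
have g0 := Lplus_normal_form gnf.
rewrite lee_fin; apply: ge0_ler_powR; [exact: ltW| | |].
- by rewrite nnegrE divr_ge0 ?prim_ge0// ltW.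
- by rewrite nnegrE divr_ge0 ?prim_ge0// ltW.
- by rewrite ler_pdivrMr// mulrAC ler_pdivlMr//; exact: prim_concave gB _ _.
Qed.

Lemma integral_adj_le (a b g : R -> \bar R) (r C B u : R) : (0 < r)%R -> (0 <= C)%R ->
  normal_form a -> normal_form b -> normal_form g ->
  (forall x, (0 < x)%R -> g x <= B%:E) ->
  (forall x, (u <= x)%R -> g x = 0) -> (0 < u)%R ->
  (forall t, (0 < t)%R ->
    \int[@leb R]_(x in `]0%R, t[) ((x `^ r)%:E * a x) <=
    C%:E * \int[@leb R]_(x in `]0%R, t[) ((x `^ r)%:E * b x)) ->
  \int[@leb R]_(t in posR) (adj a g t `^ (r + 1)) <=
  C%:E * \int[@leb R]_(t in posR) (adj b g t `^ (r + 1)).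
Proof.
move=> r0 C0 anf bnf gnf gB gu u0 ab; have g0 := Lplus_normal_form gnf.
rewrite (integral_adj_poweR anf g0 gB gu r0) (integral_adj_poweR bnf g0 gB gu r0).
rewrite muleCA; apply: lee_wpmul2l; first by rewrite lee_fin addr_ge0// ltW.
(* Moving [x^r] from the primitive to the weight leaves the nonincreasing factor [g (G/x)^r] and
   exactly the integrand of the hypothesis, as Hardy's lemma requires. *)
have E w : \int[@leb R]_(x in posR) (g x * (prim g x `^ r)%:E * w x) =
    \int[@leb R]_(x in posR) ((x `^ r)%:E * w x * (g x * ((prim g x / x) `^ r)%:E)).
  apply: eq_integral_posR => x x0.
  rewrite [RHS]muleAC; congr (_ * _).
  rewrite [RHS]muleCA; congr (_ * _).
  rewrite -EFinM powRM ?prim_ge0 ?invr_ge0 ?(ltW x0)// powR_inv//.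
  by rewrite mulrCA divff ?mulr1// gt_eqF// powR_gt0.
rewrite !E; exact: (hardy_weight C0 (normal_form_average gnf gB r0)
  (LplusM (Lplus_powR r) (Lplus_normal_form anf))
  (LplusM (Lplus_powR r) (Lplus_normal_form bnf)) ab).
Qed.

Lemma Hop_nonincreasing a f (x y : R) : normal_form a -> Lplus f ->
  (0 < x)%R -> (x <= y)%R -> Hop a f y <= Hop a f x.
Proof.
move=> anf f0 x0 xy; rewrite !Hop_if; apply: le_integral_posR.
- by apply: Lplus_if f0; exact: measurable_EFin_lt.
- by apply: Lplus_if f0; exact: measurable_EFin_lt.
- move=> t t0; case: ifPn => ty.
    by rewrite (lt_le_trans ty)//; exact: anf.2.
  by case: ifPn => // _; exact: f0.2.
Qed.

Lemma integral_posR_le_sup (hn : nat -> R -> \bar R) h (M : \bar R) :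
  Lplus h -> (forall n, Lplus (hn n)) ->
  (forall x, (0 < x)%R -> {homo hn ^~ x : m n / (m <= n)%N >-> m <= n}) ->
  (forall x, (0 < x)%R -> h x <= ereal_sup (range (hn ^~ x))) ->
  (forall n, \int[@leb R]_(x in posR) hn n x <= M) ->
  \int[@leb R]_(x in posR) h x <= M.
Proof.
move=> Lh Lhn hmono hlim hM.
have hcv x : (0 < x)%R -> hn n x @[n --> \oo] --> ereal_sup (range (hn ^~ x)).
  by move=> x0; apply: ereal_nondecreasing_cvgn; exact: hmono.
have cv := @cvg_monotone_convergence _ L R (@leb R) posR measurable_posR hn
  (fun n => (Lhn n).1).
have mlim : Lplus (fun x => limn (hn ^~ x)).
  split; last first.
    move=> x x0; rewrite (cvg_lim (@ereal_hausdorff R) (hcv x x0)).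
    by apply: le_trans (hlim x x0); exact: Lh.2.
  apply: (@emeasurable_fun_cvg _ L R posR hn) => [n|x]; first exact: (Lhn n).1.
  by rewrite posRE => x0; apply/cvg_ex; eexists; exact: hcv.
apply: (@le_trans _ _ (\int[@leb R]_(x in posR) limn (hn ^~ x))).
  apply: (le_integral_posR Lh mlim) => x x0.
  by rewrite (cvg_lim (@ereal_hausdorff R) (hcv x x0)); exact: hlim.
have {}cv : \int[@leb R]_(x in posR) hn n x @[n --> \oo] -->
    \int[@leb R]_(x in posR) limn (hn ^~ x).
  apply: cv => [n x|x]; rewrite posRE => x0; first exact: (Lhn n).2.
  exact: hmono.
rewrite -(cvg_lim (@ereal_hausdorff R) cv); apply: lime_le; last exact: nearW.
by apply/cvg_ex; eexists; exact: cv.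
Qed.

(** Cuts height and support at the same bound and keeps a nonincreasing function nonincreasing. The
    bound [n.+1] is positive already for [n = 0]. *)
Definition trunc_at (h : R -> \bar R) (n : nat) (x : R) : \bar R :=
  if (x < n.+1%:R)%R then mine (h x) n.+1%:R%:E else 0.

Lemma Lplus_trunc_at h n : Lplus h -> Lplus (trunc_at h n).
Proof.
move=> h0; apply: Lplus_if; first exact: measurable_ltr_posR.
split; last by move=> x x0; rewrite le_min lee_fin ler0n andbT; exact: h0.2.
by apply: measurable_mine; [exact: h0.1|exact: measurable_cst].
Qed.

Lemma trunc_at_mono (f : R -> \bar R) (x : R) : Lplus f -> (0 < x)%R ->
  {homo (fun n => trunc_at f n x) : m n / (m <= n)%N >-> m <= n}.
Proof.
move=> f0 x0 m n mn.
rewrite /trunc_at; have mnR : (m.+1%:R <= n.+1%:R :> R)%R by rewrite ler_nat.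
case: ifPn => [xm|_]; last exact: (Lplus_trunc_at n f0).2.
by rewrite (lt_le_trans xm mnR) le_min !ge_min lexx/= lee_fin mnR orbT.
Qed.

Lemma integral_posR_le_trunc h (q : R) (M : \bar R) : (0 < q)%R -> Lplus h ->
  (forall n : nat, \int[@leb R]_(x in posR) (trunc_at h n x `^ q) <= M) ->
  \int[@leb R]_(x in posR) (h x `^ q) <= M.
Proof.
move=> q0 h0.
have tn0 n x : (0 < x)%R -> 0 <= trunc_at h n x by exact: (Lplus_trunc_at n h0).2.
apply: (integral_posR_le_sup (hn := fun n x => trunc_at h n x `^ q)).
- exact: Lplus_poweR.
- by move=> n; apply: Lplus_poweR; exact: Lplus_trunc_at.
- move=> x x0 m n mn; apply: le_poweR; [exact: ltW|exact: tn0|].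
  exact: trunc_at_mono.
- move=> x x0; have := h0.2 x x0; case hxE : (h x) => [y| |] // y0.
    pose n := Num.truncn (Num.max x y).
    have : (Num.max x y < n.+1%:R)%R by exact: truncnS_gt.
    rewrite gt_max => /andP[xn yn].
    apply: ereal_sup_ubound; exists n => //.
    rewrite /trunc_at xn hxE; congr (_ `^ _); apply/min_idPl.
    by rewrite lee_fin ltW.
  rewrite poweRyr ?gt_eqF// leye_eq; apply/eqP/eqyP => A A0.
  pose n := Num.truncn (Num.max x (A `^ q^-1)%R).
  have : (Num.max x (A `^ q^-1) < n.+1%:R)%R by exact: truncnS_gt.
  rewrite gt_max => /andP[xn An].
  apply: (@le_trans _ _ (trunc_at h n x `^ q)); last by apply: ereal_sup_ubound; exists n.
  rewrite /trunc_at xn hxE (min_idPr _) ?leey// poweR_EFin lee_fin.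
  have := ge0_ler_powR (ltW q0) (powR_ge0 _ _) (ler0n _ _) (ltW An).
  by rewrite -powRrM mulVf ?gt_eqF// powRr1// ltW.
Qed.

(** The weights can be compared only on nonincreasing functions. This suffices because [Hop a f] is
    nonincreasing for every [f], hence so is the power of it that is dual to the q-norm. *)
Lemma admissible_transfer (p q p' q' C D : R) (a b : R -> \bar R) :
  (0 < p)%R -> (1 < q)%R -> (1 < p')%R -> (0 < q')%R ->
  (p^-1 + p'^-1 = 1)%R -> (q^-1 + q'^-1 = 1)%R -> (0 <= D)%R -> (0 <= C)%R ->
  normal_form a -> normal_form b ->
  (forall t, (0 < t)%R ->
    \int[@leb R]_(x in `]0%R, t[) ((x `^ (p' - 1))%:E * a x) <=
    C%:E * \int[@leb R]_(x in `]0%R, t[) ((x `^ (p' - 1))%:E * b x)) ->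
  admissible p q b D -> admissible p q a (C `^ p'^-1 * D).
Proof.
move=> p0 q1 p'1 q'0 pp' qq' D0 C0 anf bnf ab adm f f0 foo.
have q0 : (0 < q)%R by exact: lt_trans q1.
have p'0 : (0 < p')%R by exact: lt_trans p'1.
have La := Lplus_normal_form anf; have Lb := Lplus_normal_form bnf.
have Laf := Lplus_Hop La f0.
set N := _ * _.
have N0 : 0 <= N by rewrite mule_ge0 ?poweR_ge0// lee_fin mulr_ge0// powR_ge0.
have qN0 : (q != 0)%R by rewrite gt_eqF.
rewrite -[leRHS](poweR_rootK N0 qN0); apply: le_poweR; first by rewrite invr_ge0 ltW.
  by apply: integral_posR_ge0; exact: Lplus_poweR.
apply: integral_posR_le_trunc => // n.
pose h := trunc_at (Hop a f) n.
have Lh : Lplus h by exact: Lplus_trunc_at.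
have hle x : (0 < x)%R -> h x <= n.+1%:R%:E.
  by move=> x0; rewrite /h /trunc_at; case: ifPn => _; rewrite ?ge_min ?lexx ?orbT// lee_fin.
have hHop x : (0 < x)%R -> h x <= Hop a f x.
  move=> x0; rewrite /h /trunc_at; case: ifPn => _; rewrite ?ge_min ?lexx//.
  exact: Laf.2.
have hni x y : (0 < x)%R -> (x <= y)%R -> h y <= h x.
  move=> x0 xy; have y0 := lt_le_trans x0 xy.
  rewrite {1}/h /trunc_at; case: ifPn => [yn|_]; last exact: Lh.2.
  rewrite /h /trunc_at (le_lt_trans xy yn) le_min !ge_min lexx orbT andbT.
  by rewrite (Hop_nonincreasing anf f0 x0 xy).
have hz x : (n.+1%:R <= x)%R -> h x = 0.
  by rewrite leNgt => /negbTE xn; rewrite /h /trunc_at xn.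
rewrite -/h; clearbody h.
(* The dual function of the q-norm: [g^q'] and [g * h] are both [h^q]. *)
pose g x := h x `^ (q - 1).
have q10 : (0 < q - 1)%R by rewrite subr_gt0.
have gnf : normal_form g.
  split=> [x x0|x y x0 xy]; first exact: poweR_ge0.
  apply: le_poweR; [exact: ltW|apply: Lh.2; exact: lt_le_trans xy|exact: hni].
have g0 := Lplus_normal_form gnf.
have gB x : (0 < x)%R -> g x <= (n.+1%:R `^ (q - 1))%:E.
  by move=> x0; rewrite -poweR_EFin; apply: le_poweR; [exact: ltW|exact: Lh.2|exact: hle].
have u0 : (0 < n.+1%:R :> R)%R by rewrite ltr0n.
have gu x : (n.+1%:R <= x)%R -> g x = 0.
  by move=> /hz; rewrite /g => ->; rewrite poweR0r// gt_eqF.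
set J := \int[_]_(x in _) _.
have J0 : 0 <= J by apply: integral_posR_ge0; exact: Lplus_poweR.
have Joo : J < +oo.
  have : J <= (n.+1%:R `^ q * (n.+1%:R - 0))%:E.
    have -> : J = \int[@leb R]_(x in `]0%R, n.+1%:R[) (h x `^ q).
      rewrite (@integral_posR_if _ (fun x => (x < n.+1%:R)%R)); last first.
        by move=> x; rewrite /= in_itv/=; split=> [/andP[]|[-> ->]].
      apply: eq_integral_posR => x x0; case: ltP => // /hz ->.
      by rewrite poweR0r.
    apply: (integral_oo_le (lexx 0%R) (ltW u0) (Lplus_poweR q Lh)).
    move=> x /andP[x0 _]; rewrite -poweR_EFin; apply: le_poweR; [exact: ltW|exact: Lh.2|exact: hle].
  by move/le_lt_trans; apply; rewrite ltry.
have gq' : \int[@leb R]_(x in posR) (g x `^ q') = J.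
  apply: eq_integral_posR => x x0; rewrite /g -poweRrM; congr (_ `^ _).
  by rewrite conj_mul1// addrC.
have JE : J <= \int[@leb R]_(x in posR) (g x * Hop a f x).
  apply: (le_integral_posR (Lplus_poweR q Lh) (LplusM g0 Laf)).
  move=> x x0; apply: (@le_trans _ _ (g x * h x)); last first.
    by apply: lee_wpmul2l; [exact: poweR_ge0|exact: hHop].
  have := hle x x0; have := Lh.2 x x0; rewrite /g.
  case: (h x) => [y| |]//; rewrite lee_fin => y0 _.
  by rewrite !poweR_EFin -EFinM mulrC mulr_powRB1.
(* The pairing is moved to the adjoint for [a], split by Hoelder, passed from [a] to [b] at the cost
   [C^(1/p')], and bounded by the adjoint inequality for [b]. *)
have key : J <= N * J `^ q'^-1.
  apply: (le_trans JE); rewrite (Hop_adj La f0 g0).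
  apply: le_trans (hoelder_posR p0 p'0 pp' f0 (Lplus_adj La g0)) _.
  rewrite /N muleAC [leRHS]muleC; apply: lee_wpmul2l; first exact: poweR_ge0.
  have := admissible_adj p0 q0 p'0 q'0 pp' qq' D0 bnf adm g0 gB gu u0.
  rewrite gq' => H; rewrite EFinM -muleA.
  apply: le_trans (lee_wpmul2l _ H); last by rewrite lee_fin powR_ge0.
  have := integral_adj_le (r := p' - 1) _ C0 anf bnf gnf gB gu u0 ab.
  rewrite subr_gt0 subrK => /(_ p'1) /(le_poweR (r := p'^-1)); rewrite invr_ge0 (ltW p'0).
  move=> /(_ isT (integral_posR_ge0 (Lplus_poweR p' (Lplus_adj La g0)))).
  by rewrite poweRM// (integral_posR_ge0 (Lplus_poweR p' (Lplus_adj Lb g0))).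
have := root_of_self_bound q'0 q0 _ J0 Joo N0 key; rewrite addrC => /(_ qq').
move/(le_poweR (ltW q0) (poweR_ge0 _ _)).
by rewrite poweR_Kroot.
Qed.

End transfer.

(** * Transport of densities *)

Section density.
Context {R : realType}.

Section one_density.
Variables (k : R -> R) (B : R).
Hypothesis ck : forall x, 0 < x -> {for x, continuous k}.
Hypothesis k0 : forall x, 0 < x -> 0 <= k x.
Hypothesis kB : forall x, 0 < x -> k x <= B.
Let K (x : R) : \bar R := (k x)%:E.

Let LK : Lplus K. Proof. exact: Lplus_EFin. Qed.
Let KB x : 0 < x -> (K x <= B%:E)%E. Proof. by move=> /kB; rewrite lee_fin. Qed.

Lemma prim_diff_approx (x y d e : R) : 0 < x -> x <= y -> 0 <= e -> 0 <= d ->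
  (forall t, x < t < y -> `|d - k t| <= e) ->
  `|d * (y - x) - (prim K y - prim K x)| <= e * (y - x).
Proof.
move=> x0 xy e0 d0 H; move: xy; rewrite le_eqVlt => /predU1P[<-|xy].
  by rewrite !subrr !mulr0 subrr normr0.
have xy0 : 0 < y - x by rewrite subr_gt0.
have ps := prim_split LK KB (ltW x0) xy.
have up : prim K y - prim K x <= (d + e) * (y - x).
  rewrite -lee_fin -ps; apply: (integral_oo_le (ltW x0) (ltW xy) LK) => t /H.
  by rewrite lee_fin distrC ler_distl => /andP[_ ->].
have lo : (d - e) * (y - x) <= prim K y - prim K x.
  have [de|de] := leP 0 (d - e); last first.
    apply: (@le_trans _ _ 0); first by rewrite mulr_le0_ge0 ?ltW.
    by rewrite subr_ge0; apply: prim_le LK KB _ _ (ltW x0) (ltW xy).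
  rewrite -lee_fin -ps; apply: (integral_oo_ge (ltW x0) (ltW xy) de LK) => t /H.
  by rewrite lee_fin distrC ler_distl => /andP[-> _].
by rewrite ler_norml; apply/andP; split; lra.
Qed.

(** The increment over a short interval differs from [k x] times its length by at most [e] times its
    length; increments of either sign reduce to this, the interval being read from its left end. *)
Lemma is_derive_prim (x : R) : 0 < x -> is_derive x 1 (prim K) (k x).
Proof.
move=> x0; have d0 := k0 x0.
suff H : (fun h => h^-1 *: ((prim K \o shift x) (h *: 1) - prim K x)) @ 0^' --> k x.
  by split; [apply/cvg_ex; exists (k x)|exact: cvg_lim H].
apply/cvgrPdist_le => e e0.
have [r /= r0 Hr] := (cvgrPdist_le _ _).1 (ck x0) e e0.
have m0 : 0 < Num.min r x by rewrite lt_min r0 x0.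
near=> h.
have h0 : h != 0 by near: h; exact: nbhs_dnbhs_neq.
have : `|h| < Num.min r x.
  by near: h; apply: dnbhs0_lt.
rewrite lt_min => /andP[hr hx].
rewrite /= /shift/= /GRing.scale/= mulr1.
rewrite (_ : k x - _ = h^-1 * (k x * h - (prim K (h + x) - prim K x))); last first.
  by rewrite [RHS]mulrBr [k x * h]mulrC mulKf.
rewrite normrM normfV ler_pdivrMl ?normr_gt0// [`|h| * e]mulrC.
have [h1|h1] := ltP 0 h.
  have := @prim_diff_approx x (h + x) (k x) e x0 _ (ltW e0) d0.
  rewrite addrK lerDr (ltW h1) (gtr0_norm h1) => /(_ isT); apply.
  move=> t /andP[xt th]; apply: Hr => /=; rewrite ltr0_norm ?subr_lt0//.
  by rewrite opprB ltrBlDr (lt_trans th)// ltrD2r -(gtr0_norm h1).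
have {}h1 : h < 0 by rewrite lt_neqAle h0.
have hx0 : 0 < h + x by move: hx; rewrite ltr0_norm// ltrNl -subr_gt0 opprK addrC.
have := @prim_diff_approx (h + x) x (k x) e hx0 _ (ltW e0) d0.
rewrite gerDr (ltW h1) opprD addrCA subrr addr0 => /(_ isT) H.
rewrite (ltr0_norm h1) -[X in `|X|]opprK normrN.
rewrite (_ : - (_ - _) = k x * - h - (prim K x - prim K (h + x))); last by ring.
apply: H => t /andP[ht tx]; apply: Hr => /=; rewrite ger0_norm ?subr_ge0 ?(ltW tx)//.
by rewrite ltrBlDr -ltrBlDl; apply: lt_trans ht; rewrite addrC ltrD2r ltrNl -(ltr0_norm h1).
Unshelve. all: by end_near.
Qed.

Lemma cvg_prim0 : prim K x @[x --> 0^'+] --> 0.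
Proof.
have B0 : 0 <= B by exact: le_trans (k0 ltr01) (kB ltr01).
apply/cvgrPdist_le => e e0; near=> x.
have x0 : 0 < x by near: x; exact: nbhs_right_gt.
have xe : x <= e / (B + 1) by near: x; apply: nbhs_right_le; rewrite divr_gt0// ltr_wpDl.
rewrite sub0r normrN ger0_norm; last exact: prim_ge0.
have := prim_lip LK KB (lexx 0) (ltW x0); rewrite prim0 add0r subr0 => /le_trans; apply.
move: xe; rewrite ler_pdivlMr ?ltr_wpDl// => xe; nra.
Unshelve. all: by end_near.
Qed.

Variable T : R.
Hypothesis KT : (\int[@leb R]_(x in posR) K x = T%:E)%E.

Lemma prim_le_total x : 0 <= x -> prim K x <= T.
Proof.
move=> x0; rewrite -lee_fin -(primE LK KB x0) -KT.
by apply: (le_integral_subset _ _ _ _ LK);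
  [exact: measurable_itv|exact: measurable_itv|exact: itv_posR|].
Qed.

Lemma prim_near_total y : y < T -> exists2 u : R, 0 < u & y < prim K u.
Proof.
move=> yT; apply/not_exists2P => H.
have : (T%:E <= y%:E)%E.
  rewrite -KT; apply: (integral_posR_le LK) => u u0.
  rewrite (primE LK KB (ltW u0)) lee_fin.
  by have [|/negP] := H u; rewrite ?u0// -leNgt.
by rewrite lee_fin leNgt yT.
Qed.

Lemma cvg_prim_total : prim K x @[x --> +oo] --> T.
Proof.
apply/cvgrPdist_le => e e0.
have [u u0 Hu] := @prim_near_total (T - e) (ltac:(lra)).
near=> x.
have ux : u <= x by near: x; apply: nbhs_pinfty_ge; exact: num_real.
have := prim_le LK KB (ltW u0) ux; have := prim_le_total (le_trans (ltW u0) ux).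
by move=> h1 h2; rewrite ger0_norm ?subr_ge0//; lra.
Unshelve. all: by end_near.
Qed.

Hypothesis kpos : forall x, 0 < x -> 0 < k x.

Lemma prim_lt (x y : R) : 0 < x -> x < y -> prim K x < prim K y.
Proof.
move=> x0 xy; rewrite lt_neqAle (prim_le LK KB (ltW x0) (ltW xy)) andbT.
apply/eqP => E.
have := kpos x0; have := is_derive_prim x0 => -[_ <-].
(* By continuity [k] stays above [k x / 2] on an interval to the right of [x], which forces a
   positive increment. *)
have [r /= r0 Hr] := (cvgrPdist_lt _ _).1 (ck x0) (k x / 2) (divr_gt0 (kpos x0) (ltr0Sn _ _)).
pose v := Num.min y (x + r).
have xv : x < v by rewrite lt_min xy ltrDl.
have vy : v <= y by rewrite ge_min lexx.
have vr : v <= x + r by rewrite ge_min lexx orbT.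
have k20 : 0 <= k x / 2 by rewrite divr_ge0// k0.
have : ((k x / 2 * (v - x))%:E <= (prim K v - prim K x)%:E)%E.
  rewrite -(prim_split LK KB (ltW x0) xv).
  apply: (integral_oo_ge (ltW x0) (ltW xv) k20 LK) => t /andP[xt tv].
  rewrite lee_fin; have := Hr t; rewrite /= ltr0_norm ?subr_lt0// opprB ltrBlDl.
  by move=> /(_ (lt_le_trans tv vr)); rewrite ltr_norml => /andP[_]; lra.
rewrite lee_fin; have := prim_le LK KB (ltW (lt_trans x0 xv)) vy; rewrite -E => h1 h2.
have := mulr_gt0 (kpos x0) (_ : 0 < v - x); rewrite subr_gt0 => /(_ xv); lra.
Qed.

Lemma prim_gt0 x : 0 < x -> 0 < prim K x.
Proof.
move=> x0; apply: le_lt_trans (prim_lt (divr_gt0 x0 (ltr0Sn _ 1)) _); first exact: prim_ge0.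
by lra.
Qed.

Lemma prim_lt_total x : 0 < x -> prim K x < T.
Proof.
move=> x0; apply: lt_le_trans (prim_lt x0 (_ : x < x + 1)) _; first by rewrite ltrDl.
by apply: prim_le_total; rewrite addr_ge0// ltW.
Qed.

Lemma total_gt0 : 0 < T.
Proof. exact: lt_trans (prim_gt0 ltr01) (prim_lt_total ltr01). Qed.

Lemma prim_surj y : 0 < y < T -> exists2 x, 0 < x & prim K x = y.
Proof.
move=> /andP[y0 yT].
have B0 : 0 <= B by exact: le_trans (k0 ltr01) (kB ltr01).
have [u u0 Hu] : exists2 u : R, 0 < u & prim K u < y.
  have u0 : 0 < y / (B + 1) by rewrite divr_gt0// ltr_wpDl.
  exists (y / (B + 1)) => //.
  have := prim_lip LK KB (lexx 0) (ltW u0); rewrite prim0 add0r subr0 => /le_lt_trans; apply.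
  by rewrite mulrA ltr_pdivrMr ?ltr_wpDl// mulrDr mulr1 mulrC ltrDl.
have [v v0 Hv] := prim_near_total yT.
have uv : u <= v.
  rewrite leNgt; apply/negP => vu; have := prim_le LK KB (ltW v0) (ltW vu).
  by move=> h; move: (lt_trans Hu Hv); rewrite ltNge h.
have cuv : {within `[u, v], continuous (prim K)}.
  apply: continuous_in_subspaceT => x /set_mem/=; rewrite in_itv/= => /andP[ux _].
  by apply: prim_continuous LK KB _ _; exact: lt_le_trans ux.
have [|c cuv' <-] := IVT uv cuv (v := y).
  by rewrite ge_min le_max (ltW Hu) (ltW Hv) orbT.
by exists c => //; move: cuv'; rewrite in_itv/= => /andP[uc _]; exact: lt_le_trans uc.
Qed.

End one_density.

End density.

Section transport.
Context {R : realType}.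
Variables (k1 k2 : R -> R) (B1 B2 T1 T2 : R).
Hypothesis ck1 : forall x, 0 < x -> {for x, continuous k1}.
Hypothesis k10 : forall x, 0 < x -> 0 < k1 x.
Hypothesis kB1 : forall x, 0 < x -> k1 x <= B1.
Hypothesis ck2 : forall x, 0 < x -> {for x, continuous k2}.
Hypothesis k20 : forall x, 0 < x -> 0 < k2 x.
Hypothesis kB2 : forall x, 0 < x -> k2 x <= B2.
Let P1 := prim (fun x => (k1 x)%:E).
Let P2 := prim (fun x => (k2 x)%:E).
Hypothesis KT1 : (\int[@leb R]_(x in posR) (k1 x)%:E = T1%:E)%E.
Hypothesis KT2 : (\int[@leb R]_(x in posR) (k2 x)%:E = T2%:E)%E.

Let k1_ge0 x : 0 < x -> 0 <= k1 x. Proof. by move=> /k10/ltW. Qed.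
Let k2_ge0 x : 0 < x -> 0 <= k2 x. Proof. by move=> /k20/ltW. Qed.
Let lt2 x y : 0 < x -> x < y -> P2 x < P2 y.
Proof. exact: (prim_lt ck2 k2_ge0 kB2). Qed.
Let gt1 x : 0 < x -> 0 < P1 x.
Proof. exact: (prim_gt0 ck1 k1_ge0 kB1). Qed.
Let gt2 x : 0 < x -> 0 < P2 x.
Proof. exact: (prim_gt0 ck2 k2_ge0 kB2). Qed.
Let ltT1 x : 0 < x -> P1 x < T1.
Proof. exact: (prim_lt_total ck1 k1_ge0 kB1). Qed.
Let ltT2 x : 0 < x -> P2 x < T2.
Proof. exact: (prim_lt_total ck2 k2_ge0 kB2). Qed.
Let T10 : 0 < T1. Proof. exact: (total_gt0 ck1 k1_ge0 kB1 KT1 k10). Qed.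
Let T20 : 0 < T2. Proof. exact: (total_gt0 ck2 k2_ge0 kB2 KT2 k20). Qed.
Let l := T2 / T1.
Let l0 : 0 < l. Proof. exact: divr_gt0. Qed.

(** The inverse of the second primitive, by choice; the default 1 is taken only off its range and is
    never met, since [l * P1 x] lies in []0, T2[]. *)
Let inv2 (y : R) : R := xget 1 [set z | 0 < z /\ P2 z = y].
Let Z (x : R) : R := inv2 (l * P1 x).

Let inv2P y : 0 < y < T2 -> 0 < inv2 y /\ P2 (inv2 y) = y.
Proof.
move=> yT; rewrite /inv2; case: xgetP => [z -> //|H].
have [x x0 xE] := prim_surj ck2 k2_ge0 kB2 KT2 yT.
by case: (H x).
Qed.

Let P2_inj x y : 0 < x -> 0 < y -> P2 x = P2 y -> x = y.
Proof.
move=> x0 y0 E; case: (ltgtP x y) => // [xy|yx].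
  by have := lt2 x0 xy; rewrite E ltxx.
by have := lt2 y0 yx; rewrite E ltxx.
Qed.

Let inv2K x : 0 < x -> inv2 (P2 x) = x.
Proof.
move=> x0; have [|h0 hE] := @inv2P (P2 x); first by rewrite gt2// ltT2.
exact: P2_inj.
Qed.

Let ZP x : 0 < x -> 0 < Z x /\ P2 (Z x) = l * P1 x.
Proof.
move=> x0; apply: inv2P; rewrite mulr_gt0 ?gt1//= /l mulrAC ltr_pdivrMr//.
by rewrite ltr_pM2l// ltT1.
Qed.

Let is_derive_Z (x : R) : 0 < x -> is_derive x 1 Z (l * k1 x / k2 (Z x)).
Proof.
move=> x0; have [z0 zE] := ZP x0.
have dP2 (z : R) : 0 < z -> is_derive z 1 P2 (k2 z) by exact: is_derive_prim ck2 k2_ge0 kB2 z.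
have dinv : is_derive (l * P1 x) 1 inv2 (k2 (Z x))^-1.
  rewrite -zE; apply: is_derive_inverse (dP2 _ z0) _.
  - by near=> z; apply: inv2K; near: z; exact: lt_nbhsr.
  - near=> z; apply: is_derive_continuous (dP2 z _).
    by near: z; exact: lt_nbhsr.
  - by rewrite gt_eqF// k20.
have dP1 := is_derive_prim ck1 k1_ge0 kB1 x0.
have := is_derive1_comp (g := fun z => l * P1 z) dinv (is_derive_mulc l dP1).
by move=> H; apply: is_derive_eq H _; rewrite mulrC.
Unshelve. all: by end_near.
Qed.

Let Z_gt (x a : R) : 0 < x -> 0 < a -> P2 a < l * P1 x -> a < Z x.
Proof.
move=> x0 a0 H; have [z0 zE] := ZP x0; rewrite ltNge; apply/negP => za.
move: za; rewrite le_eqVlt => /predU1P[za|/(lt2 z0)].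
  by move: H; rewrite -zE za ltxx.
by rewrite zE => /(lt_trans H); rewrite ltxx.
Qed.

Let Z_lt (x a : R) : 0 < x -> 0 < a -> l * P1 x < P2 a -> Z x < a.
Proof.
move=> x0 a0 H; have [z0 zE] := ZP x0; rewrite ltNge; apply/negP => za.
move: za; rewrite le_eqVlt => /predU1P[za|/(lt2 a0)].
  by move: H; rewrite -zE za ltxx.
by rewrite zE => /lt_trans/(_ H); rewrite ltxx.
Qed.

(** [Z] is the inverse of [P2] applied to [T2 / T1 * P1], the factor matching the total masses.
    Positivity of both densities makes the primitives strictly increasing, and the inverse function
    rule gives [Z']. *)
Lemma monotone_transport : exists Z : R -> R,
  [/\ forall x, 0 < x -> 0 < Z x,
      forall x, 0 < x -> P2 (Z x) = T2 / T1 * P1 x,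
      forall x : R, 0 < x -> is_derive x 1 Z (T2 / T1 * k1 x / k2 (Z x)),
      Z x @[x --> 0^'+] --> 0^'+ & Z x @[x --> +oo] --> +oo].
Proof.
exists Z; split.
- by move=> x /ZP[].
- by move=> x /ZP[].
- exact: is_derive_Z.
- suff Z00 : Z x @[x --> 0^'+] --> 0.
    move=> A /= HA; have := Z00 _ HA.
    apply: filterS2 (nbhs_right_gt 0) => x x0 /=; apply.
    by have [] := ZP x0.
  apply/cvgrPdist_le => e e0; near=> x.
  have x0 : 0 < x by near: x; exact: nbhs_right_gt.
  have [z0 _] := ZP x0.
  rewrite sub0r normrN gtr0_norm// ltW// Z_lt//.
  rewrite -ltr_pdivlMl//; near: x.
  by apply: (cvgr_lt (0 : R) (cvg_prim0 ck1 k1_ge0 kB1)); rewrite mulr_gt0 ?invr_gt0 ?gt2.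
- apply/cvgryPge => A; near=> x.
  have x0 : 0 < x by near: x; apply: nbhs_pinfty_gt; exact: num_real.
  pose a := Num.max A 1; have a0 : 0 < a by rewrite lt_max ltr01 orbT.
  apply: (@le_trans _ _ a); first by rewrite le_max lexx.
  rewrite ltW// Z_gt//.
  rewrite -ltr_pdivrMl//; near: x.
  apply: (cvgr_gt T1 (cvg_prim_total ck1 k1_ge0 kB1 KT1)).
  rewrite ltr_pdivrMl// /l divfK ?gt_eqF// ltT2//.
  by rewrite lt_max ltr01 orbT.
Unshelve. all: by end_near.
Qed.

End transport.

Section integrability.
Context {R : realType}.
Local Open Scope ereal_scope.

Lemma Lplus_powRZ (C r : R) : (0 <= C)%R -> Lplus (fun x : R => (C * x `^ r)%:E).
Proof.
move=> C0; apply: Lplus_EFin => x x0; last by rewrite mulr_ge0// powR_ge0.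
by apply: cvgMr; exact: continuous_powR.
Qed.

Lemma integral_posR_lty (h : R -> \bar R) (B C r c : R) : Lplus h -> (0 < c)%R -> (1 < r)%R ->
  (0 <= C)%R -> (forall x, (0 < x)%R -> h x <= B%:E) ->
  (forall x, (c < x)%R -> h x <= (C * x `^ (- r))%:E) ->
  \int[@leb R]_(x in posR) h x < +oo.
Proof.
move=> h0 c0 r1 C0 hB hC.
have Nr : (- r < -1)%R by rewrite ltrN2.
pose T := (C * (c `^ (- r + 1) / - (- r + 1)))%R.
have tail u : (c < u)%R -> \int[@leb R]_(x in `]c, u[) h x <= T%:E.
  move=> cu; have L3 := Lplus_powRZ (- r) C0.
  apply: (@le_trans _ _ (\int[@leb R]_(x in `]c, u[) (C * x `^ (- r))%:E)).
    apply: (ge0_le_integral (@leb R) (measurable_itv_leb `]c, u[)).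
    - by move=> x /= /(itv_posR (ltW c0)); rewrite posRE; exact: h0.2.
    - by apply: (Lplus_sub _ h0); exact: itv_posR (ltW c0).
    - by apply: (Lplus_sub _ L3); exact: itv_posR (ltW c0).
    - by move=> x /=; rewrite in_itv/= => /andP[cx _]; exact: hC.
  have cy : `]c, +oo[%classic `<=` (posR : set R).
    by move=> x /=; rewrite posRE in_itv/= andbT; exact: lt_trans.
  apply: (@le_trans _ _ (\int[@leb R]_(x in `]c, +oo[) (C * x `^ (- r))%:E)).
    apply: (le_integral_subset _ _ _ cy L3); try exact: measurable_itv.
    by move=> x /=; rewrite !in_itv/= => /andP[->].
  under eq_integral do rewrite EFinM.
  rewrite ge0_integralZl_EFin//; first by rewrite integral_powR_y.
  - exact: measurable_itv_leb.
  - by move=> x _; rewrite lee_fin powR_ge0.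
  - by apply: (Lplus_sub cy); exact: Lplus_powR.
apply: (@le_lt_trans _ _ (B * c + T)%:E); last by rewrite ltry.
have T0 : (0 <= T)%R by rewrite mulr_ge0// divr_ge0 ?powR_ge0//; lra.
have B0 := prim_bound_ge0 h0 hB.
apply: (integral_posR_le h0) => u u0; have [uc|cu] := leP u c.
  apply: le_trans (integral_oo_bound h0 hB (lexx 0%R) (ltW u0)) _.
  by rewrite subr0 lee_fin -[X in (X <= _)%R]addr0 lerD// ler_wpM2l.
rewrite (primE h0 hB (ltW u0)) -[X in X%:E](subrK (prim h c)) EFinD.
rewrite -(prim_split h0 hB (ltW c0) cu) addrC.
rewrite [leRHS]EFinD; apply: leeD; last exact: tail.
rewrite -(primE h0 hB (ltW c0)).
by apply: le_trans (integral_oo_bound h0 hB (lexx 0%R) (ltW c0)) _; rewrite subr0.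
Qed.
End integrability.

(** * Bliss's inequality *)

Section bliss_density.
Context {R : realType}.
Variables (th s : R).
Hypothesis th0 : 0 < th.
Hypothesis s1 : 1 < s.
Hypothesis ths : 1 < (s - 1) * th.

(** Up to a dilation and a factor, the q-th power of the image of an extremal function. The
    hypothesis [ths] is the integrability of [z^th] against it at infinity. *)
Definition bliss_density (z : R) : R := (1 + z `^ th) `^ (- s).

Let one_pow_gt0 (z : R) : 0 < 1 + z `^ th.
Proof. by rewrite ltr_wpDr// powR_ge0. Qed.

Lemma is_derive_one_pow (z : R) : 0 < z ->
  is_derive z 1 (fun z => 1 + z `^ th) (th * z `^ (th - 1)).
Proof.
move=> z0; apply: is_derive_eq (is_deriveD (is_derive_cst (1 : R) z 1) (is_derive1_powR th z0)) _.
by rewrite add0r.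
Qed.

Lemma continuous_one_pow (r z : R) : 0 < z -> {for z, continuous (fun z => (1 + z `^ th) `^ r)}.
Proof.
move=> z0; have := @is_derive_powR_comp _ (fun z => 1 + z `^ th) z _ r (one_pow_gt0 z)
  (is_derive_one_pow z0).
exact: is_derive_continuous.
Qed.

Lemma bliss_density_gt0 z : 0 < bliss_density z.
Proof. by rewrite powR_gt0. Qed.

Lemma one_pow_le1 (r z : R) : r <= 0 -> (1 + z `^ th) `^ r <= 1.
Proof.
move=> r0; rewrite -[leRHS](powRr0 (1 + z `^ th)) ler_powR//.
by rewrite lerDl powR_ge0.
Qed.

Lemma one_pow_le (r z : R) : r <= 0 -> 0 < z -> (1 + z `^ th) `^ r <= z `^ (th * r).
Proof.
move=> r0 z0; rewrite powRrM -(opprK r) !(powRN _ (- r)) lef_pV2 ?posrE ?powR_gt0//.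
apply: ge0_ler_powR; rewrite ?nnegrE ?powR_ge0 ?oppr_ge0// ?(ltW (one_pow_gt0 z))//.
by rewrite lerDr.
Qed.

Lemma Lplus_bliss_density : Lplus (fun z => (bliss_density z)%:E).
Proof.
apply: Lplus_EFin => z z0; last exact: ltW (bliss_density_gt0 z).
exact: continuous_one_pow.
Qed.

Let P := prim (fun z => (bliss_density z)%:E).

(** A primitive of [z^th * bliss_density z]: the derivative of [z (1 + z^th)^(1-s)] is the density
    minus [(s-1) th - 1] times that function. The boundary term vanishes at both ends, so the moment
    is a rational multiple of the mass. *)
Definition bliss_moment (z : R) : R :=
  ((s - 1) * th - 1)^-1 * (P z - z * (1 + z `^ th) `^ (1 - s)).

Lemma is_derive_bliss_moment (z : R) : 0 < z ->
  is_derive z 1 bliss_moment (z `^ th * bliss_density z).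
Proof.
move=> z0.
have dP : is_derive z 1 P (bliss_density z).
  apply: (@is_derive_prim _ bliss_density 1) => //.
  - by move=> x; exact: continuous_one_pow.
  - by move=> x _; exact: ltW (bliss_density_gt0 x).
  - by move=> x _; rewrite one_pow_le1// oppr_le0 ltW// (lt_trans ltr01).
have dQ := is_derive_mul (is_derive_id z 1)
  (@is_derive_powR_comp _ (fun z => 1 + z `^ th) z _ (1 - s) (one_pow_gt0 z)
    (is_derive_one_pow z0)).
apply: is_derive_eq (is_derive_mulc _ (is_deriveB dP dQ)) _.
rewrite mul1r (_ : 1 - s - 1 = - s); last by ring.
rewrite (_ : (1 + z `^ th) `^ (1 - s) = (1 + z `^ th) * bliss_density z); last first.
  by rewrite powRD ?(gt_eqF (one_pow_gt0 z)) ?implybT// powRr1 ?(ltW (one_pow_gt0 z)).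
rewrite -/(bliss_density z).
have zE := mulr_powRB1 (ltW z0) th0.
move: zE; set y := z `^ (th - 1); set x := z `^ th; set d := bliss_density z.
have : (s - 1) * th - 1 != 0 by rewrite subr_eq0 gt_eqF.
clearbody x y d => ne <-; move: ne; rewrite mulrBl mul1r => ne; field.
exact: ne.
Qed.

Lemma cvg_bliss_tail0 : z * (1 + z `^ th) `^ (1 - s) @[z --> 0^'+] --> 0.
Proof.
apply/cvgrPdist_le => e e0; near=> z.
have z0 : 0 < z by near: z; exact: nbhs_right_gt.
have ze : z <= e by near: z; exact: nbhs_right_le.
rewrite sub0r normrN ger0_norm ?mulr_ge0 ?powR_ge0 ?(ltW z0)//.
apply: le_trans ze; rewrite ger_pMr// one_pow_le1// subr_le0 ltW//.
Unshelve. all: by end_near.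
Qed.

Lemma cvg_bliss_tail : z * (1 + z `^ th) `^ (1 - s) @[z --> +oo] --> 0.
Proof.
have r0 : 1 + th * (1 - s) < 0 by move: ths; lra.
apply/cvgrPdist_le => e e0; near=> z.
have z0 : 0 < z by near: z; apply: nbhs_pinfty_gt; exact: num_real.
have : `|0 - z `^ (1 + th * (1 - s))| <= e.
  by near: z; apply: (cvgrPdist_le _ _).1 (cvg_powRN r0) _ e0.
rewrite !sub0r !normrN !ger0_norm ?mulr_ge0 ?powR_ge0 ?(ltW z0)//.
apply: le_trans; rewrite (@powRD _ z 1) ?(gt_eqF z0) ?implybT// powRr1 ?(ltW z0)//.
by rewrite ler_pM2l// one_pow_le// subr_le0 ltW.
Unshelve. all: by end_near.
Qed.

End bliss_density.

(** * The power kernel *)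

Section power_kernel.
Context {R : realType}.

(** The exponent is [-1/r] so that the inverse function is [t^(-r)]; for [r = q/p'] this is the
    weight [x^(-p'/q)] of Hardy and Bliss. *)
Definition pow_kernel (r : R) (x : R) : \bar R := (x `^ (- r^-1))%:E.

Lemma powRNK (r x : R) : 0 < r -> 0 < x -> (x `^ (- r^-1)) `^ (- r) = x.
Proof. by move=> r0 x0; rewrite -powRrM mulrNN mulVf ?powRr1 ?(ltW x0)// gt_eqF. Qed.

Lemma powRNVK (r x : R) : 0 < r -> 0 < x -> (x `^ (- r)) `^ (- r^-1) = x.
Proof. by move=> r0 x0; rewrite -powRrM mulrNN divff ?powRr1 ?(ltW x0)// gt_eqF. Qed.

Lemma gt0_ltr_powRN (r y z : R) : 0 < r -> 0 < y -> y < z -> z `^ (- r) < y `^ (- r).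
Proof.
move=> r0 y0 yz; have z0 := lt_trans y0 yz.
rewrite !powRN ltf_pV2 ?posrE ?powR_gt0//.
by apply: gt0_ltr_powR; rewrite ?nnegrE ?ltW.
Qed.

Lemma lt_powRNV (r t x : R) : 0 < r -> 0 < t -> 0 < x ->
  (t < x `^ (- r^-1)) = (x < t `^ (- r)).
Proof.
move=> r0 t0 x0; have rV : 0 < r^-1 by rewrite invr_gt0.
apply/idP/idP => H.
  by rewrite -[x](powRNK r0 x0); exact: gt0_ltr_powRN.
by rewrite -[t](powRNVK r0 t0); exact: gt0_ltr_powRN.
Qed.

Lemma Lplus_pow_kernel (r : R) : Lplus (pow_kernel r).
Proof. exact: Lplus_powR. Qed.

Lemma normal_form_pow_kernel (r : R) : 0 < r -> normal_form (pow_kernel r).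
Proof.
move=> r0; split=> [x _|x y x0]; first by rewrite lee_fin powR_ge0.
rewrite le_eqVlt => /predU1P[->//|xy].
by rewrite lee_fin ltW// gt0_ltr_powRN// invr_gt0.
Qed.

Lemma Hop_pow_kernel (r : R) (f : R -> \bar R) (x : R) :
  (Hop (pow_kernel r) f x = \int[@leb R]_(t in `]0%R, (x `^ (- r^-1))%R[) f t)%E.
Proof.
by rewrite /Hop; congr (integral _ _ _).
Qed.

Lemma adj_pow_kernel (r : R) (h : R -> \bar R) (t : R) : 0 < r -> 0 < t ->
  (adj (pow_kernel r) h t = \int[@leb R]_(x in `]0%R, (t `^ (- r))%R[) h x)%E.
Proof.
move=> r0 t0; rewrite /adj; congr (integral _ _ _).
apply/seteqP; split=> x; rewrite /= in_itv/= lte_fin.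
  by move=> [x0]; rewrite lt_powRNV// x0.
by move=> /andP[x0 xt]; rewrite lt_powRNV.
Qed.

End power_kernel.

(** * Bliss's inequality for bounded functions, by transport *)

Section bliss_core.
Context {R : realType}.

(** The right-hand side is the derivative of [Z^(1/s) x^(1-1/s)] when [Z x = z] and [Z' x = d].
    Equality holds for [d = z / x], in particular when [Z] is linear. *)
Lemma transport_am_gm (s x z d : R) : 1 < s -> 0 < x -> 0 < z -> 0 < d ->
  d `^ s^-1 <= s^-1 * z `^ (s^-1 - 1) * d * x `^ (1 - s^-1) +
    z `^ s^-1 * ((1 - s^-1) * x `^ (1 - s^-1 - 1)).
Proof.
move=> s1 x0 z0 d0; have s0 : 0 < s by exact: lt_trans s1.
have sV : 0 < 1 - s^-1 by rewrite subr_gt0 invf_lt1.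
(* [e] is the exponent for which [a * b] is [d^(1/s)] and Young's inequality with exponents [s] and
   [s/(s-1)] yields the two terms of the derivative. *)
pose e := (1 - s^-1) / s.
pose a := d `^ s^-1 * (x / z) `^ e; pose b := (z / x) `^ e.
have xz0 : 0 < x / z by rewrite divr_gt0.
have zx0 : 0 < z / x by rewrite divr_gt0.
have := @conjugate_powR _ a b s (1 - s^-1)^-1 _ _ s0 (_ : 0 < (1 - s^-1)^-1) _.
rewrite invr_gt0 sV mulr_ge0 ?powR_ge0// invrK addrC subrK => /(_ isT isT isT erefl).
have -> : a * b = d `^ s^-1.
  rewrite /a /b -mulrA -powRM ?ltW// (_ : x / z * (z / x) = 1) ?powR1 ?mulr1//.
  by field; rewrite !gt_eqF.
have -> : a `^ s = d * (x / z) `^ (1 - s^-1).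
  rewrite /a powRM ?powR_ge0// -!powRrM mulVf ?gt_eqF// powRr1 ?(ltW d0)//.
  by rewrite /e divfK// gt_eqF.
have -> : b `^ (1 - s^-1)^-1 = (z / x) `^ s^-1.
  by rewrite /b -powRrM /e mulrAC divff ?mul1r// gt_eqF.
move=> /le_trans; apply; rewrite le_eqVlt; apply/orP; left; apply/eqP.
rewrite !powRM ?invr_ge0 ?ltW// !powR_inv// -!powRN opprB.
by rewrite (_ : 1 - s^-1 - 1 = - s^-1); [ring|rewrite addrAC subrr add0r].
Qed.

(** In the application [1/s = 1/p - 1/q], [sg = q/p'] and [th = p'/s]; the hypotheses record the
    consequences used. *)
Variables (p q p' s th sg : R).
Hypothesis p0 : 0 < p.
Hypothesis q0 : 0 < q.
Hypothesis p'1 : 1 < p'.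
Hypothesis s1 : 1 < s.
Hypothesis th0 : 0 < th.
Hypothesis sg0 : 0 < sg.
Hypothesis pp' : p^-1 + p'^-1 = 1.
Hypothesis e1 : q * (1 - s^-1) = sg + 1.
Hypothesis e2 : p' * (1 - s^-1) = 1 + sg^-1.
Hypothesis e3 : p' = th * s.
Hypothesis e4 : sg * p' = q.
Variable m : R.
Hypothesis mE : (\int[@leb R]_(z in posR) (bliss_density th s z)%:E = m%:E)%E.
Variables (f : R -> \bar R) (B u : R).
Hypothesis f0 : Lplus f.
Hypothesis fB : forall x, 0 < x -> (f x <= B%:E)%E.
Hypothesis fu : forall x, u <= x -> f x = 0%E.
Hypothesis u0 : 0 < u.
(** A positive primitive makes the source density [k] positive, as [monotone_transport] demands. *)
Hypothesis fpos : forall y, 0 < y -> 0 < prim f y.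

Let p'0 : 0 < p'. Proof. exact: lt_trans p'1. Qed.
Let s0 : 0 < s. Proof. exact: lt_trans s1. Qed.
Let B0 : 0 <= B. Proof. exact: prim_bound_ge0 f0 fB. Qed.
Let e5 : (s - 1) * th = 1 + sg^-1.
Proof.
rewrite -e2 e3 mulrBr mulr1 -mulrA divff ?gt_eqF// mulr1.
by rewrite mulrBl mul1r mulrC.
Qed.
Let ths : 1 < (s - 1) * th.
Proof. by rewrite e5 ltrDl invr_gt0. Qed.

Let beta (x : R) : R := x `^ (- sg^-1).
Let w (x : R) : R := prim f (beta x).
Let k (x : R) : R := w x `^ q.

Let beta_gt0 x : 0 < x -> 0 < beta x. Proof. exact: powR_gt0. Qed.

Let w_gt0 x : 0 < x -> 0 < w x. Proof. by move=> /beta_gt0; exact: fpos. Qed.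

Let cw x : 0 < x -> {for x, continuous w}.
Proof.
move=> x0; apply: (@continuous_comp _ _ _ beta (prim f)).
  exact: continuous_powR.
by apply: (prim_continuous f0 fB); exact: beta_gt0.
Qed.

Let w_le_beta x : 0 < x -> w x <= B * beta x.
Proof.
move=> x0; have := prim_lip f0 fB (lexx 0) (ltW (beta_gt0 x0)).
by rewrite prim0 add0r subr0.
Qed.

Let w_le x : 0 < x -> w x <= B * u.
Proof.
move=> x0; have [bu|ub] := leP (beta x) u.
  by apply: le_trans (w_le_beta x0) _; rewrite ler_wpM2l.
rewrite /w -lee_fin -(primE f0 fB (ltW (beta_gt0 x0))).
have -> : (\int[@leb R]_(t in `]0%R, beta x[) f t = \int[@leb R]_(t in `]0%R, u[) f t)%E.
  rewrite (@integral_posR_if _ (fun t => t < beta x)); last first.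
    by move=> t; rewrite /= in_itv/=; split=> [/andP[]|[-> ->]].
  rewrite [RHS](@integral_posR_if _ (fun t => t < u)); last first.
    by move=> t; rewrite /= in_itv/=; split=> [/andP[]|[-> ->]].
  apply: eq_integral_posR => t t0; case: (ltP t u) => [tu|/fu ->]; last by case: ifP.
  by rewrite (lt_trans tu ub).
by have := integral_oo_bound f0 fB (lexx 0) (ltW u0); rewrite subr0.
Qed.

Let ck x : 0 < x -> {for x, continuous k}.
Proof.
move=> x0; apply: (@continuous_comp _ _ _ w (fun z => z `^ q)); first exact: cw.
by apply: continuous_powR; exact: w_gt0.
Qed.

Let k_gt0 x : 0 < x -> 0 < k x. Proof. by move=> /w_gt0; exact: powR_gt0. Qed.

Let k_le x : 0 < x -> k x <= (B * u) `^ q.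
Proof.
move=> x0; apply: ge0_ler_powR; rewrite ?nnegrE ?(ltW q0) ?(ltW (w_gt0 x0)) ?mulr_ge0//.
  exact: ltW.
exact: w_le.
Qed.

Let Lk : Lplus (fun x => (k x)%:E).
Proof. by apply: Lplus_EFin => x x0; [exact: ck|exact: ltW (k_gt0 x0)]. Qed.

(** Bounded support of [f] bounds [k] near 0, and boundedness of [f] gives [w <= B * beta], so [k]
    decays like [x^(-p')] with [p' > 1]. *)
Let k_total : exists M : R, (\int[@leb R]_(x in posR) (k x)%:E = M%:E)%E.
Proof.
have : (\int[@leb R]_(x in posR) (k x)%:E < +oo)%E.
  apply: (@integral_posR_lty _ _ ((B * u) `^ q) (B `^ q) p' 1 Lk ltr01 p'1 (powR_ge0 _ _)).
    by move=> x x0; rewrite lee_fin k_le.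
  move=> x x1; have x0 : 0 < x by exact: lt_trans x1.
  have -> : - p' = - sg^-1 * q by rewrite -e4 mulNr mulKf// gt_eqF.
  rewrite lee_fin (powRrM x (- sg^-1) q) -powRM ?powR_ge0//.
  apply: ge0_ler_powR; rewrite ?nnegrE ?(ltW q0) ?(ltW (w_gt0 x0)) ?mulr_ge0 ?powR_ge0//.
  exact: w_le_beta.
move: (integral_posR_ge0 Lk).
by case: (integral _ _ _) => // M _ _; exists M.
Qed.

Let phi := bliss_density th s.
Let phi_gt0 z : 0 < phi z. Proof. exact: bliss_density_gt0. Qed.
Let cphi z : 0 < z -> {for z, continuous phi}.
Proof. by move=> z0; exact: continuous_one_pow. Qed.
Let phi_le z : phi z <= 1.
Proof. by apply: one_pow_le1; rewrite oppr_le0 ltW. Qed.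

Let moment := bliss_moment th s.

Let m0 : 0 < m.
Proof.
have phi0 (z : R) : 0 < z -> 0 <= phi z by move=> _; exact: ltW.
exact: (total_gt0 cphi phi0 (fun z _ => phi_le z) mE (fun z _ => phi_gt0 z)).
Qed.

Let k_ge0 x : 0 < x -> 0 <= k x. Proof. by move=> /k_gt0/ltW. Qed.

Section with_transport.
Variables (M l : R) (Z : R -> R).
Hypothesis lM : l * M = m.
Hypothesis ME : (\int[@leb R]_(x in posR) (k x)%:E = M%:E)%E.
Hypothesis Z_gt0 : forall x, 0 < x -> 0 < Z x.
Hypothesis ZE : forall x, 0 < x ->
  prim (fun z => (phi z)%:E) (Z x) = l * prim (fun x => (k x)%:E) x.
Hypothesis dZ : forall x : R, 0 < x -> is_derive x 1 Z (l * k x / phi (Z x)).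
Hypothesis Z_to0 : Z x @[x --> 0^'+] --> 0^'+.
Hypothesis Z_toy : Z x @[x --> +oo] --> +oo.

Let M0 : 0 < M. Proof. exact: (total_gt0 ck k_ge0 k_le ME k_gt0). Qed.

Let l0 : 0 < l. Proof. by rewrite -(pmulr_lgt0 l M0) lM. Qed.

(** A primitive of [l k Z^th], by the chain rule; its limits 0 and [sg * m] are used twice, in
    [integral_moment] and in [integral_FY]. *)
Let psi (x : R) : R := moment (Z x).

Let psiE x : 0 < x -> psi x = sg * (l * prim (fun x => (k x)%:E) x -
  Z x * (1 + Z x `^ th) `^ (1 - s)).
Proof.
move=> x0; rewrite /psi /moment /bliss_moment -/phi ZE// e5.
(* By [e5], the factor [1 / ((s-1) th - 1)] is [sg]. *)
by rewrite addrAC subrr add0r invrK.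
Qed.

Let psi_to0 : psi x @[x --> 0^'+] --> 0.
Proof.
pose G x := sg * (l * prim (fun x => (k x)%:E) x - Z x * (1 + Z x `^ th) `^ (1 - s)).
have GE : {near (0 : R)^'+, G =1 psi}.
  by near=> x; rewrite psiE//; near: x; exact: nbhs_right_gt.
apply: cvg_trans (near_eq_cvg GE) _.
have HG : G x @[x --> 0^'+] --> sg * (l * 0 - 0).
  apply: cvgMr; apply: cvgB.
    by apply: cvgMr; exact: (cvg_prim0 ck k_ge0 k_le).
  exact: (cvg_comp Z (fun z => z * (1 + z `^ th) `^ (1 - s)) Z_to0 (cvg_bliss_tail0 th s1)).
by rewrite (mulr0 l) subrr mulr0 in HG.
Unshelve. all: by end_near.
Qed.

Let psi_toy : psi x @[x --> +oo] --> sg * m.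
Proof.
pose G x := sg * (l * prim (fun x => (k x)%:E) x - Z x * (1 + Z x `^ th) `^ (1 - s)).
have GE : {near (pinfty_nbhs R), G =1 psi}.
  by apply: filterS (nbhs_pinfty_gt (num_real (0 : R))) => x x0; rewrite psiE.
apply: cvg_trans (near_eq_cvg GE) _.
have HG : G x @[x --> +oo] --> sg * (l * M - 0).
  apply: cvgMr; apply: cvgB.
    by apply: cvgMr; exact: (cvg_prim_total ck k_ge0 k_le ME).
  exact: (cvg_comp Z (fun z => z * (1 + z `^ th) `^ (1 - s)) Z_toy (cvg_bliss_tail s1 ths)).
by rewrite subr0 lM in HG.
Qed.

Let dpsi (x : R) : 0 < x -> is_derive x 1 psi (l * k x * Z x `^ th).
Proof.
move=> x0; have dm := is_derive_bliss_moment th0 s1 ths (Z_gt0 x0).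
apply: is_derive_eq (is_derive1_comp dm (dZ x0)) _.
by rewrite -/phi; field; rewrite gt_eqF.
Qed.

Let cZ x : 0 < x -> {for x, continuous Z}.
Proof. by move=> /dZ; exact: is_derive_continuous. Qed.

Let cZr r x : 0 < x -> {for x, continuous (fun x => Z x `^ r)}.
Proof.
move=> x0; apply: (@continuous_comp _ _ _ Z (fun z => z `^ r)); first exact: cZ.
by apply: continuous_powR; exact: Z_gt0.
Qed.

(** The transported form of the moment of [phi]; the value does not depend on [f]. *)
Let integral_moment : (\int[@leb R]_(x in posR) (l * k x * Z x `^ th)%:E = (sg * m)%:E)%E.
Proof.
rewrite (ge0_FTC_oy dpsi _ _ psi_to0 psi_toy) ?subr0//.
  by move=> x x0; apply: cvgM; [apply: cvgMr; exact: ck|exact: cZr].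
by move=> x x0; rewrite !mulr_ge0 ?powR_ge0 ?(ltW l0) ?k_ge0.
Qed.

Let Y (x : R) : R := Z x `^ s^-1 * x `^ (1 - s^-1).
Let dY (x : R) : R := s^-1 * Z x `^ (s^-1 - 1) * (l * k x / phi (Z x)) * x `^ (1 - s^-1) +
    Z x `^ s^-1 * ((1 - s^-1) * x `^ (1 - s^-1 - 1)).

Let sV : 0 < 1 - s^-1. Proof. by rewrite subr_gt0 invf_lt1. Qed.

Let is_derive_Y (x : R) : 0 < x -> is_derive x 1 Y (dY x).
Proof.
move=> x0; exact: (is_derive_mul (is_derive_powR_comp s^-1 (Z_gt0 x0) (dZ x0))
  (is_derive1_powR (1 - s^-1) x0)).
Qed.

Let cdY x : 0 < x -> {for x, continuous dY}.
Proof.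
move=> x0; apply: cvgD; apply: cvgM.
- apply: cvgM; first by apply: cvgMr; exact: cZr.
  apply: cvgM; first by apply: cvgMr; exact: ck.
  apply: cvgV; first by rewrite gt_eqF.
  apply: (@continuous_comp _ _ _ Z phi); first exact: cZ.
  by apply: cphi; exact: Z_gt0.
- exact: continuous_powR.
- exact: cZr.
- by apply: cvgMr; exact: continuous_powR.
Qed.

Let dY_ge0 x : 0 < x -> 0 <= dY x.
Proof.
move=> x0; apply: addr_ge0.
  by rewrite !mulr_ge0 ?powR_ge0 ?invr_ge0 ?(ltW s0) ?(ltW l0) ?k_ge0 ?(ltW (phi_gt0 _)).
by rewrite !mulr_ge0 ?powR_ge0 ?(ltW sV).
Qed.

Let Y_to0 : Y x @[x --> 0^'+] --> 0.
Proof.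
have sV0 : 0 < s^-1 by rewrite invr_gt0.
have H : Y x @[x --> 0^'+] --> (0 * 0 : R).
  apply: cvgM; last exact: powR_cvg0.
  exact: (cvg_comp Z (fun z => z `^ s^-1) Z_to0 (powR_cvg0 sV0)).
by rewrite mul0r in H.
Qed.

Let LdY : Lplus (fun x => (dY x)%:E).
Proof. by apply: Lplus_EFin => x x0; [exact: cdY|exact: dY_ge0]. Qed.

(** As [phi^(-1/s) = 1 + z^th], the left-hand side is [(l k)^(1-1/s) (Z')^(1/s)], and AM-GM bounds
    the last factor by [Y']. By [e1] the power of [w] is [sg + 1]. *)
Let pointwise x : 0 < x ->
  l * k x + l * k x * Z x `^ th <= l `^ (1 - s^-1) * (w x `^ (sg + 1) * dY x).
Proof.
move=> x0; have z0 := Z_gt0 x0; have lk0 : 0 < l * k x by rewrite mulr_gt0// k_gt0.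
pose D := l * k x / phi (Z x).
have D0 : 0 < D by rewrite divr_gt0.
have DE : D `^ s^-1 = (l * k x) `^ s^-1 * (1 + Z x `^ th).
  rewrite /D /phi /bliss_density powRN invrK powRM ?powR_ge0 ?(ltW lk0)//.
  by rewrite -(powRrM _ s) divff ?gt_eqF// powRr1// addr_ge0// powR_ge0.
have kE : (l * k x) `^ (1 - s^-1) = l `^ (1 - s^-1) * w x `^ (sg + 1).
  by rewrite powRM ?(ltW l0) ?k_ge0// /k -powRrM e1.
rewrite [leRHS]mulrA -kE.
rewrite (_ : _ + _ = (l * k x) `^ (1 - s^-1) * D `^ s^-1); last first.
  rewrite DE mulrA -powRD ?subrK ?powRr1 ?(ltW lk0)//; first by rewrite mulrDr mulr1.
  by rewrite oner_eq0.
by rewrite ler_pM2l ?powR_gt0//; exact: transport_am_gm.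
Qed.

Local Notation bf := (pow_kernel sg).

Let Lbeta : Lplus bf. Proof. exact: Lplus_pow_kernel. Qed.

Let LF r : Lplus (fun t => (prim f t `^ r)%:E).
Proof. exact: (Lplus_poweR r (Lplus_prim f0 fB)). Qed.

(** Together with [adj_Y] this makes the integration by parts an instance of [Hop_adj]: a power of
    [w] is an image under [Hop], and the adjoint of [Y'] is [Y] itself, since [Y] vanishes at 0. *)
Let Hop_w x : 0 < x ->
  (Hop bf (fun t => f t * (prim f t `^ sg)%:E) x = (w x `^ (sg + 1) / (sg + 1))%:E)%E.
Proof.
move=> x0; rewrite Hop_pow_kernel.
by rewrite (integral_prim_powR f0 fB sg0 (beta_gt0 x0)).
Qed.

Let gam (t : R) : R := t `^ (- sg).
Let gam_gt0 t : 0 < t -> 0 < gam t. Proof. exact: powR_gt0. Qed.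
Let gamK t : 0 < t -> beta (gam t) = t. Proof. exact: powRNVK. Qed.

Let adj_Y t : 0 < t -> (adj bf (fun x => (dY x)%:E) t = (Y (gam t))%:E)%E.
Proof.
move=> t0; rewrite adj_pow_kernel//.
have g0 := gam_gt0 t0.
have dYi x : 0 < x < gam t -> is_derive x 1 Y (dY x) by move=> /andP[x0 _]; exact: is_derive_Y.
rewrite (ge0_FTC_oo g0 dYi _ _ Y_to0 (lb := Y (gam t))) ?subr0//.
- by move=> x /andP[x0 _]; exact: cdY.
- by move=> x /andP[x0 _]; exact: dY_ge0.
- by apply: cvg_at_left_filter; exact: is_derive_continuous (is_derive_Y g0).
Qed.

Let gam_to0 : gam t @[t --> +oo] --> 0^'+.
Proof.
move=> A /= HA.
have H : gam t @[t --> +oo] --> 0 by apply: cvg_powRN; rewrite oppr_lt0.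
have := H _ HA; apply: filterS2 (nbhs_pinfty_gt (num_real (0 : R))) => t t0 /=; apply.
exact: gam_gt0.
Qed.

Let gam_toy : gam t @[t --> 0^'+] --> +oo.
Proof.
apply/cvgryPge => A.
pose a := Num.max A 1; have a0 : 0 < a by rewrite lt_max ltr01 orbT.
near=> t.
have t0 : 0 < t by near: t; exact: nbhs_right_gt.
apply: (@le_trans _ _ a); first by rewrite le_max lexx.
rewrite ltW// -lt_powRNV//; near: t; apply: nbhs_right_lt; exact: beta_gt0.
Unshelve. all: by end_near.
Qed.

(** The substitution [x = t^(-sg)] turns the integrand into a multiple of [k Z^th], whose primitive
    is [psi]. It is carried out by an explicit primitive in [t]; the substitution reverses the ends,
    whence the minus sign in [G]. *)
Let integral_FY :
  (\int[@leb R]_(t in posR) (((prim f t `^ sg)%:E * (Y (gam t))%:E) `^ p')%E = (m / l)%:E)%E.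
Proof.
pose g t := (l * k (gam t) * Z (gam t) `^ th) * (l^-1 * t `^ (- sg - 1)).
pose G (t : R) : R := - (l * sg)^-1 * psi (gam t).
have dG (t : R) : 0 < t -> is_derive t 1 G (g t).
  move=> t0; have H := is_derive1_comp (dpsi (gam_gt0 t0)) (is_derive1_powR (- sg) t0).
  apply: is_derive_eq (is_derive_mulc _ H) _.
  by rewrite /g -/(gam t); field; rewrite !gt_eqF.
have cgam (t : R) : 0 < t -> {for t, continuous gam} by exact: continuous_powR.
have cg (t : R) : 0 < t -> {for t, continuous g}.
  move=> t0; apply: cvgM; last by apply: cvgMr; exact: continuous_powR.
  apply: cvgM; first apply: cvgMr.
    by apply: (@continuous_comp _ _ _ gam k); [exact: cgam|apply: ck; exact: gam_gt0].
  apply: (@continuous_comp _ _ _ gam (fun x => Z x `^ th)); first exact: cgam.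
  by apply: cZr; exact: gam_gt0.
have g_ge0 t : 0 < t -> 0 <= g t.
  by move=> t0; rewrite !mulr_ge0 ?powR_ge0 ?invr_ge0 ?(ltW l0) ?k_ge0 ?gam_gt0.
have G0 : G t @[t --> 0^'+] --> - (l * sg)^-1 * (sg * m).
  by apply: cvgMr; exact: cvg_comp gam_toy psi_toy.
have G1 : G t @[t --> +oo] --> - (l * sg)^-1 * 0.
  by apply: cvgMr; exact: cvg_comp gam_to0 psi_to0.
transitivity (\int[@leb R]_(t in posR) (g t)%:E)%E; last first.
  rewrite (ge0_FTC_oy dG cg g_ge0 G0 G1); congr (_%:E).
  by field; rewrite !gt_eqF.
apply: eq_integral_posR => t t0.
have gt0 := gam_gt0 t0; have z0 := Z_gt0 gt0.
rewrite -EFinM poweR_EFin; congr (_%:E).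
rewrite powRM ?powR_ge0//; last by rewrite mulr_ge0 ?powR_ge0.
rewrite -powRrM e4 /Y powRM ?powR_ge0// -!powRrM.
rewrite (_ : s^-1 * p' = th); last by rewrite e3 mulrC mulfK// gt_eqF.
rewrite mulrC [_ * p']mulrC e2 /g /k /w gamK//.
rewrite (_ : - sg * (1 + sg^-1) = - sg - 1); last first.
  by rewrite mulNr mulrDr mulr1 divff ?gt_eqF// opprD.
by field; rewrite gt_eqF.
Qed.

(** Left: the mass [m] plus the moment [sg * m]. Right: integration by parts, then Hoelder with [f]
    in one factor and [F^sg Y] in the other. *)
Let core_bound :
  (((sg + 1) * m)%:E <= (l `^ (1 - s^-1) * (sg + 1))%:E *
    ((\int[@leb R]_(t in posR) (f t `^ p)) `^ p^-1 * ((m / l)%:E `^ p'^-1)))%E.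
Proof.
have LfF := LplusM f0 (LF sg).
have lc : 0 <= l `^ (1 - s^-1) by exact: powR_ge0.
have sg1 : 0 < sg + 1 by rewrite addr_gt0.
have L1 : Lplus (fun x => (l * k x)%:E).
  apply: Lplus_EFin => x x0; first by apply: cvgMr; exact: ck.
  by rewrite mulr_ge0 ?(ltW l0) ?k_ge0.
have L2 : Lplus (fun x => (l * k x * Z x `^ th)%:E).
  apply: Lplus_EFin => x x0; last by rewrite !mulr_ge0 ?powR_ge0 ?(ltW l0) ?k_ge0.
  by apply: cvgM; [apply: cvgMr; exact: ck|exact: cZr].
have LH := Lplus_Hop Lbeta LfF.
have L3 := LplusM LdY LH.
have cc : (0 <= (l `^ (1 - s^-1) * (sg + 1))%:E)%E by rewrite lee_fin mulr_ge0// ltW.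
have -> : (((sg + 1) * m)%:E =
    \int[@leb R]_(x in posR) ((l * k x)%:E + (l * k x * Z x `^ th)%:E))%E.
  rewrite (integralD_posR L1 L2) integral_moment.
  under eq_integral do rewrite EFinM.
  rewrite (integralZl_posR Lk) ?ME ?lee_fin ?(ltW l0)// -EFinM lM -EFinD.
  by rewrite mulrDl mul1r addrC.
apply: (@le_trans _ _ (\int[@leb R]_(x in posR) ((l `^ (1 - s^-1) * (sg + 1))%:E *
    ((dY x)%:E * Hop bf (fun t => f t * (prim f t `^ sg)%:E) x)))%E).
  apply: (le_integral_posR (LplusD L1 L2) (LplusM (Lplus_cst cc) L3)) => x x0.
  rewrite Hop_w// -!EFinM -EFinD lee_fin.
  apply: le_trans (pointwise x0) _; rewrite le_eqVlt; apply/orP; left; apply/eqP.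
  by field; rewrite gt_eqF.
rewrite (integralZl_posR L3 cc); apply: lee_wpmul2l => //.
rewrite (Hop_adj Lbeta LfF LdY).
have LFY : Lplus (fun t => ((prim f t `^ sg)%:E * (Y (gam t))%:E))%E.
  apply: (@eq_Lplus _ (fun t => (prim f t `^ sg)%:E * adj bf (fun x => (dY x)%:E) t)%E).
    by move=> t t0; rewrite adj_Y.
  exact: LplusM (LF sg) (Lplus_adj Lbeta LdY).
rewrite -integral_FY.
apply: le_trans (hoelder_posR p0 p'0 pp' f0 LFY); rewrite le_eqVlt; apply/orP; left; apply/eqP.
by apply: eq_integral_posR => t t0; rewrite adj_Y// muleA.
Qed.

Lemma bliss_with_transport :
  ((\int[@leb R]_(x in posR) (Hop bf f x `^ q)) `^ q^-1 <=
  (m `^ (- s^-1))%:E * (\int[@leb R]_(t in posR) (f t `^ p)) `^ p^-1)%E.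
Proof.
have -> : (\int[@leb R]_(x in posR) (Hop bf f x `^ q) = M%:E)%E.
  rewrite -ME; apply: eq_integral_posR => x x0; rewrite /k -poweR_EFin; congr (_ `^ _)%E.
  rewrite Hop_pow_kernel; exact: (primE f0 fB (ltW (beta_gt0 x0))).
have := core_bound; have : (0 <= (\int[@leb R]_(t in posR) (f t `^ p)) `^ p^-1)%E.
  exact: poweR_ge0.
case: ((_ `^ p^-1)%E) => [A| |]// A0; last first.
  by move=> _; rewrite gt0_muley ?leey// lte_fin powR_gt0.
rewrite !poweR_EFin -!EFinM !lee_fin.
have sg1 : 0 < sg + 1 by rewrite addr_gt0.
have -> : l `^ (1 - s^-1) * (sg + 1) * (A * (m / l) `^ p'^-1) =
   (sg + 1) * (l `^ (1 - s^-1) * (A * (m / l) `^ p'^-1)) by ring.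
rewrite ler_pM2l// => H.
(* This relation lets the powers of [l] combine with [M = m / l], so that only [m^(1/q - 1/p)]
   remains. *)
have eqs : 1 - s^-1 = p'^-1 + q^-1.
  have : q * (1 - s^-1) / q = (sg + 1) / q by rewrite e1.
  rewrite mulrAC divff ?gt_eqF// mul1r => ->.
  by rewrite -e4; field; rewrite !gt_eqF.
have ME' : M = m / l by rewrite -lM mulrAC divff ?mul1r// gt_eqF.
have lpos r : 0 < l `^ r by rewrite powR_gt0.
have mpos r : 0 < m `^ r by rewrite powR_gt0.
have divE r : (m / l) `^ r = m `^ r / l `^ r.
  by rewrite powRM ?invr_ge0 ?(ltW l0) ?(ltW m0)// powR_inv.
rewrite ME' divE ler_pdivrMr//.
move: H; rewrite divE eqs powRD ?(gt_eqF l0) ?implybT//.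
have -> : l `^ p'^-1 * l `^ q^-1 * (A * (m `^ p'^-1 / l `^ p'^-1)) =
   A * l `^ q^-1 * m `^ p'^-1 by field; rewrite gt_eqF.
move=> H0; have {H0}H : m / m `^ p'^-1 <= A * l `^ q^-1 by rewrite ler_pdivrMr.
rewrite powRN -mulrA ler_pdivlMl//; apply: le_trans H.
rewrite -[X in X / _](powRr1 (ltW m0)) -powRB ?(gt_eqF m0) ?implybT//.
rewrite -powRD ?(gt_eqF m0) ?implybT// le_eqVlt; apply/orP; left; apply/eqP.
congr (_ `^ _); move: eqs; lra.
Qed.

End with_transport.

Lemma bliss_bounded :
  ((\int[@leb R]_(x in posR) (Hop (pow_kernel sg) f x `^ q)) `^ q^-1 <=
  (m `^ (- s^-1))%:E * (\int[@leb R]_(t in posR) (f t `^ p)) `^ p^-1)%E.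
Proof.
have [M ME] := k_total.
have [Z [Z0 ZE dZ Z_to0 Z_toy]] := monotone_transport ck k_gt0 k_le cphi
  (fun z _ => phi_gt0 z) (fun z _ => phi_le z) ME mE.
have M0 := total_gt0 ck k_ge0 k_le ME k_gt0.
apply: (bliss_with_transport (l := m / M) (Z := Z) _ ME) => //.
by rewrite divfK// gt_eqF.
Qed.

End bliss_core.

Section bliss.
Context {R : realType}.
Local Open Scope ereal_scope.

Lemma le_Hop (b f g : R -> \bar R) (x : R) : Lplus f -> Lplus g ->
  (forall t, (0 < t)%R -> f t <= g t) -> Hop b f x <= Hop b g x.
Proof.
move=> f0 g0 fg; rewrite !Hop_if; apply: le_integral_posR.
- by apply: Lplus_if f0; exact: measurable_EFin_lt.
- by apply: Lplus_if g0; exact: measurable_EFin_lt.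
- by move=> t t0; case: ifPn => // _; exact: fg.
Qed.

Lemma trunc_at_le (f : R -> \bar R) n (x : R) : Lplus f -> (0 < x)%R -> trunc_at f n x <= f x.
Proof.
move=> f0 x0; rewrite /trunc_at; case: ifPn => _; first by rewrite ge_min lexx.
exact: f0.2.
Qed.

(** Monotone convergence at two levels: inside [Hop] for the truncations of [f], then in the outer
    integral. *)
Lemma Hop_le_trunc (b f : R -> \bar R) (q : R) (M : \bar R) : (0 < q)%R -> Lplus b -> Lplus f ->
  (forall n, \int[@leb R]_(x in posR) (Hop b (trunc_at f n) x `^ q) <= M) ->
  \int[@leb R]_(x in posR) (Hop b f x `^ q) <= M.
Proof.
move=> q0 b0 f0; have Lt n := Lplus_trunc_at n f0.
have LH n := Lplus_Hop b0 (Lt n).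
apply: (integral_posR_le_sup (hn := fun n x => Hop b (trunc_at f n) x `^ q)).
- exact: Lplus_poweR (Lplus_Hop b0 f0).
- by move=> n; exact: Lplus_poweR (LH n).
- move=> x x0 m n mn; apply: le_poweR; [exact: ltW|exact: (LH m).2|].
  by apply: le_Hop (Lt m) (Lt n) _ => t t0; exact: trunc_at_mono.
- move=> x x0; set S := ereal_sup _.
  have SP n : Hop b (trunc_at f n) x `^ q <= S by apply: ereal_sup_ubound; exists n.
  have S0 : 0 <= S by apply: le_trans (SP 0%N); exact: poweR_ge0.
  have qN0 : (q != 0)%R by rewrite gt_eqF.
  rewrite -[leRHS](poweR_Kroot S0 qN0); apply: le_poweR; [exact: ltW|exact: (Lplus_Hop b0 f0).2|].
  pose h t := if t%:E < b x then f t else 0.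
  have Lh : Lplus h by apply: Lplus_if f0; exact: measurable_EFin_lt.
  (* The exponent 1 makes [integral_posR_le_trunc] applicable to the inner integral. *)
  rewrite Hop_if (@eq_integral_posR _ _ (fun t => h t `^ 1)); last first.
    by move=> t t0; rewrite poweRe1//; exact: Lh.2.
  apply: (integral_posR_le_trunc ltr01 Lh) => n.
  apply: (@le_trans _ _ (Hop b (trunc_at f n) x)).
    rewrite Hop_if le_eqVlt; apply/orP; left; apply/eqP; apply: eq_integral_posR => t t0.
    rewrite poweRe1; last exact: (Lplus_trunc_at n Lh).2.
    rewrite /trunc_at /h; case: ifPn => // _; first by case: ifPn => // _; rewrite min_l// lee_fin.
    by case: ifP.
  rewrite -[leLHS](poweR_rootK ((LH n).2 x x0) qN0); apply: le_poweR => //.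
    by rewrite invr_ge0 ltW.
  exact: poweR_ge0.
Qed.

Lemma bliss_admissible (p q p' s th sg m : R) :
  (0 < p)%R -> (0 < q)%R -> (1 < p')%R -> (1 < s)%R -> (0 < th)%R -> (0 < sg)%R ->
  (p^-1 + p'^-1 = 1)%R -> (q * (1 - s^-1) = sg + 1)%R ->
  (p' * (1 - s^-1) = 1 + sg^-1)%R -> (p' = th * s)%R -> (sg * p' = q)%R -> (0 < m)%R ->
  \int[@leb R]_(z in posR) (bliss_density th s z)%:E = m%:E ->
  admissible p q (pow_kernel sg) (m `^ (- s^-1)).
Proof.
move=> p0 q0 p'1 s1 th0 sg0 pp' e1 e2 e3 e4 m0 mE f f0.
have : 0 <= \int[@leb R]_(x in posR) (f x `^ p) by exact: integral_posR_ge0 (Lplus_poweR p f0).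
case EA : (integral _ _ _) => [A| |]// A0 _; rewrite lee_fin in A0.
set K := (m `^ _)%R; have K0 : (0 < K)%R by exact: powR_gt0.
set b := pow_kernel sg.
have Lb : Lplus b by exact: Lplus_pow_kernel.
have qN0 : (q != 0)%R by rewrite gt_eqF.
have pN0 : (p != 0)%R by rewrite gt_eqF.
rewrite poweR_EFin -EFinM.
have KA0 : 0 <= (K * A `^ p^-1)%:E by rewrite lee_fin mulr_ge0 ?powR_ge0 ?(ltW K0).
rewrite -[leRHS](poweR_rootK KA0 qN0); apply: le_poweR; first by rewrite invr_ge0 ltW.
  exact: integral_posR_ge0 (Lplus_poweR q (Lplus_Hop Lb f0)).
apply: Hop_le_trunc => // n.
have Lt := Lplus_trunc_at n f0; have LHt := Lplus_Hop Lb Lt.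
have X0 := integral_posR_ge0 (Lplus_poweR q LHt).
have key (e : R) : (0 < e <= 1)%R ->
    (\int[@leb R]_(x in posR) (Hop b (trunc_at f n) x `^ q)) `^ q^-1 <=
    (K * (A + e `^ p) `^ p^-1)%:E.
  move=> /andP[e0 e1'].
  (* Raising the truncation to at least [e] on []0, 1[] makes the primitive positive, at a cost of
     at most [e^p] in the integral of [f^p]. *)
  pose c (x : R) : \bar R := if (x < 1)%R then e%:E else 0.
  have e0e : 0 <= e%:E by rewrite lee_fin ltW.
  have Lc : Lplus c by apply: Lplus_if (Lplus_cst e0e); exact: measurable_ltr_posR.
  pose g x := maxe (trunc_at f n x) (c x).
  have Lg : Lplus g.
    split; first by apply: measurable_maxe; [exact: Lt.1|exact: Lc.1].
    by move=> x x0; rewrite le_max (Lt.2 x x0).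
  have gB x : (0 < x)%R -> g x <= n.+1%:R%:E.
    move=> x0; rewrite ge_max /c /trunc_at; apply/andP; split.
      by case: ifPn => _; rewrite ?ge_min ?lexx ?orbT// lee_fin.
    by case: ifPn => _; rewrite lee_fin// (le_trans e1')// ler1n.
  have gu x : (n.+1%:R <= x)%R -> g x = 0.
    move=> nx; rewrite /g /trunc_at /c ltNge nx/= ltNge (le_trans _ nx) ?ler1n//=.
    by rewrite maxxx.
  have gpos y : (0 < y)%R -> (0 < prim g y)%R.
    move=> y0; have y10 : (0 < Num.min y 1)%R by rewrite lt_min y0/=.
    have y1y : (Num.min y 1 <= y)%R by rewrite ge_min lexx.
    apply: lt_le_trans (prim_le Lg gB (ltW y10) y1y).
    apply: (@lt_le_trans _ _ (e * (Num.min y 1 - 0))%R); first by rewrite subr0 mulr_gt0.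
    rewrite -lee_fin -(primE Lg gB (ltW y10)).
    apply: (integral_oo_ge (lexx 0%R) (ltW y10) (ltW e0) Lg) => x /andP[x0].
    by rewrite lt_min => /andP[_ x1]; rewrite le_max /c x1 lexx orbT.
  have n0 : (0 < n.+1%:R :> R)%R by rewrite ltr0n.
  have := bliss_bounded p0 q0 p'1 s1 th0 sg0 pp' e1 e2 e3 e4 mE Lg gB gu n0 gpos.
  rewrite -/b -/K => H.
  have gA : \int[@leb R]_(t in posR) (g t `^ p) <= (A + e `^ p)%:E.
    have Lfp := Lplus_poweR p f0; have Lcp := Lplus_poweR p Lc.
    apply: (@le_trans _ _ (\int[@leb R]_(t in posR) (f t `^ p + c t `^ p))).
      apply: (le_integral_posR (Lplus_poweR p Lg) (LplusD Lfp Lcp)) => t t0.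
      rewrite /g; case: (leP (trunc_at f n t) (c t)) => _.
        by rewrite leeDr// poweR_ge0.
      apply: (@le_trans _ _ (f t `^ p)); last by rewrite leeDl// poweR_ge0.
      by apply: le_poweR; [exact: ltW|exact: Lt.2|exact: trunc_at_le].
    rewrite (integralD_posR Lfp Lcp) EA EFinD leeD2l//.
    rewrite (@eq_integral_posR _ _ (fun t => if (t < 1)%R then (e `^ p)%:E else 0)); last first.
      by move=> t _; rewrite /c; case: ifPn => // _; rewrite poweR0r.
    rewrite -(@integral_posR_if _ _ `]0%R, 1%R[); last first.
      by move=> x; rewrite /= in_itv/=; split=> [/andP[]|[-> ->]].
    have ep0 : 0 <= (e `^ p)%:E by rewrite lee_fin powR_ge0.
    apply: le_trans (integral_oo_le (lexx 0%R) ler01 (Lplus_cst ep0) (c := (e `^ p)%R) _) _ => //.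
    by rewrite subr0 mulr1.
  apply: (@le_trans _ _ ((\int[@leb R]_(x in posR) (Hop b g x `^ q)) `^ q^-1)).
    apply: le_poweR X0 _; first by rewrite invr_ge0 ltW.
    have LHg := Lplus_Hop Lb Lg.
    apply: (le_integral_posR (Lplus_poweR q LHt) (Lplus_poweR q LHg)) => x x0.
    apply: le_poweR; [exact: ltW|exact: LHt.2|].
    by apply: le_Hop Lt Lg _ => t t0; rewrite le_max lexx.
  apply: (le_trans H); rewrite EFinM; apply: lee_wpmul2l; first by rewrite lee_fin ltW.
  rewrite -poweR_EFin; apply: le_poweR gA; first by rewrite invr_ge0 ltW.
  exact: integral_posR_ge0 (Lplus_poweR p Lg).
rewrite -[leLHS](poweR_Kroot X0 qN0); apply: le_poweR; [exact: ltW|exact: poweR_ge0|].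
move: key (poweR_ge0 (\int[@leb R]_(x in posR) (Hop b (trunc_at f n) x `^ q)) q^-1).
case: (_ `^ q^-1) => [V| |]// key V0; last first.
  by have := key 1%R; rewrite ltr01 lexx => /(_ isT).
rewrite lee_fin in V0; rewrite lee_fin -ler_pdivrMl//.
have VK : (0 <= K^-1 * V)%R by rewrite mulr_ge0// invr_ge0 ltW.
rewrite -[X in (X <= _)%R](powRr1 VK) -(divff pN0) powRrM.
apply: ge0_ler_powR; rewrite ?nnegrE ?powR_ge0 ?invr_ge0 ?(ltW p0)//.
(* Limit [e] to 0: this [e] has [e^p = min d 1], hence [e <= 1] and an error of at most [d]. *)
apply/ler_addgt0Pr => d d0.
pose e := ((Num.min d 1) `^ p^-1)%R.
have d10 : (0 < Num.min d 1)%R by rewrite lt_min d0/=.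
have e0 : (0 < e)%R by rewrite powR_gt0.
have e1' : (e <= 1)%R.
  have pV0 : (0 <= p^-1)%R by rewrite invr_ge0 ltW.
  have d1 : (Num.min d 1 <= 1)%R by rewrite ge_min lexx orbT.
  by have := ge0_ler_powR pV0 (ltW d10) ler01 d1; rewrite powR1.
have ep : (e `^ p = Num.min d 1)%R by rewrite -powRrM mulVf// powRr1// ltW.
have := key e; rewrite e0 e1' lee_fin ep => /(_ isT).
rewrite -ler_pdivrMl// => /(ge0_ler_powR (ltW p0)).
rewrite !nnegrE VK powR_ge0 => /(_ isT isT).
rewrite -[X in (_ <= X -> _)%R]powRrM mulVf// powRr1; last by rewrite addr_ge0 ?(ltW d10).
by move=> /le_trans; apply; rewrite lerD2l ge_min lexx.
Qed.

End bliss.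

(** * Hardy's inequality *)

Section hardy.
Context {R : realType}.
Local Open Scope ereal_scope.

Lemma Hop_hoelder (p p' : R) (b f g : R -> \bar R) (x : R) : (0 < p)%R -> (0 < p')%R ->
  (p^-1 + p'^-1 = 1)%R -> Lplus f -> Lplus g ->
  Hop b (fun t => f t * g t) x <=
  (Hop b (fun t => f t `^ p) x) `^ p^-1 * (Hop b (fun t => g t `^ p') x) `^ p'^-1.
Proof.
move=> p0 p'0 pp' f0 g0; rewrite !Hop_if.
have L h : Lplus h -> Lplus (fun t => if t%:E < b x then h t else 0).
  by move=> h0; apply: Lplus_if h0; exact: measurable_EFin_lt.
have := hoelder_posR p0 p'0 pp' (L _ f0) (L _ g0).
rewrite (@eq_integral_posR _ _ (fun t => if t%:E < b x then f t * g t else 0)); last first.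
  by move=> t _; case: ifP; rewrite ?mul0e.
rewrite (@eq_integral_posR _ (fun t => _ `^ p) (fun t => if t%:E < b x then f t `^ p else 0)); last first.
  by move=> t _; case: ifP => // _; rewrite poweR0r// gt_eqF.
rewrite (@eq_integral_posR _ (fun t => _ `^ p') (fun t => if t%:E < b x then g t `^ p' else 0)) //.
by move=> t _; case: ifP => // _; rewrite poweR0r// gt_eqF.
Qed.

(** Hardy's weighted Hoelder argument: split [f] as [(f t^a) t^(-a)], apply Hoelder on each []0, b
    x[], and exchange the integrals. The choice [a = 1/(p p')] makes all powers of [x] and [t]
    cancel with the sharp constant. *)
Lemma hardy_admissible (p p' sg : R) : (1 < p)%R -> (1 < p')%R ->
  (p^-1 + p'^-1 = 1)%R -> (sg * p' = p)%R ->
  admissible p p (pow_kernel sg) (p `^ p^-1 * p' `^ p'^-1).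
Proof.
move=> p1 p'1 pp' e4 f f0 _.
have p0 : (0 < p)%R by exact: lt_trans p1.
have p'0 : (0 < p')%R by exact: lt_trans p'1.
have sg0 : (0 < sg)%R by rewrite -(pmulr_lgt0 _ p'0) e4.
have pN0 : (p != 0)%R by rewrite gt_eqF.
have p'N0 : (p' != 0)%R by rewrite gt_eqF.
have sgN0 : (sg != 0)%R by rewrite gt_eqF.
set b := pow_kernel sg.
have Lb : Lplus b by exact: Lplus_pow_kernel.
have Lfp := Lplus_poweR p f0.
pose a := (p^-1 * p'^-1)%R.
have ap : (a * p = p'^-1)%R by rewrite /a mulrAC mulVf// mul1r.
have ap' : (- a * p' = - p^-1)%R by rewrite /a mulNr -mulrA mulVf// mulr1.
pose k (t : R) : \bar R := f t `^ p * (t `^ p'^-1)%:E.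
have Lk : Lplus k by exact: LplusM Lfp (Lplus_powR p'^-1).
have pw x : (0 < x)%R ->
    Hop b f x `^ p <= (p' `^ (p / p'))%:E * ((x `^ (- p'^-1))%:E * Hop b k x).
  move=> x0.
  have Hb : Hop b f x <= (Hop b k x) `^ p^-1 *
      ((x `^ (- sg^-1)) `^ p'^-1 * p')%:E `^ p'^-1.
    have := @Hop_hoelder p p' b (fun t => f t * (t `^ a)%:E) (fun t => (t `^ (- a))%:E) x
      p0 p'0 pp' (LplusM f0 (Lplus_powR a)) (Lplus_powR (- a)).
    have -> : Hop b (fun t => f t * (t `^ a)%:E * (t `^ (- a))%:E) x = Hop b f x.
      rewrite !Hop_if; apply: eq_integral_posR => t t0; case: ifP => // _.
      by rewrite -muleA -EFinM powRN divff ?mule1// gt_eqF// powR_gt0.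
    have -> : Hop b (fun t => (f t * (t `^ a)%:E) `^ p) x = Hop b k x.
      rewrite !Hop_if; apply: eq_integral_posR => t t0; case: ifP => // _.
      rewrite poweRM ?lee_fin ?powR_ge0//; last exact: f0.2.
      by rewrite poweR_EFin -powRrM ap.
    have -> // : Hop b (fun t => (t `^ (- a))%:E `^ p') x = ((x `^ (- sg^-1)) `^ p'^-1 * p')%:E.
    rewrite Hop_pow_kernel.
    under eq_integral do rewrite poweR_EFin -powRrM ap'.
    rewrite integral_powR_o ?powR_gt0//; last by rewrite ltrN2 invf_lt1.
    have -> : (- p^-1 + 1 = p'^-1)%R by move: pp'; lra.
    by rewrite invrK.
  apply: (@le_trans _ _ (((Hop b k x) `^ p^-1 *
      ((x `^ (- sg^-1)) `^ p'^-1 * p')%:E `^ p'^-1) `^ p)).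
    by apply: le_poweR Hb; [exact: ltW|exact: (Lplus_Hop Lb f0).2].
  have Hk0 : 0 <= Hop b k x by exact: (Lplus_Hop Lb Lk).2.
  rewrite poweRM ?poweR_ge0// poweR_Kroot// muleC.
  rewrite -poweRrM poweR_EFin powRM ?powR_ge0 ?(ltW p'0)// -!powRrM.
  rewrite muleA; rewrite -EFinM; apply: lee_wpmul2r => //.
  rewrite lee_fin mulrC [(p'^-1 * p)%R]mulrC le_eqVlt; apply/orP; left; apply/eqP.
  congr (_ * _ `^ _)%R; rewrite -e4; field.
  by rewrite p'N0 sgN0.
set A := \int[@leb R]_(x in posR) (f x `^ p).
have A0 : 0 <= A by exact: integral_posR_ge0 Lfp.
set K := (p `^ p^-1 * p' `^ p'^-1)%R.
have K0 : (0 <= K)%R by rewrite mulr_ge0 ?powR_ge0.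
have KA0 : 0 <= K%:E * A `^ p^-1 by rewrite mule_ge0 ?poweR_ge0.
rewrite -[leRHS](poweR_rootK KA0 pN0); apply: le_poweR; first by rewrite invr_ge0 ltW.
  exact: integral_posR_ge0 (Lplus_poweR p (Lplus_Hop Lb f0)).
rewrite poweRM ?poweR_ge0// poweR_Kroot// poweR_EFin.
have LHk := Lplus_Hop Lb Lk.
have Lx := Lplus_powR (- p'^-1).
have c0 : 0 <= (p' `^ (p / p'))%:E by rewrite lee_fin powR_ge0.
apply: (@le_trans _ _ (\int[@leb R]_(x in posR)
    ((p' `^ (p / p'))%:E * ((x `^ (- p'^-1))%:E * Hop b k x)))).
  exact: (le_integral_posR (Lplus_poweR p (Lplus_Hop Lb f0))
    (LplusM (Lplus_cst c0) (LplusM Lx LHk)) pw).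
rewrite (integralZl_posR (LplusM Lx LHk) c0) (Hop_adj Lb Lk Lx).
(* The adjoint of [x^(-1/p')] at [t] is [p t^(-1/p')], which cancels the weight in [k]; with the
   factor [p'^(p/p')] this produces the p-th power of the constant. *)
rewrite (@eq_integral_posR _ _ (fun t => p%:E * f t `^ p)); last first.
  move=> t t0; rewrite adj_pow_kernel// integral_powR_o ?powR_gt0//; last first.
    by rewrite ltrN2 invf_lt1.
  have -> : (- p'^-1 + 1 = p^-1)%R by move: pp'; lra.
  rewrite invrK -powRrM /k muleC muleCA muleC; congr (_ * _).
  rewrite -EFinM mulrAC; congr (_%:E).
  rewrite [X in (t `^ X * _ * _)%R](_ : _ = - p'^-1)%R; last first.
    by rewrite -e4; field; rewrite p'N0 sgN0.
  by rewrite powRN mulVf ?mul1r// gt_eqF// powR_gt0.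
rewrite (integralZl_posR Lfp) ?lee_fin ?(ltW p0)// muleA -EFinM.
apply: lee_wpmul2r => //; rewrite lee_fin le_eqVlt; apply/orP; left; apply/eqP.
rewrite /K powRM ?powR_ge0// -!powRrM mulVf// powRr1 ?(ltW p0)//.
by rewrite mulrC [(p / p')%R]mulrC.
Qed.

End hardy.

(** * The Gamma integral *)

Section gamma.
Context {R : realType}.

Section scale.
Variables (h : R -> R) (B T c : R).
Hypothesis ch : forall x, 0 < x -> {for x, continuous h}.
Hypothesis h0 : forall x, 0 < x -> 0 <= h x.
Hypothesis hB : forall x, 0 < x -> h x <= B.
Hypothesis hT : (\int[@leb R]_(x in posR) (h x)%:E = T%:E)%E.
Hypothesis c0 : 0 < c.

Lemma is_derive_scale (x : R) : is_derive x 1 (fun y => c * y) c.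
Proof. by apply: is_derive_eq (is_derive_mulc c (is_derive_id x 1)) _; rewrite mulr1. Qed.

Lemma cvg_scale0 : c * x @[x --> (0 : R)^'+] --> (0 : R)^'+.
Proof.
move=> A /= [e /= e0 HA]; exists (e / c) => /=; first exact: divr_gt0.
move=> x /=; rewrite !sub0r !normrN => xe x0; apply: HA; last by rewrite /= mulr_gt0.
by rewrite /= sub0r normrN normrM (gtr0_norm c0) mulrC -ltr_pdivlMr.
Qed.

Lemma cvg_scaley : c * x @[x --> +oo] --> +oo.
Proof.
apply/cvgryPge => A; apply: filterS (nbhs_pinfty_ge (num_real (c^-1 * A))) => x.
by rewrite ler_pdivrMl.
Qed.

Lemma integral_scale : (\int[@leb R]_(x in posR) (h (c * x))%:E = (T / c)%:E)%E.
Proof.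
pose G x := c^-1 * prim (fun x => (h x)%:E) (c * x).
have dG (x : R) : 0 < x -> is_derive x 1 G (h (c * x)).
  move=> x0; have cx0 : 0 < c * x by exact: mulr_gt0.
  have := is_derive_mulc c^-1 (is_derive1_comp (is_derive_prim ch h0 hB cx0) (is_derive_scale x)).
  by move=> H; apply: is_derive_eq H _; rewrite mulrCA mulVf ?mulr1// gt_eqF.
have -> : T / c = c^-1 * T - c^-1 * 0 by rewrite mulr0 subr0 mulrC.
apply: (ge0_FTC_oy dG).
- move=> x x0; apply: (@continuous_comp _ _ _ (fun x => c * x) h).
    exact: is_derive_continuous (is_derive_scale x).
  by apply: ch; exact: mulr_gt0.
- by move=> x x0; apply: h0; exact: mulr_gt0.
- apply: cvgMr; apply: (cvg_comp (fun x => c * x) (prim (fun x => (h x)%:E)) cvg_scale0).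
  exact: cvg_prim0 ch h0 hB.
- apply: cvgMr.
  exact: (cvg_comp (fun x => c * x) _ cvg_scaley (cvg_prim_total ch h0 hB hT)).
Qed.

End scale.

Definition gamma_density (a x : R) : R := x `^ (a - 1) * expR (- x).

(** From [y <= exp y] at [y = x / r], raised to the power [r]. It bounds the Gamma integrand near 0
    and, with a larger exponent, gives its decay. *)
Lemma powR_expRN_le (r x : R) : 0 < r -> 0 < x -> x `^ r * expR (- x) <= r `^ r.
Proof.
move=> r0 x0; rewrite expRN ler_pdivrMr ?expR_gt0//.
have -> : x = r * (x / r) by rewrite mulrCA divff ?mulr1// gt_eqF.
have xr0 : 0 <= x / r by rewrite divr_ge0 ?ltW.
rewrite [r * (x / r)]mulrC expRM powRM ?(ltW r0)// mulrC.
rewrite ler_pM2l ?powR_gt0//; apply: ge0_ler_powR; rewrite ?nnegrE ?expR_ge0 ?(ltW r0)//.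
by apply: le_trans (expR_ge1Dx _); rewrite lerDr.
Qed.

Section gamma_density.
Variable a : R.
Hypothesis a1 : 1 < a.

Lemma continuous_gamma_density x : 0 < x -> {for x, continuous (gamma_density a)}.
Proof.
move=> x0; apply: cvgM; first exact: continuous_powR.
apply: (@continuous_comp _ _ _ (fun x => - x) expR); last exact: continuous_expR.
exact: opp_continuous.
Qed.

Lemma gamma_density_gt0 x : 0 < x -> 0 < gamma_density a x.
Proof. by move=> x0; rewrite mulr_gt0 ?powR_gt0 ?expR_gt0. Qed.

Lemma gamma_density_le x : 0 < x -> gamma_density a x <= (a - 1) `^ (a - 1).
Proof. by move=> x0; apply: powR_expRN_le; rewrite ?subr_gt0. Qed.

Lemma Lplus_gamma_density : Lplus (fun x => (gamma_density a x)%:E).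
Proof.
apply: Lplus_EFin => x x0; [exact: continuous_gamma_density|exact/ltW/gamma_density_gt0].
Qed.

(** [Gamma] is the [fine] part of an integral, so finiteness must be shown: the density is bounded
    because [a > 1], and at most a constant times [x^(-2)] at infinity. *)
Lemma integral_gamma_density :
  (\int[@leb R]_(x in posR) (gamma_density a x)%:E = (Gamma a)%:E)%E.
Proof.
have mg : measurable_fun (posR : set R) (fun x => (gamma_density a x)%:E).
  apply/measurable_EFinP; apply: open_continuous_measurable_fun; first exact: interval_open.
  by move=> x /set_mem; rewrite posRE; exact: continuous_gamma_density.
have E : (\int[@leb R]_(x in posR) (gamma_density a x)%:E =
    \int[@lebesgue_measure R]_(x in posR) (gamma_density a x)%:E)%E.
  apply: ge0_integral_leb mg _; first exact: measurable_itv.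
  by move=> x; rewrite posRE lee_fin => /gamma_density_gt0/ltW.
rewrite /Gamma /Rintegral -[X in (fine X)%:E]E fineK// ge0_fin_numE; last first.
  exact: integral_posR_ge0 Lplus_gamma_density.
have a10 : 0 < a + 1 by rewrite addr_gt0// (lt_trans ltr01).
apply: (@integral_posR_lty _ _ ((a - 1) `^ (a - 1)) ((a + 1) `^ (a + 1)) 2 1 Lplus_gamma_density);
  rewrite ?ltr01 ?powR_ge0//.
- by rewrite ltr1n.
- by move=> x x0; rewrite lee_fin gamma_density_le.
move=> x x1; have x0 : 0 < x by exact: lt_trans x1.
rewrite lee_fin powRN ler_pdivlMr ?powR_gt0//.
apply: le_trans (powR_expRN_le a10 x0).
rewrite /gamma_density mulrAC -powRD; last by rewrite (gt_eqF x0) implybT.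
by rewrite (_ : a - 1 + 2 = a + 1)//; ring.
Qed.

Lemma Gamma_gt0 : 0 < Gamma a.
Proof.
have g0 x : 0 < x -> 0 <= gamma_density a x by move=> /gamma_density_gt0/ltW.
exact: (total_gt0 continuous_gamma_density g0 gamma_density_le
  integral_gamma_density gamma_density_gt0).
Qed.

End gamma_density.

Lemma integral_expRN (c : R) : 0 <= c ->
  (\int[@leb R]_(x in `]c, +oo[) (expR (- x))%:E = (expR (- c))%:E)%E.
Proof.
move=> c0.
have dN (x : R) : is_derive x 1 (fun z : R => - z) (- 1) by exact: is_deriveN.
have dE (x : R) : is_derive x 1 (fun z => expR (- z)) (- expR (- x)).
  have H := is_derive1_comp (is_derive_expR (- x)) (dN x).
  by apply: is_derive_eq H _; rewrite mulrN1.
have dG (x : R) : c < x -> is_derive x 1 (fun z => - expR (- z)) (expR (- x)).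
  by move=> _; apply: is_derive_eq (is_deriveN (dE x)) _; rewrite opprK.
have -> : expR (- c) = - 0 - - expR (- c) by rewrite oppr0 sub0r opprK.
apply: (ge0_FTC_oy dG).
- by move=> x _; exact: is_derive_continuous (dE x).
- by move=> x _; rewrite expR_ge0.
- by apply: cvg_at_right_filter; apply: cvgN; exact: is_derive_continuous (dE c).
- by apply: cvgN; exact: cvgr_expR.
Qed.

(** The exponential is the integral of [exp (-u)] over [u > w z^th]; exchanging the order measures
    the set of such [z], of length [(u/w)^(1/th)]. The result is a Gamma value at an argument above
    1, within reach of [integral_gamma_density]. *)
Lemma integral_expRN_powR (th w : R) : 0 < th -> 0 < w ->
  (\int[@leb R]_(z in posR) (expR (- (w * z `^ th)))%:E =
   (w `^ (- th^-1) * Gamma (1 + th^-1))%:E)%E.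
Proof.
move=> th0 w0; have thV0 : 0 < th^-1 by rewrite invr_gt0.
pose b (u : R) : \bar R := ((w^-1 * u) `^ th^-1)%:E.
have Lb : Lplus b.
  apply: Lplus_EFin => x x0; last exact: powR_ge0.
  have wx0 : 0 < w^-1 * x by rewrite mulr_gt0 ?invr_gt0.
  exact: is_derive_continuous (is_derive_powR_comp th^-1 wx0 (is_derive_scale w^-1 x)).
have L1 : Lplus (cst 1%E : R -> \bar R) by exact: Lplus_cst.
have Le : Lplus (fun u : R => (expR (- u))%:E).
  apply: Lplus_EFin => x x0; last exact: expR_ge0.
  apply: (@continuous_comp _ _ _ (fun x : R => - x) expR); last exact: continuous_expR.
  exact: opp_continuous.
have := Hop_adj Lb L1 Le.
rewrite (@eq_integral_posR _ _ (fun u => (w `^ (- th^-1))%:E * (gamma_density (1 + th^-1) u)%:E)%E);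
    last first.
  move=> u u0; rewrite Hop_cst1; last by rewrite lee_fin powR_ge0.
  rewrite /b -!EFinM /gamma_density powRM ?invr_ge0 ?ltW// powR_inv// powRN.
  by rewrite addrAC subrr add0r; congr (_%:E); ring.
rewrite (@eq_integral_posR _ (fun t => cst 1 t * _)%E (fun z => (expR (- (w * z `^ th)))%:E)).
  move=> <-; rewrite integralZl_posR; last 2 first.
  - by apply: Lplus_gamma_density.
  - by rewrite lee_fin powR_ge0.
  by rewrite integral_gamma_density ?EFinM// ltrDl.
move=> z z0; rewrite /= mul1e -integral_expRN ?mulr_ge0 ?powR_ge0 ?(ltW w0)//.
rewrite /adj; congr (integral _ _ _); apply/seteqP; split=> u /=.
  move=> [u0]; rewrite lte_fin in_itv/= andbT => H.
  have := gt0_ltr_powR th0 (ltW z0) (powR_ge0 _ _) H.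
  rewrite -powRrM mulVf ?gt_eqF// powRr1 ?mulr_ge0 ?invr_ge0 ?ltW//.
  by rewrite ltr_pdivlMl.
rewrite in_itv/= andbT => H.
have u0 : 0 < u by apply: le_lt_trans H; rewrite mulr_ge0 ?powR_ge0 ?(ltW w0).
split=> //; rewrite lte_fin.
have zE : z = (z `^ th) `^ th^-1 by rewrite -powRrM divff ?gt_eqF// powRr1// ltW.
rewrite zE; apply: gt0_ltr_powR; rewrite ?nnegrE ?powR_ge0 ?mulr_ge0 ?invr_ge0 ?ltW//.
by rewrite ltr_pdivlMl.
Qed.

End gamma.

(** * The mass of the Bliss density *)

Section bliss_gamma.
Context {R : realType}.
Local Notation L := (lebesgueR R).

(** The identity [Gamma s * c^(-s)] = integral of [u^(s-1) exp (-c u)], for [c = 1 + z^th]. *)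
Lemma bliss_density_gamma (th s z : R) : 1 < s -> 0 < z ->
  (\int[@leb R]_(u in posR) (gamma_density s u * expR (- (u * z `^ th)))%:E =
   (Gamma s * bliss_density th s z)%:E)%E.
Proof.
move=> s1 z0; set c := 1 + z `^ th.
have c0 : 0 < c by rewrite ltr_wpDr ?powR_ge0.
have g0 (x : R) : 0 < x -> 0 <= gamma_density s x by move=> /(@gamma_density_gt0 _ s)/ltW.
have Lg : Lplus (fun u => (gamma_density s (c * u))%:E).
  apply: Lplus_EFin => u u0; last by apply: g0; rewrite mulr_gt0.
  apply: (@continuous_comp _ _ _ (fun x => c * x) (gamma_density s)).
    exact: is_derive_continuous (is_derive_scale c u).
  by apply: continuous_gamma_density; rewrite mulr_gt0.
rewrite (@eq_integral_posR _ _ (fun u => (c `^ (1 - s))%:E * (gamma_density s (c * u))%:E)%E).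
  rewrite (integralZl_posR Lg) ?lee_fin ?powR_ge0//.
  rewrite (integral_scale (@continuous_gamma_density _ s) g0 (gamma_density_le s1)
    (integral_gamma_density s1) c0).
  rewrite /bliss_density -/c -EFinM (@powRD _ c 1 (- s)) ?(gt_eqF c0) ?implybT//.
  by rewrite powRr1 ?(ltW c0)//; congr (_%:E); field; rewrite gt_eqF.
move=> u u0; rewrite -EFinM /gamma_density powRM ?ltW//.
rewrite -[X in _ = (_ * (X * _))%:E]/(_ * _) mulrA (mulrA (c `^ (1 - s))) -powRD; last first.
  by rewrite (gt_eqF c0) implybT.
rewrite addrA subrK subrr powRr0 mul1r -mulrA -expRD; congr ((_ * expR _)%:E).
by rewrite /c; ring.
Qed.

(** A Beta integral: after multiplication by [Gamma s] the density becomes an integral in [u];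
    integrating first in [z] gives [u^(-1/th) Gamma (1 + 1/th)], and then a Gamma integral with
    exponent lowered by [1/th]. *)
Lemma integral_bliss_density (th s : R) : 0 < th -> 1 < s - th^-1 ->
  (\int[@leb R]_(z in posR) (bliss_density th s z)%:E =
   (Gamma (s - th^-1) * Gamma (1 + th^-1) / Gamma s)%:E)%E.
Proof.
move=> th0 sth; have thV0 : 0 < th^-1 by rewrite invr_gt0.
have s1 : 1 < s by rewrite (lt_trans sth)// ltrBlDr ltrDl.
have Gs := Gamma_gt0 s1.
have Lb : Lplus (fun z => (bliss_density th s z)%:E) by exact: Lplus_bliss_density.
suff E : ((Gamma s)%:E * \int[@leb R]_(z in posR) (bliss_density th s z)%:E =
   (Gamma (s - th^-1) * Gamma (1 + th^-1))%:E)%E.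
  move: E; move: (Gamma (s - th^-1) * _) => X E.
  rewrite -[LHS]mul1e -(mulVf (lt0r_neq0 Gs)) EFinM -muleA E -EFinM.
  by rewrite mulrC.
rewrite -integralZl_posR ?lee_fin ?(ltW Gs)//.
pose k (z u : R) : \bar R := (gamma_density s u * expR (- (u * z `^ th)))%:E.
rewrite (@eq_integral_posR _ _ (fun z => \int[@leb R]_(u in posR) k z u)%E); last first.
  by move=> z z0; rewrite bliss_density_gamma// EFinM.
rewrite tonelli_posR; last 2 first.
- have Lid : Lplus (fun u : R => u%:E).
    by apply: Lplus_EFin => x x0; [exact: cvg_id|exact: ltW].
  have M := emeasurable_funM (measurable_snd_posR Lid) (measurable_fst_posR (Lplus_powR th)).
  rewrite /k; under eq_fun do rewrite EFinM.
  apply: emeasurable_funM; first exact: measurable_snd_posR (@Lplus_gamma_density _ s).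
  apply/measurable_EFinP; apply: (@measurableT_comp _ _ _ _ _ _ (@expR R) _
      (fun z : L * L => - ((z.2 : R) * (z.1 : R) `^ th))).
    exact: measurable_expR.
  exact: measurable_funN (proj1 (measurable_EFinP _ (fun z : L * L => (z.2 : R) * (z.1 : R) `^ th)) M).
- by move=> z u z0 u0; rewrite lee_fin mulr_ge0 ?expR_ge0 ?(ltW (gamma_density_gt0 _ u0)).
rewrite (@eq_integral_posR _ _ (fun u => (Gamma (1 + th^-1))%:E * (gamma_density (s - th^-1) u)%:E)%E).
  rewrite (integralZl_posR (@Lplus_gamma_density _ _)); last first.
    by rewrite lee_fin; apply/ltW/Gamma_gt0; rewrite ltrDl.
  by rewrite (integral_gamma_density sth) -EFinM mulrC.
move=> u u0; have Le : Lplus (fun z => (expR (- (u * z `^ th)))%:E).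
  apply: Lplus_EFin => x x0; last exact: expR_ge0.
  apply: (@continuous_comp _ _ _ (fun x : R => - (u * x `^ th)) expR); last exact: continuous_expR.
  by apply: cvgN; apply: cvgMr; exact: continuous_powR.
rewrite /k; under eq_integral do rewrite EFinM.
rewrite (integralZl_posR Le) ?lee_fin ?(ltW (gamma_density_gt0 _ u0))//.
rewrite integral_expRN_powR// -!EFinM /gamma_density; congr (_%:E).
rewrite (_ : s - th^-1 - 1 = (s - 1) + - th^-1); last by ring.
by rewrite (@powRD _ u (s - 1) (- th^-1)) ?(gt_eqF u0) ?implybT//; ring.
Qed.

End bliss_gamma.

(** * Lower bounds for the constants *)

Section bliss_lower.
Context {R : realType}.
Local Notation L := (lebesgueR R).

Lemma admissible_poweR (p q D A : R) (b f : R -> \bar R) : 0 < q -> 0 <= D -> Lplus b ->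
  admissible p q b D -> Lplus f -> (\int[@leb R]_(x in posR) (f x `^ p) = A%:E)%E ->
  (\int[@leb R]_(x in posR) (Hop b f x `^ q) <= ((D * A `^ p^-1) `^ q)%:E)%E.
Proof.
move=> q0 D0 Lb adm Lf fA; have qN0 : q != 0 by rewrite gt_eqF.
have LH := Lplus_poweR q (Lplus_Hop Lb Lf).
have := adm f Lf; rewrite fA ltry => /(_ isT).
rewrite poweR_EFin -EFinM => H.
rewrite -[leLHS](poweR_Kroot (integral_posR_ge0 LH) qN0) -poweR_EFin.
by apply: le_poweR H; [exact: ltW|exact: poweR_ge0].
Qed.

(** Where [c] fails the integrand is discarded, so it is enough that [b] dominates [b0] on part of
    the half-line, later near one end. *)
Lemma admissible_restrict (p q D A : R) (b b0 f : R -> \bar R) (c : R -> bool) :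
  0 < q -> 0 <= D -> Lplus b -> Lplus b0 ->
  measurable_fun (posR : set L) (c : L -> bool) ->
  (forall x, 0 < x -> c x -> (b0 x <= b x)%E) ->
  admissible p q b D -> Lplus f -> (\int[@leb R]_(x in posR) (f x `^ p) = A%:E)%E ->
  (\int[@leb R]_(x in posR) (if c x then Hop b0 f x `^ q else 0) <=
    ((D * A `^ p^-1) `^ q)%:E)%E.
Proof.
move=> q0 D0 Lb Lb0 mc bb0 adm Lf fA.
apply: le_trans (admissible_poweR q0 D0 Lb adm Lf fA).
have LH := Lplus_Hop Lb Lf; have LH0 := Lplus_Hop Lb0 Lf.
apply: le_integral_posR; [exact: Lplus_if mc (Lplus_poweR q LH0)|exact: Lplus_poweR|].
move=> x x0; case: ifPn => cx; last exact: poweR_ge0.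
apply: le_poweR; [exact: ltW|exact: LH0.2|].
rewrite !Hop_if; apply: le_integral_posR.
- by apply: Lplus_if Lf; exact: measurable_EFin_lt.
- by apply: Lplus_if Lf; exact: measurable_EFin_lt.
- move=> t t0; case: ifPn => [tb|_]; last by case: ifP => // _; exact: Lf.2.
  by rewrite (lt_le_trans tb (bb0 _ x0 cx)).
Qed.

(** The extremal functions of Bliss have the elementary primitive [x (1 + (c x)^th)^(-1/th)]. *)
Lemma integral_one_pow_scale (th c y : R) : 0 < th -> 0 < c -> 0 < y ->
  (\int[@leb R]_(t in `]0%R, y[) ((1 + (c * t) `^ th) `^ (- (th^-1 + 1)))%:E =
   (y * (1 + (c * y) `^ th) `^ (- th^-1))%:E)%E.
Proof.
move=> th0 c0 y0.
have op0 (x : R) : 0 < 1 + (c * x) `^ th by rewrite ltr_wpDr// powR_ge0.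
have dop (x : R) : 0 < x ->
    is_derive x 1 (fun x => 1 + (c * x) `^ th) (th * (c * x) `^ (th - 1) * c).
  move=> x0; have cx0 : 0 < c * x by rewrite mulr_gt0.
  have H := is_derive_powR_comp th cx0 (is_derive_scale c x).
  apply: is_derive_eq (is_deriveD (is_derive_cst (1 : R) x 1) H) _.
  by rewrite add0r.
have dr (r x : R) (x0 : 0 < x) :=
  @is_derive_powR_comp _ (fun x => 1 + (c * x) `^ th) x _ r (op0 x) (dop x x0).
pose G (x : R) := x * (1 + (c * x) `^ th) `^ (- th^-1).
have dG (x : R) : 0 < x -> is_derive x 1 G ((1 + (c * x) `^ th) `^ (- (th^-1 + 1))).
  move=> x0; apply: is_derive_eq (is_derive_mul (is_derive_id x 1) (dr (- th^-1) x x0)) _.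
  have E1 : (1 + (c * x) `^ th) `^ (- th^-1) =
      (1 + (c * x) `^ th) * (1 + (c * x) `^ th) `^ (- (th^-1 + 1)).
    rewrite -[X in _ = X * _]powRr1 ?(ltW (op0 x))// -powRD.
      by congr (_ `^ _); ring.
    by rewrite (gt_eqF (op0 x)) implybT.
  rewrite mul1r {1}E1 (_ : - th^-1 - 1 = - (th^-1 + 1)); last by ring.
  have := @mulr_powRB1 _ (c * x) th (ltW (mulr_gt0 c0 x0)) th0.
  set X := (c * x) `^ (th - 1); set Y := (c * x) `^ th; move=> <-.
  by set Z := (1 + _) `^ _; field; rewrite gt_eqF.
have -> : y * (1 + (c * y) `^ th) `^ (- th^-1) = G y - 0 by rewrite subr0.
apply: (ge0_FTC_oo y0 (g := fun x => (1 + (c * x) `^ th) `^ (- (th^-1 + 1))) (G := G)).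
- by move=> x /andP[x0 _]; exact: dG.
- by move=> x /andP[x0 _]; exact: is_derive_continuous (dr _ _ x0).
- by move=> x _; exact: powR_ge0.
- apply/cvgrPdist_le => e e0; near=> z.
  have z0 : 0 < z by near: z; exact: nbhs_right_gt.
  have ze : z <= e by near: z; exact: nbhs_right_le.
  rewrite sub0r normrN ger0_norm ?mulr_ge0 ?powR_ge0 ?(ltW z0)//.
  apply: le_trans ze; rewrite ger_pMr// -[leRHS](powRr0 (1 + (c * z) `^ th)) ler_powR//.
    by rewrite lerDl powR_ge0.
  by rewrite oppr_le0 invr_ge0 ltW.
- by apply: cvg_at_left_filter; exact: is_derive_continuous (dG y y0).
Unshelve. all: by end_near.
Qed.

Section test.
Variables (p q p' s th sg m D : R) (b : R -> \bar R) (c : R -> bool).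
Hypothesis p0 : 0 < p.
Hypothesis q0 : 0 < q.
Hypothesis p'0 : 0 < p'.
Hypothesis s0 : 0 < s.
Hypothesis e0 : s / q + 1 = s / p.
Hypothesis e1 : sg * p' = q.
Hypothesis e2 : th * s = p'.
Hypothesis e3 : q - sg = q / p.
Hypothesis mE : (\int[@leb R]_(z in posR) (bliss_density (q / s) s z)%:E = m%:E)%E.
Hypothesis D0 : 0 <= D.
Hypothesis Lb : Lplus b.
Hypothesis mc : measurable_fun (posR : set L) (c : L -> bool).
Hypothesis bb0 : forall x, 0 < x -> c x -> (pow_kernel sg x <= b x)%E.
Hypothesis adm : admissible p q b D.

Let qs0 : 0 < q / s. Proof. by rewrite divr_gt0. Qed.

(** The extremal function of Bliss, dilated by [k]. By [e0] the exponent is [-s/p], so [f^p] is a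
    dilate of the density with [th = q/s]. *)
Let f (k : R) (t : R) : \bar R := ((1 + (k * t) `^ (q / s)) `^ (- ((q / s)^-1 + 1)))%:E.

Let Hop_f k x : 0 < k -> 0 < x ->
  (Hop (pow_kernel sg) (f k) x `^ q =
   (k `^ (- q) * bliss_density th s (k `^ (- sg) * x))%:E)%E.
Proof.
move=> k0 x0; set y := x `^ (- sg^-1); have y0 : 0 < y by rewrite powR_gt0.
have sgN : sg != 0 by apply: contraTneq q0 => h; rewrite -e1 h mul0r ltxx.
have qN : q != 0 by rewrite gt_eqF.
have sN : s != 0 by rewrite gt_eqF.
rewrite Hop_pow_kernel integral_one_pow_scale// poweR_EFin; congr (_%:E).
have ky0 : 0 < k * y by rewrite mulr_gt0.
rewrite powRM ?powR_ge0 ?(ltW y0)// -[X in _ * X = _]powRrM.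
rewrite (_ : - (q / s)^-1 * q = - s); last by field; rewrite qN sN.
rewrite /bliss_density.
(* The kernel inverts the variable: [u] in the primitive becomes [1/u] in the image, and
   [1 + 1/u = (1 + u)/u] brings the image to the density with exponent [th]. *)
have -> : (k `^ (- sg) * x) `^ th = ((k * y) `^ (q / s))^-1.
  rewrite -powRN !powRM ?powR_ge0 ?(ltW k0) ?(ltW x0) ?(ltW y0)//.
  rewrite /y -!powRrM -e1 -e2.
  congr (_ `^ _ * _ `^ _); last by field; rewrite sgN sN.
  by field; rewrite sN.
set u := (k * y) `^ (q / s); have u0 : 0 < u by rewrite powR_gt0.
have -> : 1 + u^-1 = u^-1 * (1 + u) by rewrite mulrDr mulr1 mulVf ?gt_eqF// addrC.
rewrite powRM ?invr_ge0 ?(ltW u0) ?addr_ge0 ?(ltW u0)// mulrA; congr (_ * _).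
have us : u `^ s = k `^ q * y `^ q by rewrite -powRM ?(ltW k0) ?(ltW y0)// /u -powRrM divfK.
rewrite powR_inv// -powRN opprK us.
by rewrite mulrA -powRD ?(gt_eqF k0) ?implybT// addrC subrr powRr0 mul1r.
Qed.

Let f_total k : 0 < k -> (\int[@leb R]_(t in posR) (f k t `^ p) = (m / k)%:E)%E.
Proof.
move=> k0; rewrite -(@integral_scale _ (bliss_density (q / s) s) 1 m k _ _ _ mE k0).
- apply: eq_integral_posR => t t0; rewrite /f poweR_EFin -powRrM /bliss_density.
  congr ((_ `^ _)%:E); rewrite invf_div e0 mulNr divfK// gt_eqF//.
- by move=> x x0; exact: continuous_one_pow.
- by move=> x _; exact: ltW (bliss_density_gt0 _ _ _).
- by move=> x _; apply: one_pow_le1; rewrite oppr_le0 ltW.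
Qed.

Let Lf k : 0 < k -> Lplus (f k).
Proof.
move=> k0; apply: Lplus_EFin => x x0; last exact: powR_ge0.
have kx : 0 < k * x by rewrite mulr_gt0.
apply: (@continuous_comp _ _ _ (fun x => k * x)
  (fun z => (1 + z `^ (q / s)) `^ (- ((q / s)^-1 + 1)))).
  exact: is_derive_continuous (is_derive_scale k x).
exact: continuous_one_pow.
Qed.

(** With [k = l^(-1/sg)], both sides of the test inequality carry the same power of [k] and [l], by
    [e3], so only the dilated density remains. Large [l] concentrates it near 0, small [l] near
    infinity. *)
Lemma bliss_test (l : R) : 0 < l ->
  (\int[@leb R]_(x in posR) (if c x then (l * bliss_density th s (l * x))%:E else 0) <=
   ((D * m `^ p^-1) `^ q)%:E)%E.
Proof.
move=> l0.
have sg0 : 0 < sg by rewrite -(pmulr_lgt0 _ p'0) e1.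
pose k := l `^ (- sg^-1); have k0 : 0 < k by rewrite powR_gt0.
have kl : k `^ (- sg) = l by exact: powRNK.
have := admissible_restrict q0 D0 Lb (Lplus_pow_kernel sg) mc bb0 adm (Lf k0) (f_total k0).
have Lphi : Lplus (fun x => (l * bliss_density th s (l * x))%:E).
  apply: Lplus_EFin => x x0; last by rewrite mulr_ge0 ?(ltW l0) ?(ltW (bliss_density_gt0 _ _ _)).
  apply: cvgMr.
  apply: (@continuous_comp _ _ _ (fun x => l * x) (bliss_density th s)).
    exact: is_derive_continuous (is_derive_scale l x).
  by apply: continuous_one_pow; rewrite mulr_gt0.
rewrite (@eq_integral_posR _ _ (fun x => (k `^ (- q) / l)%:E *
    (if c x then (l * bliss_density th s (l * x))%:E else 0))%E); last first.
  move=> x x0; case: ifPn => _; last by rewrite mule0.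
  by rewrite Hop_f// kl -EFinM mulrA divfK// gt_eqF.
rewrite integralZl_posR; last 2 first.
- exact: Lplus_if mc Lphi.
- by rewrite lee_fin divr_ge0 ?powR_ge0 ?(ltW l0).
have m0 : 0 <= m.
  rewrite -lee_fin -mE; apply: integral_posR_ge0; apply: Lplus_EFin => x x0.
    exact: continuous_one_pow.
  exact: ltW (bliss_density_gt0 _ _ _).
have -> : (D * (m / k) `^ p^-1) `^ q = k `^ (- q) / l * (D * m `^ p^-1) `^ q.
  rewrite (powRM _ m0) ?invr_ge0 ?(ltW k0)// mulrA powRM ?mulr_ge0 ?powR_ge0//.
  rewrite mulrC; congr (_ * _).
  rewrite powR_inv// -powRN -powRrM -kl -powRN -powRD; last by rewrite (gt_eqF k0) implybT.
  by congr (_ `^ _); rewrite mulNr mulrC -e3; ring.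
by rewrite [X in (_ <= X)%E -> _]EFinM lee_pmul2l// lte_fin divr_gt0 ?powR_gt0.
Qed.

End test.

End bliss_lower.

Section scale_parts.
Context {R : realType}.
Variables (h : R -> R) (B l : R).
Hypothesis ch : forall x, 0 < x -> {for x, continuous h}.
Hypothesis h0 : forall x, 0 < x -> 0 <= h x.
Hypothesis hB : forall x, 0 < x -> h x <= B.
Hypothesis l0 : 0 < l.
Let H := prim (fun x => (h x)%:E).

Let dH (x : R) : 0 < x -> is_derive x 1 (fun x => H (l * x)) (l * h (l * x)).
Proof.
move=> x0; have lx0 : 0 < l * x by exact: mulr_gt0.
apply: is_derive_eq (is_derive1_comp (is_derive_prim ch h0 hB lx0) (is_derive_scale l x)) _.
by rewrite mulrC.
Qed.

Let ch' x : 0 < x -> {for x, continuous (fun x => l * h (l * x))}.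
Proof.
move=> x0; apply: cvgMr; apply: (@continuous_comp _ _ _ (fun x => l * x) h).
  exact: is_derive_continuous (is_derive_scale l x).
by apply: ch; exact: mulr_gt0.
Qed.

Let h0' x : 0 < x -> 0 <= l * h (l * x).
Proof. by move=> x0; rewrite mulr_ge0 ?(ltW l0)// h0// mulr_gt0. Qed.

Lemma integral_scale_lt (d : R) : 0 < d ->
  (\int[@leb R]_(x in posR) (if (x < d)%R then (l * h (l * x))%:E else 0) = (H (l * d))%:E)%E.
Proof.
move=> d0; rewrite -(@integral_posR_if _ _ `]0%R, d[); last first.
  by move=> x; rewrite /= in_itv/=; split=> [/andP[]|[-> ->]].
rewrite -[H _]subr0; apply: (ge0_FTC_oo d0 (G := fun x => H (l * x))).
- by move=> x /andP[x0 _]; exact: dH.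
- by move=> x /andP[x0 _]; exact: ch'.
- by move=> x /andP[x0 _]; exact: h0'.
- exact: (cvg_comp (fun x => l * x) _ (cvg_scale0 l0) (cvg_prim0 ch h0 hB)).
- by apply: cvg_at_left_filter; exact: is_derive_continuous (dH d0).
Qed.

Lemma integral_scale_gt (T d : R) : (\int[@leb R]_(x in posR) (h x)%:E = T%:E)%E -> 0 < d ->
  (\int[@leb R]_(x in posR) (if (d < x)%R then (l * h (l * x))%:E else 0) =
   (T - H (l * d))%:E)%E.
Proof.
move=> hT d0; rewrite -(@integral_posR_if _ _ `]d, +oo[); last first.
  move=> x; rewrite /= in_itv/= andbT; split=> [dx|[]//].
  by split=> //; exact: lt_trans dx.
apply: (ge0_FTC_oy (G := fun x => H (l * x))).
- by move=> x dx; apply: dH; exact: lt_trans dx.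
- by move=> x dx; apply: ch'; exact: lt_trans dx.
- by move=> x dx; apply: h0'; exact: lt_trans dx.
- by apply: cvg_at_right_filter; exact: is_derive_continuous (dH d0).
- exact: (cvg_comp (fun x => l * x) _ (cvg_scaley l0) (cvg_prim_total ch h0 hB hT)).
Qed.

End scale_parts.

Section lower_bounds.
Context {R : realType}.
Local Notation L := (lebesgueR R).

Lemma measurable_gtr_posR (y : R) :
  measurable_fun (posR : set L) (fun t : L => y < (t : R)).
Proof.
rewrite (_ : (fun t => _) = (fun t : L => (y%:E < (t : R)%:E)%E)).
  apply: measurable_lt_Lplus; apply: Lplus_EFin => x x0; [exact: cvg_id|exact: ltW].
by apply/funext => t; rewrite lte_fin.
Qed.

Section bliss.
Variables (p q p' s th sg m D : R) (b : R -> \bar R).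
Hypothesis p0 : 0 < p.
Hypothesis q0 : 0 < q.
Hypothesis p'0 : 0 < p'.
Hypothesis s1 : 1 < s.
Hypothesis sE : s^-1 = p^-1 - q^-1.
Hypothesis e1 : sg * p' = q.
Hypothesis e2 : th * s = p'.
Hypothesis e3 : q - sg = q / p.
Hypothesis m0 : 0 < m.
Hypothesis mE : (\int[@leb R]_(z in posR) (bliss_density th s z)%:E = m%:E)%E.
Hypothesis mE' : (\int[@leb R]_(z in posR) (bliss_density (q / s) s z)%:E = m%:E)%E.
Hypothesis D0 : 0 <= D.
Hypothesis Lb : Lplus b.
Hypothesis adm : admissible p q b D.

Let s0 : 0 < s. Proof. exact: lt_trans s1. Qed.

Let e0 : s / q + 1 = s / p.
Proof.
have sN : s != 0 by rewrite gt_eqF.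
have -> : p^-1 = s^-1 + q^-1 by rewrite sE subrK.
by rewrite mulrDr divff// addrC.
Qed.

Let cphi z : 0 < z -> {for z, continuous (bliss_density th s)}.
Proof. by move=> z0; exact: continuous_one_pow. Qed.
Let phi0 z : 0 < z -> 0 <= bliss_density th s z.
Proof. by move=> _; exact: ltW (bliss_density_gt0 _ _ _). Qed.
Let phi1 z : 0 < z -> bliss_density th s z <= 1.
Proof. by move=> _; apply: one_pow_le1; rewrite oppr_le0 ltW. Qed.

Let bound : m <= (D * m `^ p^-1) `^ q -> m `^ (- s^-1) <= D.
Proof.
move=> H; have qV : 0 <= q^-1 by rewrite invr_ge0 ltW.
have := ge0_ler_powR qV _ _ H; rewrite !nnegrE powR_ge0 (ltW m0) => /(_ isT isT).
rewrite -[X in _ <= X -> _]powRrM divff ?gt_eqF// powRr1 ?mulr_ge0 ?powR_ge0//.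
rewrite -ler_pdivrMr ?powR_gt0// -powRN -powRD; last by rewrite (gt_eqF m0) implybT.
by rewrite sE opprB.
Qed.

Lemma bliss_lower_zero (d : R) : 0 < d ->
  (forall x, 0 < x -> x < d -> (pow_kernel sg x <= b x)%E) -> m `^ (- s^-1) <= D.
Proof.
move=> d0 bb0; apply: bound; rewrite leNgt; apply/negP => H.
have [u u0] := prim_near_total cphi phi0 phi1 mE H; apply/negP; rewrite -leNgt.
(* With [l = u / d] the part on []0, d[] of the dilated density has the mass of []0, u[], chosen
   above the bound. *)
have l0 : 0 < u / d by rewrite divr_gt0.
have := bliss_test p0 q0 p'0 s0 e0 e1 e2 e3 mE' D0 Lb (measurable_ltr_posR d) bb0 adm l0.
by rewrite (integral_scale_lt cphi phi0 phi1 l0 d0) divfK ?gt_eqF// lee_fin.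
Qed.

Lemma bliss_lower_infty (d : R) : 0 < d ->
  (forall x, 0 < x -> d < x -> (pow_kernel sg x <= b x)%E) -> m `^ (- s^-1) <= D.
Proof.
move=> d0 bb0; apply: bound; set Y := _ `^ q; rewrite leNgt; apply/negP => H.
(* The density is at most 1, so dilating by [(m - Y) / (2 d)] loses at most [(m - Y) / 2] of the
   mass below [d]. *)
have u0 : 0 < (m - Y) / 2 by rewrite divr_gt0 ?subr_gt0.
have l0 : 0 < (m - Y) / 2 / d by rewrite divr_gt0.
have := bliss_test p0 q0 p'0 s0 e0 e1 e2 e3 mE' D0 Lb (measurable_gtr_posR d) bb0 adm l0.
rewrite (integral_scale_gt cphi phi0 phi1 l0 mE d0) divfK ?gt_eqF// lee_fin -/Y.
have phi1E x : 0 < x -> ((bliss_density th s x)%:E <= 1%:E)%E by move=> /phi1; rewrite lee_fin.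
have := prim_lip (Lplus_bliss_density th s) phi1E (lexx 0) (ltW u0).
by rewrite prim0 add0r subr0 mul1r; lra.
Qed.

End bliss.

End lower_bounds.

(** * Sharpness for p = q *)

Section lower_hardy.
Context {R : realType}.
Local Notation L := (lebesgueR R).

Section hardy.
Variables (p p' sg D : R) (b : R -> \bar R).
Hypothesis p1 : 1 < p.
Hypothesis p'1 : 1 < p'.
Hypothesis pp' : p^-1 + p'^-1 = 1.
Hypothesis e1 : sg * p' = p.
Hypothesis D0 : 0 <= D.
Hypothesis Lb : Lplus b.
Hypothesis adm : admissible p p b D.

Let p0 : 0 < p. Proof. exact: lt_trans p1. Qed.
Let p'0 : 0 < p'. Proof. exact: lt_trans p'1. Qed.
Let sg0 : 0 < sg. Proof. by rewrite -(pmulr_lgt0 _ p'0) e1. Qed.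

(** Nearly extremal functions: the critical power [t^(-1/p)] made integrable at 0 by [e]. The cut at
    [v^(-1/sg)] is invisible to [Hop] for [x > v], where the image is a pure power. *)
Let f (e v : R) (t : R) : \bar R :=
  if (t < v `^ (- sg^-1))%R then (t `^ (e - p^-1))%:E else 0%E.

Let f_total e v : 0 < e -> 0 < v ->
  (\int[@leb R]_(t in posR) (f e v t `^ p) = (v `^ (- (e * p')) / (e * p))%:E)%E.
Proof.
move=> e0 v0; set l := v `^ (- sg^-1); have l0 : 0 < l by rewrite powR_gt0.
rewrite (@eq_integral_posR _ _ (fun t => if (t < l)%R then (t `^ (e * p - 1))%:E else 0)%E); last first.
  move=> t t0; rewrite /f -/l; case: ifPn => _; last by rewrite poweR0r ?gt_eqF.
  by rewrite poweR_EFin -powRrM mulrBl mulVf ?gt_eqF.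
rewrite -(@integral_posR_if _ _ `]0%R, l[); last first.
  by move=> x; rewrite /= in_itv/=; split=> [/andP[]|[-> ->]].
rewrite integral_powR_o// ?subrK.
  rewrite /l -powRrM; congr ((_ `^ _ / _)%:E); rewrite -e1; field; rewrite gt_eqF//.
by rewrite ltrBrDl subrr mulr_gt0.
Qed.

Let Lf e v : Lplus (f e v).
Proof. exact: Lplus_if (measurable_ltr_posR _) (Lplus_powR _). Qed.

Let Hop_f e v x : 0 < e -> 0 < v -> v < x ->
  (Hop (pow_kernel sg) (f e v) x `^ p =
   ((p'^-1 + e) `^ (- p) * x `^ (- (1 + e * p')))%:E)%E.
Proof.
move=> e0 v0 vx; have x0 := lt_trans v0 vx.
have sgV0 : 0 < sg^-1 by rewrite invr_gt0.
have lx := gt0_ltr_powRN sgV0 v0 vx.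
have k0 : 0 < p'^-1 + e by rewrite addr_gt0 ?invr_gt0.
rewrite Hop_pow_kernel.
rewrite (_ : (integral _ _ _ = \int[@leb R]_(t in `]0%R, (x `^ (- sg^-1))%R[) (t `^ (e - p^-1))%:E)%E).
  rewrite integral_powR_o ?powR_gt0//; last by move: pp' k0; lra.
  have -> : e - p^-1 + 1 = p'^-1 + e by move: pp'; lra.
  rewrite poweR_EFin powRM ?invr_ge0 ?powR_ge0 ?(ltW k0)// powR_inv// -powRN -!powRrM.
  rewrite mulrC; congr ((_ * _ `^ _)%:E).
  by rewrite -e1; field; rewrite !gt_eqF.
apply: eq_integral => t /set_mem /=; rewrite in_itv/= => /andP[_ tx].
by rewrite /f (lt_trans tx lx).
Qed.

Let kernel_cst (e r v : R) (c : R -> bool) : 0 < e -> 0 < v ->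
  measurable_fun (posR : set L) (c : L -> bool) ->
  (forall x, 0 < x -> c x -> v < x) ->
  (forall x, 0 < x -> c x -> (pow_kernel sg x <= b x)%E) ->
  (\int[@leb R]_(x in posR) (if c x then (x `^ (- (1 + e * p')))%:E else 0) = r%:E)%E ->
  r * (e * p) <= (D * (p'^-1 + e)) `^ p * v `^ (- (e * p')).
Proof.
move=> e0 v0 mc cv bb0 rE.
have k0 : 0 < p'^-1 + e by rewrite addr_gt0 ?invr_gt0.
have ep : 0 < e * p by rewrite mulr_gt0.
have := admissible_restrict p0 D0 Lb (Lplus_pow_kernel sg) mc bb0 adm (Lf e v) (f_total e0 v0).
rewrite (@eq_integral_posR _ _ (fun x => ((p'^-1 + e) `^ (- p))%:E *
    (if c x then (x `^ (- (1 + e * p')))%:E else 0))%E); last first.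
  move=> x x0; case: ifPn => cx; last by rewrite mule0.
  by rewrite Hop_f// ?EFinM// cv.
rewrite integralZl_posR; last 2 first.
- exact: Lplus_if mc (Lplus_powR _).
- by rewrite lee_fin powR_ge0.
rewrite rE -EFinM lee_fin powRN [X in _ <= X -> _]powRM ?powR_ge0//.
rewrite -[X in _ <= _ * X -> _]powRrM mulVf ?gt_eqF// powRr1 ?divr_ge0 ?powR_ge0 ?(ltW ep)//.
rewrite ler_pdivrMl ?powR_gt0// -(ler_pM2r ep) => /le_trans; apply.
rewrite (powRM _ D0 (ltW k0)) le_eqVlt; apply/orP; left; apply/eqP; field.
by rewrite (gt_eqF e0) (gt_eqF p0).
Qed.

(** [X^(1/p) <= D (1/p' + e)] for all [e > 0]; the choice [e = d / (D + 1)] makes the excess at most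
    [d]. *)
Let lim_e (X : R) : 0 <= X -> (forall e, 0 < e -> X <= (D * (p'^-1 + e)) `^ p) ->
  X `^ p^-1 * p' <= D.
Proof.
move=> X0 H; rewrite -ler_pdivlMr//; apply/ler_addgt0Pr => d d0.
have D1 : 0 < D + 1 by rewrite ltr_wpDl.
have e0 : 0 < d / (D + 1) by rewrite divr_gt0.
have pV : 0 <= p^-1 by rewrite invr_ge0 ltW.
have := ge0_ler_powR pV _ _ (H _ e0); rewrite !nnegrE powR_ge0 X0 => /(_ isT isT).
rewrite -[X in _ <= X -> _]powRrM divff ?gt_eqF// powRr1; last first.
  by rewrite mulr_ge0// addr_ge0 ?invr_ge0 ?ltW.
move=> /le_trans; apply; rewrite mulrDr lerD2l mulrA ler_pdivrMr// mulrC ler_pM2l//.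
by rewrite lerDl.
Qed.

Let hardy_constant : (p / p') `^ p^-1 * p' = p `^ p^-1 * p' `^ p'^-1.
Proof.
rewrite powRM ?invr_ge0 ?(ltW p0) ?(ltW p'0)// powR_inv// -powRN -mulrA; congr (_ * _).
rewrite -[X in _ * X = _]powRr1 ?(ltW p'0)// -powRD ?(gt_eqF p'0) ?implybT//.
by congr (_ `^ _); move: pp'; lra.
Qed.

Lemma hardy_lower_infty (d : R) : 0 < d ->
  (forall x, 0 < x -> d < x -> (pow_kernel sg x <= b x)%E) ->
  p `^ p^-1 * p' `^ p'^-1 <= D.
Proof.
move=> d0 bb0; rewrite -hardy_constant; apply: lim_e => [|e e0].
  by rewrite divr_ge0 ?ltW.
have ep' : 0 < e * p' by rewrite mulr_gt0.
have := @kernel_cst e (d `^ (- (e * p')) / (e * p')) d _ e0 d0 (measurable_gtr_posR d) _ bb0.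
rewrite -(@integral_posR_if _ _ `]d, +oo[); last first.
  move=> x; rewrite /= in_itv/= andbT; split=> [dx|[]//].
  by split=> //; exact: lt_trans dx.
rewrite integral_powR_y//; last by rewrite ltrN2 ltrDl.
rewrite [in X in X%:E](_ : - (1 + e * p') + 1 = - (e * p')) ?opprK; last by ring.
move=> /(_ (fun x _ H => H) erefl).
rewrite mulrAC -mulrA [_ * (_ `^ _)]mulrC ler_pM2l ?powR_gt0//.
by rewrite -mulf_div divff ?mul1r// gt_eqF.
Qed.

Lemma hardy_lower_zero (d : R) : 0 < d ->
  (forall x, 0 < x -> x < d -> (pow_kernel sg x <= b x)%E) ->
  p `^ p^-1 * p' `^ p'^-1 <= D.
Proof.
move=> d0 bb0; rewrite -hardy_constant; apply: lim_e => [|e e0].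
  by rewrite divr_ge0 ?ltW.
have ep' : 0 < e * p' by rewrite mulr_gt0.
set Y := _ `^ p; have pp0 : 0 < p / p' by rewrite divr_gt0.
have key (n : R) : 0 < n -> n < 1 -> p / p' * (1 - n) <= Y.
  (* Now only []v, d[] is available. This [v] makes [d^(-e p')] equal to [n v^(-e p')], so the lost
     fraction is [n], whatever [e] is. *)
  move=> n0 n1; pose v := d * n `^ (e * p')^-1.
  have v0 : 0 < v by rewrite mulr_gt0 ?powR_gt0.
  have vd : v < d.
    rewrite gtr_pMr//; have : n `^ (e * p')^-1 < 1 `^ (e * p')^-1; last by rewrite powR1.
    by apply: gt0_ltr_powR; rewrite ?nnegrE ?invr_gt0 ?(ltW n0).
  have vE : v `^ (e * p') = d `^ (e * p') * n.
    by rewrite powRM ?powR_ge0 ?(ltW d0)// -powRrM mulVf ?gt_eqF// powRr1 ?(ltW n0).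
  have mc : measurable_fun (posR : set L) (fun x : L => (v < (x : R)) && ((x : R) < d)).
    by apply: measurable_and; [exact: measurable_gtr_posR|exact: measurable_ltr_posR].
  have bb x : 0 < x -> (v < x) && (x < d) -> (pow_kernel sg x <= b x)%E.
    by move=> x0 /andP[_ xd]; exact: bb0.
  have cv x : 0 < x -> (v < x) && (x < d) -> v < x by move=> _ /andP[].
  have := @kernel_cst e ((v `^ (- (e * p')) - d `^ (- (e * p'))) / (e * p')) v _ e0 v0 mc cv bb.
  rewrite -(@integral_posR_if _ _ `]v, d[); last first.
    move=> x; rewrite /= in_itv/=; split=> [vxd|[]//].
    by split=> //; case/andP: vxd => vx _; exact: lt_trans vx.
  pose G (x : R) := - (e * p')^-1 * x `^ (- (e * p')).
  have dG (x : R) : 0 < x -> is_derive x 1 G (x `^ (- (1 + e * p'))).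
    move=> x0; apply: is_derive_eq (is_derive_mulc _ (is_derive1_powR (- (e * p')) x0)) _.
    rewrite mulrA mulrNN mulVf ?mul1r ?gt_eqF//; congr (_ `^ _); ring.
  have dG' (x : R) : v < x < d -> is_derive x 1 G (x `^ (- (1 + e * p'))).
    by move=> /andP[vx _]; apply: dG; exact: lt_trans vx.
  rewrite (ge0_FTC_oo vd dG' (la := G v) (lb := G d)); last 4 first.
  - by move=> x /andP[vx _]; apply: continuous_powR; exact: lt_trans vx.
  - by move=> x _; exact: powR_ge0.
  - by apply: cvg_at_right_filter; exact: is_derive_continuous (dG v v0).
  - by apply: cvg_at_left_filter; exact: is_derive_continuous (dG d d0).
  have -> : G d - G v = (v `^ (- (e * p')) - d `^ (- (e * p'))) / (e * p') by rewrite /G; ring.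
  move=> /(_ erefl); rewrite -/Y !powRN vE => H.
  have dp : 0 < d `^ (e * p') by rewrite powR_gt0.
  move: H; rewrite ler_pdivlMr; last by rewrite mulr_gt0.
  apply: le_trans; rewrite le_eqVlt; apply/orP; left; apply/eqP.
  by field; rewrite !gt_eqF.
rewrite leNgt; apply/negP => H; move: pp0 key H; move: (p / p') => X X0 key XY.
have Y0 := key 2^-1 (ltac:(by rewrite invr_gt0)) (ltac:(by rewrite invf_lt1// ltr1n)).
(* For this [n] the bound reads [(X + Y) / 2 <= Y], against [Y < X]; the instance [n = 1/2] makes
   [Y] positive, hence [n < 1]. *)
have n0 : 0 < (X - Y) / (2 * X) by rewrite divr_gt0 ?subr_gt0// mulr_gt0.
have n1 : (X - Y) / (2 * X) < 1 by rewrite ltr_pdivrMr ?mulr_gt0//; lra.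
have := key _ n0 n1; rewrite (_ : X * _ = (X + Y) / 2); first by lra.
by field; rewrite gt_eqF.
Qed.

End hardy.

End lower_hardy.

Section conjexp.
Context {R : realType}.

Lemma conjexp_sum (p : R) : p^-1 + (conjexp p)^-1 = 1.
Proof. by rewrite /conjexp invrK addrC subrK. Qed.

Lemma conjexp_gt1 (p : R) : 1 < p -> 1 < conjexp p.
Proof.
move=> p1; have p0 : 0 < p by exact: lt_trans p1.
by rewrite /conjexp invf_gt1 ?subr_gt0 ?invf_lt1// gtrBl invr_gt0.
Qed.

End conjexp.

Section Nconst_admissible.
Context {R : realType}.
Local Open Scope ereal_scope.
Variables (p q : R) (b : R -> \bar R).
Hypothesis p0 : (0 < p)%R.
Hypothesis q0 : (0 < q)%R.
Hypothesis Lb : Lplus b.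

Let pN : p != 0%R. Proof. by rewrite gt_eqF. Qed.
Let qN : q != 0%R. Proof. by rewrite gt_eqF. Qed.

Lemma Nconst_le (D : R) : (0 <= D)%R -> admissible p q b D -> Nconst p q b <= D%:E.
Proof.
move=> D0 adm; apply: ge_ereal_inf; exists D%:E => //; split=> [|f Lf]; first by rewrite lee_fin.
rewrite (LpnormE pN Lf) (LpnormE qN (Lplus_Hop Lb Lf)) => foo; apply: adm => //.
have I0 := integral_posR_ge0 (Lplus_poweR p Lf).
rewrite -[ltLHS](poweR_Kroot I0 pN); exact: poweR_lty.
Qed.

Lemma Nconst_ge (x : \bar R) :
  (forall D : R, (0 <= D)%R -> admissible p q b D -> x <= D%:E) -> x <= Nconst p q b.
Proof.
move=> H; apply/ereal_infP => -[D [D0 adm]|_|[]//]; last exact: leey.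
rewrite lee_fin in D0; apply: H => // f Lf foo.
have := adm f Lf; rewrite (LpnormE pN Lf) (LpnormE qN (Lplus_Hop Lb Lf)); apply.
exact: poweR_lty.
Qed.

End Nconst_admissible.

Section ereal_limits.
Context {R : realType}.
Local Open Scope ereal_scope.

Lemma limf_einf_gt (f : R -> \bar R) (F : set (set R)) (l : \bar R) :
  l < limf_einf f F -> exists2 A, F A & forall x, A x -> l < f x.
Proof.
rewrite /limf_einf lteNr => /ereal_inf_lt[_ [A FA <-] H].
exists A => // x Ax; rewrite -lteN2; apply: le_lt_trans H.
by apply: ereal_sup_ubound; exists x.
Qed.

(** Reduces a bound on a possibly infinite lower limit to real numbers strictly below it. *)
Lemma le_of_lt_EFin (x : \bar R) (d : R) : (0 <= d)%R ->
  (forall l : R, (0 < l)%R -> l%:E < x -> (l <= d)%R) -> x <= d%:E.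
Proof.
move=> d0 H; rewrite leNgt; apply/negP; case: x H => [r| |] H //.
  rewrite lte_fin => dr; have := H ((d + r) / 2)%R.
  rewrite lte_fin => /(_ (ltac:(lra)) (ltac:(lra))); lra.
move=> _; have := H (d + 1)%R; rewrite ltry => /(_ (ltac:(lra)) isT); lra.
Qed.

End ereal_limits.

Section extremal_kernel.
Context {R : realType}.
Variables (p q : R).
Hypothesis p1 : 1 < p.
Hypothesis q1 : 1 < q.
Local Notation p' := (conjexp p).
Local Notation q' := (conjexp q).
Local Notation sg := (q / p').

Let p0 : 0 < p. Proof. exact: lt_trans p1. Qed.
Let q0 : 0 < q. Proof. exact: lt_trans q1. Qed.
Let p'1 : 1 < p'. Proof. exact: conjexp_gt1. Qed.
Let q'1 : 1 < q'. Proof. exact: conjexp_gt1. Qed.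
Let p'0 : 0 < p'. Proof. exact: lt_trans p'1. Qed.
Let q'0 : 0 < q'. Proof. exact: lt_trans q'1. Qed.
Let pp' : p^-1 + p'^-1 = 1. Proof. exact: conjexp_sum. Qed.
Let qq' : q^-1 + q'^-1 = 1. Proof. exact: conjexp_sum. Qed.
Let sg0 : 0 < sg. Proof. exact: divr_gt0. Qed.
Let sgp' : sg * p' = q. Proof. by rewrite divfK// gt_eqF. Qed.

Lemma weighted_int_pow_kernel (t : R) : 0 < t ->
  weighted_int p (pow_kernel sg) t = (q' / p' * t `^ (p' / q'))%:E.
Proof.
move=> t0; rewrite /weighted_int.
have E : p' - 1 + - sg^-1 + 1 = p' / q'.
  have -> : q'^-1 = 1 - q^-1 by rewrite -qq' addrAC subrr add0r.
  by rewrite invf_div; ring.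
under eq_integral => x do rewrite /pow_kernel -EFinM.
transitivity (\int[@leb R]_(x in `]0%R, t[) (x `^ (p' - 1 + - sg^-1))%:E)%E.
  apply: eq_integral => x /set_mem /=; rewrite in_itv/= => /andP[x0 _].
  by rewrite -powRD // (gt_eqF x0) implybT.
rewrite integral_powR_o// ?E; first by rewrite invf_div mulrC.
by rewrite -subr_gt0 opprK E divr_gt0.
Qed.

Lemma weighted_int_ge0 (b : R -> \bar R) (t : R) : Lplus b -> (0 <= weighted_int p b t)%E.
Proof.
move=> Lb; apply: integral_ge0 => x /=; rewrite in_itv/= => /andP[x0 _].
by rewrite mule_ge0 ?lee_fin ?powR_ge0//; exact: Lb.2.
Qed.

Lemma c2_ge0 (b : R -> \bar R) (t : R) : (0 <= c2 p q b t)%E.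
Proof. by rewrite mule_ge0 ?lee_fin ?powR_ge0 ?poweR_ge0. Qed.

(** The factor [p'/q'] and the power of [t] in [c2] normalise it to 1 for the power kernel. A
    product instead of a quotient also covers infinite integrals. *)
Lemma weighted_int_c2 (b : R -> \bar R) (t : R) : Lplus b -> 0 < t ->
  weighted_int p b t = (c2 p q b t `^ p' * weighted_int p (pow_kernel sg) t)%E.
Proof.
move=> Lb t0; rewrite weighted_int_pow_kernel// /c2.
have w0 := weighted_int_ge0 t Lb.
rewrite poweRM ?lee_fin ?powR_ge0 ?poweR_ge0// poweR_Kroot; last 2 first.
- by rewrite mule_ge0// lee_fin divr_ge0 ?ltW.
- by rewrite gt_eqF.
rewrite poweR_EFin -powRrM muleA -EFinM muleC muleA -EFinM.
rewrite -[LHS]mul1e; congr (_%:E * _)%E.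
rewrite (_ : - q'^-1 * p' = - (p' / q')); last by rewrite mulNr mulrC.
by rewrite powRN; field; rewrite !gt_eqF ?powR_gt0.
Qed.

(** What Hardy's and Bliss's cases have in common: the upper bound for the power kernel, and its
    persistence as a lower bound for any weight that dominates the kernel near just one end. *)
Definition end_sharp (K : R) : Prop :=
  [/\ 0 < K, admissible p q (pow_kernel sg) K &
  forall (b : R -> \bar R) (D d : R), 0 <= D -> Lplus b -> admissible p q b D -> 0 < d ->
    (forall x, 0 < x -> x < d -> (pow_kernel sg x <= b x)%E) \/
    (forall x, 0 < x -> d < x -> (pow_kernel sg x <= b x)%E) -> K <= D].

Lemma Kconst_diag : p = q -> Kconst p q = p `^ p^-1 * p' `^ p'^-1.
Proof. by move=> pq; rewrite /Kconst pq eqxx. Qed.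

Section bliss_constants.
Hypothesis pq : p < q.
Variable s : R.
Hypothesis sE : s^-1 = p^-1 - q^-1.
Local Notation th := (p' / s).

Let s0 : 0 < s. Proof. by rewrite -invr_gt0 sE subr_gt0 ltf_pV2. Qed.
Let sN : s != 0. Proof. by rewrite gt_eqF. Qed.
Let sp : s / p = 1 + s / q.
Proof.
have -> : p^-1 = s^-1 + q^-1 by rewrite sE subrK.
by rewrite mulrDr divff.
Qed.
Let sp' : s - s / p' = s / p.
Proof.
have -> : p'^-1 = 1 - p^-1 by rewrite -pp' addrAC subrr add0r.
by ring.
Qed.
Let sq' : s - s / q = s / q'.
Proof.
have -> : q'^-1 = 1 - q^-1 by rewrite -qq' addrAC subrr add0r.
by ring.
Qed.
Let sp1 : 1 < s / p. Proof. by rewrite sp ltrDl divr_gt0. Qed.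
Let sq1 : 1 < s / q'.
Proof. by rewrite -sq' (_ : s - s / q = 1 + s / p') ?ltrDl ?divr_gt0//; move: sp sp'; lra. Qed.
Let s1 : 1 < s.
Proof. by rewrite (lt_trans sp1)// ltr_pdivrMr// ltr_pMr. Qed.

Local Notation m := (Gamma (s / p) * Gamma (s / q') / Gamma s).
Let m0 : 0 < m. Proof. by rewrite divr_gt0 ?mulr_gt0 ?Gamma_gt0. Qed.
Let th0 : 0 < th. Proof. by rewrite divr_gt0. Qed.
Let ths : th * s = p'. Proof. by rewrite divfK. Qed.

Let mE : (\int[@leb R]_(z in posR) (bliss_density th s z)%:E = m%:E)%E.
Proof.
have thV : th^-1 = s / p' by rewrite invf_div.
have H : 1 < s - th^-1 by rewrite thV sp'.
have E : 1 + s / p' = s / q' by move: sp sp' sq'; lra.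
by rewrite (integral_bliss_density th0 H) thV sp' E.
Qed.

(** Replacing [th] by [q/s] exchanges the two Gamma factors, so image and test function share the
    mass [m]. *)
Let mE' : (\int[@leb R]_(z in posR) (bliss_density (q / s) s z)%:E = m%:E)%E.
Proof.
have qsV : (q / s)^-1 = s / q by rewrite invf_div.
have H : 1 < s - (q / s)^-1 by rewrite qsV sq'.
rewrite (integral_bliss_density (divr_gt0 q0 s0) H) qsV sq' -sp.
by rewrite [Gamma (s / q') * _]mulrC.
Qed.

Let KE : Kconst p q = m `^ (- s^-1).
Proof.
rewrite /Kconst (lt_eqF pq) -sE invrK powRN -powR_inv//; congr (_ `^ _).
by rewrite invf_div.
Qed.

Lemma Kconst_bliss : end_sharp (Kconst p q).
Proof.
have e3 : q - sg = q / p.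
  have -> : p'^-1 = 1 - p^-1 by rewrite -pp' addrAC subrr add0r.
  by ring.
rewrite KE; split; first exact: powR_gt0.
- apply: (bliss_admissible p0 q0 p'1 s1 th0 sg0 pp' _ _ (esym ths) sgp' m0 mE).
  + rewrite sE; have -> : p'^-1 = 1 - p^-1 by rewrite -pp' addrAC subrr add0r.
    by field; rewrite !gt_eqF.
  + rewrite invf_div sE (_ : 1 - (p^-1 - q^-1) = p'^-1 + q^-1); last by rewrite -pp'; ring.
    by rewrite mulrDr divff// gt_eqF.
- move=> b D d D0 Lb adm d0 [bb|bb].
    exact: (bliss_lower_zero p0 q0 p'0 s1 sE sgp' ths e3 m0 mE mE' D0 Lb adm d0 bb).
  exact: (bliss_lower_infty p0 q0 p'0 s1 sE sgp' ths e3 m0 mE mE' D0 Lb adm d0 bb).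
Qed.

End bliss_constants.

Lemma Kconst_hardy : p = q -> end_sharp (Kconst p q).
Proof.
move=> pq; have sgp : sg * p' = p by rewrite sgp'.
rewrite Kconst_diag//; split; first by rewrite mulr_gt0 ?powR_gt0.
- have := hardy_admissible p1 p'1 pp' sgp; by rewrite [X in admissible _ X]pq.
- move=> b D d D0 Lb; rewrite -[X in admissible _ X]pq => adm d0 [bb|bb].
    exact: (hardy_lower_zero p1 p'1 pp' sgp D0 Lb adm d0 bb).
  exact: (hardy_lower_infty p1 p'1 pp' sgp D0 Lb adm d0 bb).
Qed.

Lemma Kconst_extremal : p <= q -> end_sharp (Kconst p q).
Proof.
rewrite le_eqVlt => /predU1P[/Kconst_hardy//|/Kconst_bliss H].
exact: (H (p^-1 - q^-1)^-1 (invrK _)).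
Qed.

End extremal_kernel.

(** * Bounds for a general weight *)

Section main_bounds.
Context {R : realType}.
Variables (p q : R).
Hypothesis p1 : 1 < p.
Hypothesis q1 : 1 < q.
Local Notation p' := (conjexp p).
Local Notation q' := (conjexp q).
Local Notation bk := (pow_kernel (q / p')).

Let p0 : 0 < p. Proof. exact: lt_trans p1. Qed.
Let q0 : 0 < q. Proof. exact: lt_trans q1. Qed.
Let p'1 : 1 < p'. Proof. exact: conjexp_gt1. Qed.
Let q'1 : 1 < q'. Proof. exact: conjexp_gt1. Qed.
Let p'0 : 0 < p'. Proof. exact: lt_trans p'1. Qed.
Let q'0 : 0 < q'. Proof. exact: lt_trans q'1. Qed.
Let pp' : p^-1 + p'^-1 = 1. Proof. exact: conjexp_sum. Qed.
Let qq' : q^-1 + q'^-1 = 1. Proof. exact: conjexp_sum. Qed.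
Let sg0 : 0 < q / p'. Proof. exact: divr_gt0. Qed.

Lemma weighted_transfer (a b : R -> \bar R) (C D : R) : normal_form a -> normal_form b ->
  0 <= C -> 0 <= D ->
  (forall t, 0 < t -> (weighted_int p a t <= C%:E * weighted_int p b t)%E) ->
  admissible p q b D -> admissible p q a (C `^ p'^-1 * D).
Proof.
move=> anf bnf C0 D0 ab.
exact: (admissible_transfer p0 q1 p'1 q'0 pp' qq' D0 C0 anf bnf ab).
Qed.

Lemma Nconst_transfer (a b : R -> \bar R) (C : R) : normal_form a -> normal_form b -> 0 < C ->
  (forall t, 0 < t -> (weighted_int p a t <= C%:E * weighted_int p b t)%E) ->
  (Nconst p q a <= (C `^ p'^-1)%:E * Nconst p q b)%E.
Proof.
move=> anf bnf C0 ab; have c0 : 0 < C `^ p'^-1 by exact: powR_gt0.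
rewrite -lee_pdivrMl//; apply: (Nconst_ge p0 q0 (Lplus_normal_form bnf)) => D D0 adm.
rewrite lee_pdivrMl// -EFinM; apply: (Nconst_le p0 q0 (Lplus_normal_form anf)).
  by rewrite mulr_ge0// ltW.
exact: (weighted_transfer anf bnf (ltW C0) D0 ab adm).
Qed.

Lemma weighted_int_if (b : R -> \bar R) (t : R) :
  weighted_int p b t = (\int[@leb R]_(x in posR)
    (if (x < t)%R then (x `^ (p' - 1))%:E * b x else 0))%E.
Proof.
by apply: integral_posR_if => x; rewrite /= in_itv/=; split=> [/andP[]|[-> ->]].
Qed.

Lemma Lplus_weighted_if (b : R -> \bar R) (t : R) : Lplus b ->
  Lplus (fun x => if (x < t)%R then (x `^ (p' - 1))%:E * b x else 0)%E.
Proof.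
by move=> Lb; apply: Lplus_if (LplusM (Lplus_powR _) Lb); exact: measurable_ltr_posR.
Qed.

Lemma le_weighted_int (a b : R -> \bar R) (t : R) : Lplus a -> Lplus b ->
  (forall x, 0 < x -> x < t -> (a x <= b x)%E) -> (weighted_int p a t <= weighted_int p b t)%E.
Proof.
move=> La Lb ab; rewrite !weighted_int_if.
apply: (le_integral_posR (Lplus_weighted_if t La) (Lplus_weighted_if t Lb)) => x x0; case: ifPn => // xt.
by apply: lee_wpmul2l; [rewrite lee_fin powR_ge0|exact: ab].
Qed.

Lemma weighted_int_cst (c : \bar R) (t : R) : (0 <= c)%E -> 0 < t ->
  weighted_int p (fun=> c) t = (c * (t `^ p' / p')%:E)%E.
Proof.
move=> c0 t0; rewrite /weighted_int; under eq_integral do rewrite muleC.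
rewrite ge0_integralZl; last exact: c0.
- by rewrite integral_powR_o ?subrK// ltrBrDl subrr.
- exact: measurable_itv_leb.
- by apply: Lplus_sub (Lplus_powR _); exact: itv_posR.
- by move=> x _; rewrite lee_fin powR_ge0.
Qed.

(** [t^(-p')] times the weighted integral is an average of [b] up to a factor, hence nonincreasing:
    beyond [t] the weight is at most [b t], before [t] at least [b t]. *)
Lemma weighted_int_ratio (b : R -> \bar R) (t T : R) : normal_form b -> 0 < t -> t <= T ->
  (weighted_int p b T <= ((T / t) `^ p')%:E * weighted_int p b t)%E.
Proof.
move=> bnf t0 tT; have T0 := lt_le_trans t0 tT; have Lb := Lplus_normal_form bnf.
pose I := t `^ p' / p'; pose J := (T `^ p' - t `^ p') / p'.
have I0 : 0 < I by rewrite divr_gt0 ?powR_gt0.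
have J0 : 0 <= J.
  rewrite divr_ge0 ?(ltW p'0)// subr_ge0.
  by apply: ge0_ler_powR; rewrite ?nnegrE ?(ltW t0) ?(ltW T0) ?(ltW p'0).
have [c [c0 cb bc]] : exists c : \bar R, [/\ (0 <= c)%E,
    forall x, 0 < x -> x < t -> (c <= b x)%E & forall x, t <= x -> (b x <= c)%E].
  exists (b t); split=> [|x x0 xt|x tx]; first exact: bnf.1.
    by apply: bnf.2 => //; exact: ltW.
  exact: bnf.2.
have Lk := LplusM (Lplus_powR (p' - 1)) Lb.
have Lc := LplusM (Lplus_powR (p' - 1)) (Lplus_cst c0).
have wt : (c * I%:E <= weighted_int p b t)%E.
  by rewrite -weighted_int_cst//; apply: le_weighted_int => //; exact: Lplus_cst.
pose mid (x : R) : \bar R := if t <= x then ((x `^ (p' - 1))%:E * c)%E else 0%E.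
have Lmid : Lplus mid.
  rewrite (_ : mid = (fun x => if ~~ (x < t)%R then (x `^ (p' - 1))%:E * c else 0)%E).
    by apply: Lplus_if Lc; exact: measurable_neg (measurable_ltr_posR t).
  by apply/funext => x; rewrite -leNgt.
have mT := @measurable_ltr_posR R T; have mt := @measurable_ltr_posR R t.
set M := (\int[@leb R]_(x in posR) (if (x < T)%R then mid x else 0))%E.
have cT : (c * (T `^ p' / p')%:E = c * I%:E + M)%E.
  rewrite -!weighted_int_cst// !weighted_int_if.
  rewrite -(integralD_posR (Lplus_if mt Lc) (Lplus_if mT Lmid)).
  apply: eq_integral_posR => x x0; rewrite /mid; case: (ltP x t) => [xt|tx].
    by rewrite (lt_le_trans xt tT) adde0.
  by rewrite add0e.
have wT : (weighted_int p b T <= weighted_int p b t + M)%E.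
  rewrite !weighted_int_if -(integralD_posR (Lplus_if mt Lk) (Lplus_if mT Lmid)).
  apply: (le_integral_posR (Lplus_if mT Lk) (LplusD (Lplus_if mt Lk) (Lplus_if mT Lmid))) => x x0.
  rewrite /mid; case: (ltP x t) => [xt|tx].
    by rewrite (lt_le_trans xt tT) adde0.
  rewrite add0e; case: ifP => // _; apply: lee_wpmul2l; last exact: bc.
  by rewrite lee_fin powR_ge0.
have rJ : (T / t) `^ p' = 1 + J / I.
  rewrite powRM ?invr_ge0 ?(ltW T0) ?(ltW t0)// powR_inv// /J /I.
  by field; rewrite !gt_eqF ?powR_gt0.
have r0 : 0 < (T / t) `^ p' by rewrite powR_gt0// divr_gt0.
clearbody M; clear mid Lmid Lc cb bc; apply: (le_trans wT) => {wT}.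
(* An infinite weighted integral is trivial, and a finite one forces [b t] to be finite, as [b t]
   times a positive number is below it. *)
move: wt; case: (weighted_int p b t) => [w| |] wt; last 2 first.
- by rewrite gt0_muley ?lte_fin// leey.
- have I0e : (0 <= I%:E)%E by rewrite lee_fin ltW.
  by have := le_trans (mule_ge0 c0 I0e) wt.
case: c c0 cT wt => [c| |] //= c0; last by move=> _; rewrite gt0_mulye ?lte_fin// leNgt ltry.
rewrite lee_fin in c0; case: M => [M| |] //.
rewrite -!EFinM -!EFinD !lee_fin => -[cT] wt.
have -> : M = c * J.
  by rewrite /J mulrBl mulrBr cT /I addrC addKr.
rewrite rJ mulrDl mul1r lerD2l [c * J]mulrC -[leRHS]mulrA; apply: ler_wpM2l => //.
by rewrite ler_pdivlMl// mulrC.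
Qed.

Lemma normal_form_cut (d : R) : normal_form (fun x => if x < d then bk x else 0%E).
Proof.
have bnf := normal_form_pow_kernel sg0; split=> [x x0|x y x0 xy].
  by case: ifP => // _; exact: bnf.1.
case: ifPn => [yd|_]; first by rewrite (le_lt_trans xy yd); exact: bnf.2.
by case: ifP => // _; exact: bnf.1.
Qed.

Lemma normal_form_flat (d : R) : 0 < d -> normal_form (fun x => bk (Num.max x d)).
Proof.
move=> d0; have bnf := normal_form_pow_kernel sg0; split=> [x x0|x y x0 xy].
  by apply: bnf.1; rewrite lt_max x0.
by apply: bnf.2; [rewrite lt_max x0|exact: le_max2].
Qed.

Lemma weighted_int_ge_c2 (b : R -> \bar R) (l t : R) : normal_form b -> 0 < l -> 0 < t ->
  (l%:E < c2 p q b t)%E ->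
  (weighted_int p bk t <= (l `^ (- p'))%:E * weighted_int p b t)%E.
Proof.
move=> bnf l0 t0 lc; rewrite powRN lee_pdivlMl ?powR_gt0//.
rewrite (weighted_int_c2 p1 q1 (Lplus_normal_form bnf) t0) -poweR_EFin.
apply: lee_wpmul2r; first exact: weighted_int_ge0 (Lplus_pow_kernel _).
by apply: le_poweR (ltW lc); [exact: ltW|rewrite lee_fin ltW].
Qed.

Section lower.
Variables (b : R -> \bar R) (D : R).
Hypothesis bnf : normal_form b.
Hypothesis D0 : 0 <= D.
Hypothesis adm : admissible p q b D.

(** The primitive of the indicator of []0, t[] is [x] there, so [integral_adj_poweR] gives exactly
    [p'] times the weighted integral, against [t^(1/q')] for the norm of the indicator. Since [c2]
    carries [(p'/q')^(1/p')], the factor [(q')^(1/p')] appears. *)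
Lemma A2_lower : ((q' `^ p'^-1)%:E * A2 p q b <= D%:E)%E.
Proof.
have Q0 : 0 < q' `^ p'^-1 by rewrite powR_gt0.
rewrite -lee_pdivlMl//; apply/ereal_supP => _ [t + <-]; rewrite posRE => t0.
rewrite lee_pdivlMl//.
pose g (x : R) : \bar R := if x < t then 1%E else 0%E.
have Lg : Lplus g by apply: Lplus_if (Lplus_cst lee01); exact: measurable_ltr_posR.
have gB x : 0 < x -> (g x <= 1%:E)%E by move=> _; rewrite /g; case: ifP => _; rewrite lee_fin ?ler01.
have gt x : t <= x -> g x = 0%E by move=> tx; rewrite /g ltNge tx.
have gint : (\int[@leb R]_(x in posR) (g x `^ q') = t%:E)%E.
  rewrite (@eq_integral_posR _ _ (fun x => if (x < t)%R then 1 else 0)%E); last first.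
    by move=> x _; rewrite /g; case: ifP => _; rewrite ?poweR1r ?poweR0r// gt_eqF.
  rewrite -(@integral_posR_if _ _ `]0%R, t[ (cst 1%E)); last first.
    by move=> x; rewrite /= in_itv/=; split=> [/andP[]|[-> ->]].
  by rewrite integral_cst ?leb_itv_oo ?(ltW t0) ?mul1e ?subr0//; exact: measurable_itv_leb.
have primg x : 0 < x -> x < t -> prim g x = x.
  move=> x0 xt; apply: EFin_inj; rewrite -(primE Lg gB (ltW x0)).
  rewrite -[RHS](_ : \int[@leb R]_(y in `]0%R, x[) cst 1 y = _)%E.
    apply: eq_integral => y /set_mem /=; rewrite in_itv/= => /andP[_ yx].
    by rewrite /g (lt_trans yx xt).
  by rewrite integral_cst ?leb_itv_oo ?(ltW x0) ?mul1e ?subr0//; exact: measurable_itv_leb.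
have := admissible_adj p0 q0 p'0 q'0 pp' qq' D0 bnf adm Lg gB gt t0.
rewrite gint poweR_EFin.
have r0 : 0 < p' - 1 by rewrite subr_gt0.
have := integral_adj_poweR bnf Lg gB gt r0; rewrite subrK => ->.
have -> : (\int[@leb R]_(x in posR) (g x * (prim g x `^ (p' - 1))%:E * b x) =
    weighted_int p b t)%E.
  rewrite weighted_int_if; apply: eq_integral_posR => x x0; rewrite {1}/g.
  by case: ifPn => [xt|_]; rewrite ?mul0e// mul1e primg.
have w0 := weighted_int_ge0 p t (Lplus_normal_form bnf).
rewrite /c2 poweRM ?lee_fin ?(ltW p'0)// poweR_EFin => H.
rewrite poweRM ?lee_fin ?divr_ge0 ?(ltW p'0) ?(ltW q'0)// poweR_EFin.
rewrite muleA muleA -!EFinM.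
have -> : q' `^ p'^-1 * t `^ (- q'^-1) * (p' / q') `^ p'^-1 = (t `^ q'^-1)^-1 * p' `^ p'^-1.
  have qV0 : 0 <= q'^-1 by rewrite invr_ge0 ltW.
  rewrite powRN (powRM _ (ltW p'0) qV0) (powR_inv _ q'0).
  by field; rewrite !gt_eqF ?powR_gt0.
by rewrite EFinM -muleA lee_pdivrMl ?powR_gt0// [leRHS]muleC.
Qed.

Hypothesis pq : p <= q.
Let K := Kconst p q.

Let K0 : 0 < K. Proof. by have [] := Kconst_extremal p1 q1 pq. Qed.

(** The transfer has constant [C = l^(-p')], hence [C^(1/p') = 1/l]: [D / l] is admissible for [a],
    and sharpness at one end gives [K <= D / l]. *)
Let K_le (a : R -> \bar R) (l d : R) : 0 < l -> normal_form a ->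
  (forall t, 0 < t -> (weighted_int p a t <= (l `^ (- p'))%:E * weighted_int p b t)%E) ->
  0 < d ->
  (forall x, 0 < x -> x < d -> (bk x <= a x)%E) \/
  (forall x, 0 < x -> d < x -> (bk x <= a x)%E) -> l <= D / K.
Proof.
move=> l0 anf ab d0 bka; rewrite ler_pdivlMr// mulrC -ler_pdivlMr//.
have admA := weighted_transfer anf bnf (powR_ge0 _ _) D0 ab adm.
have [_ _ H] := Kconst_extremal p1 q1 pq.
have := H a _ d _ (Lplus_normal_form anf) admA d0 bka.
rewrite -powRrM mulNr divff ?gt_eqF// powRN powRr1 ?(ltW l0)// mulrC; apply.
by rewrite divr_ge0// ltW.
Qed.

Let DK0 : 0 <= D / K. Proof. by rewrite divr_ge0// ltW. Qed.

Lemma A2_0_lower : (K%:E * A2_0 p q b <= D%:E)%E.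
Proof.
rewrite -lee_pdivlMl// -EFinM mulrC; apply: le_of_lt_EFin => // l l0.
move=> /limf_einf_gt[A [e /= e0 HA] lA].
(* Half the radius, so that the cut point itself satisfies [l < c2]. Beyond it the cut weight adds
   nothing, while the integral of [b] can only grow. *)
have e20 : 0 < e / 2 by rewrite divr_gt0.
have lc t : 0 < t -> t <= e / 2 -> (l%:E < c2 p q b t)%E.
  move=> t0 te; apply: lA; apply: HA => //=.
  by rewrite sub0r normrN gtr0_norm//; lra.
have Lb := Lplus_normal_form bnf.
have La := Lplus_normal_form (normal_form_cut (e / 2)).
apply: (K_le l0 (normal_form_cut (e / 2)) _ e20); last first.
  by left=> x x0 xe; rewrite xe.
have Lk := Lplus_pow_kernel (q / p').
have abk (x : R) : 0 < x -> ((if (x < e / 2)%R then bk x else 0) <= bk x)%E.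
  by move=> x0; case: ifP => // _; exact: Lk.2.
move=> t t0; have [te|et] := leP t (e / 2).
  apply: le_trans (weighted_int_ge_c2 bnf l0 t0 (lc _ t0 te)).
  by apply: le_weighted_int => // x x0 _; exact: abk.
apply: (@le_trans _ _ (weighted_int p bk (e / 2))).
  rewrite !weighted_int_if.
  apply: (le_integral_posR (Lplus_weighted_if _ La) (Lplus_weighted_if _ Lk)) => x x0.
  case: (ltP x (e / 2)) => [xe|_]; first by rewrite (lt_trans xe et).
  by rewrite mule0; case: ifP.
apply: le_trans (weighted_int_ge_c2 bnf l0 e20 (lc _ e20 (lexx _))) _.
apply: lee_wpmul2l; first by rewrite lee_fin powR_ge0.
rewrite !weighted_int_if.
apply: (le_integral_posR (Lplus_weighted_if _ Lb) (Lplus_weighted_if _ Lb)) => x x0.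
case: ifPn => [xe|_]; first by rewrite (lt_trans xe et).
by case: ifP => // _; rewrite mule_ge0 ?lee_fin ?powR_ge0//; exact: Lb.2.
Qed.

(** Removing the kernel below [T] would destroy monotonicity, so it is made constant there. For
    [t < T] the flat weight has integral proportional to [t^p'], while that of [b] falls no faster
    by [weighted_int_ratio]; the comparison at [T] therefore passes to [t]. *)
Lemma A2_oo_lower : (K%:E * A2_oo p q b <= D%:E)%E.
Proof.
rewrite -lee_pdivlMl// -EFinM mulrC; apply: le_of_lt_EFin => // l l0.
move=> /limf_einf_gt[A [M [_ HA]] lA].
pose T := Num.max M 0 + 1.
have MT : M < T by rewrite ltr_pwDr// le_max lexx.
have T0 : 0 < T by rewrite ltr_pwDr// le_max lexx orbT.
have lc t : T <= t -> (l%:E < c2 p q b t)%E.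
  by move=> Tt; apply: lA; apply: HA; exact: lt_le_trans Tt.
have Lb := Lplus_normal_form bnf; have Lk := Lplus_pow_kernel (q / p').
have anf := normal_form_flat T0; have La := Lplus_normal_form anf.
apply: (K_le l0 anf _ T0); last first.
  by right=> x x0 Tx; rewrite max_l// ltW.
have bknf := normal_form_pow_kernel sg0.
have lp0 : (0 <= (l `^ (- p'))%:E)%E by rewrite lee_fin powR_ge0.
move=> t t0; have [Tt|tT] := leP T t.
  apply: le_trans (weighted_int_ge_c2 bnf l0 t0 (lc _ Tt)).
  by apply: le_weighted_int => // x x0 _; apply: bknf.2 => //; rewrite le_max lexx.
have bT0 : (0 <= bk T)%E by exact: bknf.1.
have aE u : 0 < u -> u <= T ->
    weighted_int p (fun x => bk (Num.max x T)) u = (bk T * (u `^ p' / p')%:E)%E.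
  move=> u0 uT; rewrite -(weighted_int_cst bT0 u0); apply: eq_integral => x /set_mem /=.
  by rewrite in_itv/= => /andP[_ xu]; rewrite (max_r (ltW (lt_le_trans xu uT))).
have tT0 : 0 < T / t by rewrite divr_gt0.
have rE : ((T / t) `^ p' * (t `^ p' / p') = T `^ p' / p').
  by rewrite mulrA -powRM ?divr_ge0 ?ltW// divfK// gt_eqF.
(* Multiplication by [(T/t)^p'] turns the flat integral up to [t] into the one up to [T]. *)
rewrite -(@lee_pmul2l _ ((T / t) `^ p')%:E) ?lte_fin ?powR_gt0//.
have scaled (c : \bar R) (x y z : R) : x * y = z -> (x%:E * (c * y%:E) = c * z%:E)%E.
  by move=> <-; rewrite muleCA -EFinM.
rewrite (aE _ t0 (ltW tT)) (scaled _ _ _ _ rE) -(aE _ T0 (lexx _)).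
apply: (@le_trans _ _ (weighted_int p bk T)).
  by apply: le_weighted_int => // x x0 _; apply: bknf.2 => //; rewrite le_max lexx.
apply: le_trans (weighted_int_ge_c2 bnf l0 T0 (lc _ (lexx _))) _.
rewrite muleCA; apply: lee_wpmul2l => //.
exact: (weighted_int_ratio bnf t0 (ltW tT)).
Qed.

End lower.

Lemma A2_upper (b : R -> \bar R) : p <= q -> normal_form b ->
  (Nconst p q b <= (Kconst p q)%:E * A2 p q b)%E.
Proof.
move=> pq bnf; have [K0 adm _] := Kconst_extremal p1 q1 pq.
have Lb := Lplus_normal_form bnf.
have c2A t : 0 < t -> (c2 p q b t <= A2 p q b)%E.
  by move=> t0; apply: ereal_sup_ubound; exists t => //; rewrite posRE.
have : (0 <= A2 p q b)%E by apply: le_trans (c2A _ ltr01); exact: c2_ge0.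
move: c2A; case: (A2 p q b) => [A| |] c2A// A0; last by rewrite gt0_muley ?lte_fin// leey.
rewrite lee_fin in A0.
(* [c2 <= A] compares [b] with the power kernel at constant [A^p'], whose power [1/p'] is [A]. *)
have ab t : 0 < t -> (weighted_int p b t <= (A `^ p')%:E * weighted_int p bk t)%E.
  move=> t0; rewrite (weighted_int_c2 p1 q1 Lb t0) -poweR_EFin.
  apply: lee_wpmul2r; first exact: weighted_int_ge0 (Lplus_pow_kernel _).
  by apply: le_poweR (c2A _ t0); [exact: ltW|exact: c2_ge0].
have := weighted_transfer bnf (normal_form_pow_kernel sg0) (powR_ge0 A p') (ltW K0) ab adm.
rewrite -powRrM divff ?gt_eqF// powRr1// -EFinM mulrC.
by apply: (Nconst_le p0 q0 Lb); rewrite mulr_ge0// ltW.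
Qed.

End main_bounds.

Theorem theorem3p18 (R : realType) (p q : R) (a b : R -> \bar R) (C : R)
    (p_gt1 : 1 < p) (q_gt1 : 1 < q)
    (a_nf : normal_form a) (b_nf : normal_form b) (C_gt0 : 0 < C) :
  [/\ (forall t : R, 0 < t ->
         (weighted_int p a t <= C%:E * weighted_int p b t)%E) ->
      (Nconst p q a <= (C `^ (conjexp p)^-1)%:E * Nconst p q b)%E,
      p <= q ->
      (maxe (((conjexp q) `^ (conjexp p)^-1)%:E * A2 p q b)
            (maxe ((Kconst p q)%:E * A2_0 p q b)
                  ((Kconst p q)%:E * A2_oo p q b))
         <= Nconst p q b)%E /\
      (Nconst p q b <= (Kconst p q)%:E * A2 p q b)%E
    & p <= q -> A2_0 p q b = A2 p q b \/ A2_oo p q b = A2 p q b ->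
      Nconst p q b = ((Kconst p q)%:E * A2 p q b)%E].
Proof.
have p_gt0 : 0 < p by exact: lt_trans p_gt1.
have q_gt0 : 0 < q by exact: lt_trans q_gt1.
have Lb := Lplus_normal_form b_nf.
have lower_0 : p <= q -> ((Kconst p q)%:E * A2_0 p q b <= Nconst p q b)%E.
  move=> pq; apply: (Nconst_ge p_gt0 q_gt0 Lb) => D D0 adm.
  exact: (A2_0_lower p_gt1 q_gt1 b_nf D0 adm pq).
have lower_oo : p <= q -> ((Kconst p q)%:E * A2_oo p q b <= Nconst p q b)%E.
  move=> pq; apply: (Nconst_ge p_gt0 q_gt0 Lb) => D D0 adm.
  exact: (A2_oo_lower p_gt1 q_gt1 b_nf D0 adm pq).
split.
- exact: Nconst_transfer.
- move=> pq; split; last exact: A2_upper.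
  rewrite !ge_max lower_0// lower_oo// !andbT.
  apply: (Nconst_ge p_gt0 q_gt0 Lb) => D D0 adm.
  exact: (A2_lower p_gt1 q_gt1 b_nf D0 adm).
- move=> pq H; apply/eqP; rewrite eq_le A2_upper//=.
  by case: H => <-; [exact: lower_0|exact: lower_oo].
Qed.
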